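(* Let $X=\{a_0x_0^3+a_1x_1^3+a_2x_2^3+a_3x_3^3=0\}\subset\mathbb{P}^3\times\mathbb{P}^3$ over $\mathbb{Q}$, with $\pi:X\to\mathbb{P}^3$ the projection to $(a_0:\dots:a_3)$. Then the proportion $$\sigma=\lim_{B\to\infty}\frac{\#\{P\in\mathbb{P}^3(\mathbb{Q}):H(P)\le B,\ X_P(\mathbf{A}_\mathbb{Q})\ne\emptyset\}}{\#\{P\in\mathbb{P}^3(\mathbb{Q}):H(P)\le B\}}$$ exists and equals $\sigma=\sigma_3\prod_{p\equiv1\bmod 3}\sigma_p$, where $$\sigma_p=\frac{(1-1/p)^3}{(1-1/p^3)^3}\Big(1-\frac1p+\frac1{p^2}\Big)\Big(1+\frac1p+\frac1{3p^2}\Big)\Big(1+\frac3p+\frac3{p^2}\Big)\quad(p\equiv1\bmod3),$$ $$\sigma_3=\frac{(1-1/3)^3}{(1-1/27)^3}\Big(1+\frac33+\frac{46}{9\cdot 9}+\frac{7}{27}+\frac{62}{9\cdot 81}+\frac{19}{9\cdot 243}+\frac1{729}\Big),$$ i.e. $\sigma_3$ is the value at $p=3$ of $\frac{(1-1/p)^3}{(1-1/p^3)^3}\big(1+\frac3p+\frac{46}{9p^2}+\frac7{p^3}+\frac{62}{9p^4}+\frac{19}{9p^5}+\frac1{p^6}\big)$.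
   Context: $H$ is the standard height on $\mathbb{P}^3(\mathbb{Q})$: $H(a_0:\dots:a_3)=\max|a_i|$ for coprime integers $a_i$. $X_P$ is the fibre $\pi^{-1}(P)$, the diagonal cubic surface with coefficients $P$. *)

(* Defs.v *)
From Stdlib Require Import Reals ZArith List Znumtheory ClassicalEpsilon.
Import ListNotations.

Definition Z4 := (Z * Z * Z * Z)%type.

Definition diag_cubic (a x : Z4) : Z :=
  let '(a0, a1, a2, a3) := a in
  let '(x0, x1, x2, x3) := x in
  (a0 * x0 ^ 3 + a1 * x1 ^ 3 + a2 * x2 ^ 3 + a3 * x3 ^ 3)%Z.

(* Canonical representatives of P^3(Q): coprime integer quadruples whose
   first nonzero coordinate is positive (this picks one of the two
   primitive representatives +-(a0,...,a3)). *)
Definition P3Q_point (a : Z4) : Prop :=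
  let '(a0, a1, a2, a3) := a in
  Z.gcd (Z.gcd (Z.gcd a0 a1) a2) a3 = 1%Z /\
  ((0 < a0)%Z \/ (a0 = 0 /\ 0 < a1)%Z \/ (a0 = 0 /\ a1 = 0 /\ 0 < a2)%Z
   \/ (a0 = 0 /\ a1 = 0 /\ a2 = 0 /\ 0 < a3)%Z).

Definition height (a : Z4) : Z :=
  let '(a0, a1, a2, a3) := a in
  Z.max (Z.max (Z.abs a0) (Z.abs a1)) (Z.max (Z.abs a2) (Z.abs a3)).

Definition real_soluble (a : Z4) : Prop :=
  let '(a0, a1, a2, a3) := a in
  exists x0 x1 x2 x3 : R,
    ~ (x0 = 0 /\ x1 = 0 /\ x2 = 0 /\ x3 = 0)%R /\
    (IZR a0 * x0 ^ 3 + IZR a1 * x1 ^ 3 + IZR a2 * x2 ^ 3 + IZR a3 * x3 ^ 3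
     = 0)%R.

(* A p-adic integer, as an element of the inverse limit lim Z/p^k Z:
   a sequence u with u k representing the residue mod p^k, coherent. *)
Definition padic_int (p : Z) (u : nat -> Z) : Prop :=
  forall k : nat, (p ^ Z.of_nat k | u (S k) - u k)%Z.

(* Q_p-points of X_P: every point of P^3(Q_p) has a primitive Z_p
   representative (coordinates in Z_p, not all divisible by p); it lies
   on X_P iff the form vanishes in Z_p, i.e. mod p^k for every k. *)
Definition padic_soluble (p : Z) (a : Z4) : Prop :=
  exists x0 x1 x2 x3 : nat -> Z,
    padic_int p x0 /\ padic_int p x1 /\ padic_int p x2 /\ padic_int p x3 /\
    ~ ((p | x0 1%nat) /\ (p | x1 1%nat) /\ (p | x2 1%nat) /\ (p | x3 1%nat))%Z /\
    forall k : nat,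
      (p ^ Z.of_nat k | diag_cubic a (x0 k, x1 k, x2 k, x3 k))%Z.

Definition adelic_soluble (a : Z4) : Prop :=
  real_soluble a /\ forall p : Z, prime p -> padic_soluble p a.

Definition Zrange (n : nat) : list Z :=
  map (fun i => (Z.of_nat i - Z.of_nat n)%Z) (seq 0 (2 * n + 1)).

Definition box (n : nat) : list Z4 :=
  list_prod (list_prod (list_prod (Zrange n) (Zrange n)) (Zrange n)) (Zrange n).

Definition decP (P : Prop) : bool :=
  if excluded_middle_informative P then true else false.

(* #{ P in P^3(Q) : H(P) <= B, Q P } ; the box of radius up B contains
   every point of height <= B. *)
Definition count_points (B : R) (Q : Z4 -> Prop) : nat :=
  length (filter (fun a => decP (P3Q_point a /\ (IZR (height a) <= B)%R /\ Q a))
                 (box (Z.to_nat (up B)))).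

Definition density_ratio (B : R) : R :=
  (INR (count_points B adelic_soluble) / INR (count_points B (fun _ => True)))%R.

Definition sigma_p (p : R) : R :=
  ((1 - 1/p) ^ 3 / (1 - 1/p^3) ^ 3 *
   (1 - 1/p + 1/p^2) * (1 + 1/p + 1/(3 * p^2)) * (1 + 3/p + 3/p^2))%R.

Definition sigma_3 : R :=
  ((1 - 1/3) ^ 3 / (1 - 1/27) ^ 3 *
   (1 + 3/3 + 46/(9*9) + 7/27 + 62/(9*81) + 19/(9*243) + 1/729))%R.

Fixpoint partial_prod (N : nat) : R :=
  match N with
  | O => 1%R
  | S n =>
      (partial_prod n *
       (if prime_dec (Z.of_nat (S n)) then
          if Z.eq_dec (Z.of_nat (S n) mod 3) 1 then sigma_p (INR (S n)) else 1
        else 1))%R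
  end.

(* Main.v *)
Require Import Defs.
From Stdlib Require Import Reals ZArith List Znumtheory ClassicalEpsilon.
From Stdlib Require Import Lia Lra Psatz Permutation Zpow_facts Bool.
Import ListNotations.
Local Open Scope R_scope.

(** Real points always exist, and so do p-adic points for p = 2 mod 3, where every unit is
    a cube.  For p = 3 and p = 1 mod 3, solubility of the diagonal cubic at p depends only
    on the valuations mod 3 of the coefficients and on the classes of their unit parts
    modulo cubes.  These data are equidistributed and independent for different primes, so
    the integer vectors soluble at 3 and at all p = 1 mod 3 with p <= N have density
    sigma_3 times the product of the sigma_p.  Insolubility at a prime p = 1 mod 3 forces p
    to divide two nonzero coefficients, so the primes p > N change the density by O(1/N).
    Finally, solubility is invariant under scaling, hence all integer vectors and primitive
    ones are compared by sorting vectors according to their gcd. *)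

(** * Finite sums and indicators *)

(** Limits are taken only for a fixed finite set of primes, so no error term has to be uniform in
    the modulus. Independence of the primes comes from an induction that peels off one prime and
    absorbs its conditions into a weight on each coordinate separately. Uniformity is needed only
    for primes beyond [N]: there only nonzero multiples of [p] are counted, at most [2n/p] in a
    symmetric interval, with no additive constant, so the bounds can be summed up to [n]. Vectors
    with a zero coordinate have no valuation data and are split off, at a relative cost [O(1/n)].
    Locally, exponents modulo 3 leave coefficients [p^v u] with [v < 3], so every obstruction is
    visible modulo [p^3]. For three units of different classes modulo [p], a point on the diagonal
    cubic curve comes from a counting argument on consecutive classes, without the Hasse bound. For
    primitive points the value of zeta at 4 never appears: the count of soluble points minus
    [sigma_3 * L] times the count of all points is bounded directly, by inverting a divisor sum
    through contraction. *)

Definition lsum {A : Type} (l : list A) (f : A -> R) : R :=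
  fold_right (fun a s => f a + s) 0 l.

Definition indic (P : Prop) : R := if decP P then 1 else 0.

Lemma decP_true (P : Prop) : decP P = true <-> P.
Proof.
  unfold decP; destruct (excluded_middle_informative P); split; intros; easy || contradiction.
Qed.

Lemma ind_1 (P : Prop) : P -> indic P = 1.
Proof. intros H; unfold indic; apply decP_true in H; now rewrite H. Qed.

Lemma ind_0 (P : Prop) : ~ P -> indic P = 0.
Proof.
  intros H; unfold indic; destruct (decP P) eqn:E; auto.
  rewrite decP_true in E; contradiction.
Qed.

Lemma ind_cases (P : Prop) : (P /\ indic P = 1) \/ (~ P /\ indic P = 0).
Proof.
  destruct (classic P); [left | right]; split; auto using ind_1, ind_0.
Qed.

Lemma ind_bounds (P : Prop) : 0 <= indic P <= 1.
Proof. destruct (ind_cases P) as [[_ ->] | [_ ->]]; lra. Qed.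

Lemma ind_ext (P Q : Prop) : (P <-> Q) -> indic P = indic Q.
Proof.
  intros H; destruct (ind_cases P) as [[h ->] | [h ->]];
    destruct (ind_cases Q) as [[h' ->] | [h' ->]]; tauto.
Qed.

Lemma ind_and (P Q : Prop) : indic (P /\ Q) = indic P * indic Q.
Proof.
  destruct (ind_cases P) as [[h ->] | [h ->]];
    destruct (ind_cases Q) as [[h' ->] | [h' ->]];
    destruct (ind_cases (P /\ Q)) as [[h'' ->] | [h'' ->]]; try lra; tauto.
Qed.

Lemma ind_le (P Q : Prop) : (P -> Q) -> indic P <= indic Q.
Proof.
  intros H; destruct (ind_cases P) as [[h ->] | [h ->]];
    destruct (ind_cases Q) as [[h' ->] | [h' ->]]; try lra; tauto.
Qed.

Section ListSums.
Context {A : Type}.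
Implicit Types (l : list A) (f g : A -> R).

Lemma lsum_ext_in l f g : (forall x, In x l -> f x = g x) -> lsum l f = lsum l g.
Proof.
  induction l as [|x l IH]; simpl; intros H; auto.
  rewrite (H x), IH; auto.
Qed.

Lemma lsum_ext l f g : (forall x, f x = g x) -> lsum l f = lsum l g.
Proof. intros H; apply lsum_ext_in; auto. Qed.

Lemma lsum_plus l f g : lsum l (fun x => f x + g x) = lsum l f + lsum l g.
Proof. induction l; simpl; [|rewrite IHl]; lra. Qed.

Lemma lsum_scal l c f : lsum l (fun x => c * f x) = c * lsum l f.
Proof. induction l; simpl; [|rewrite IHl]; lra. Qed.

Lemma lsum_scal_r l c f : lsum l (fun x => f x * c) = lsum l f * c.
Proof. induction l; simpl; [|rewrite IHl]; lra. Qed.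

Lemma lsum_minus l f g : lsum l (fun x => f x - g x) = lsum l f - lsum l g.
Proof. induction l; simpl; [|rewrite IHl]; lra. Qed.

Lemma lsum_const l c : lsum l (fun _ => c) = INR (length l) * c.
Proof.
  induction l; [simpl; lra|].
  change (length (a :: l)) with (S (length l)); rewrite S_INR; simpl; rewrite IHl; lra.
Qed.

Lemma lsum_0 l : lsum l (fun _ => 0) = 0.
Proof. rewrite lsum_const; lra. Qed.

Lemma lsum_le_in l f g : (forall x, In x l -> f x <= g x) -> lsum l f <= lsum l g.
Proof.
  induction l as [|x l IH]; simpl; intros H; [lra|].
  apply Rplus_le_compat; auto.
Qed.

Lemma lsum_le l f g : (forall x, f x <= g x) -> lsum l f <= lsum l g.
Proof. intros H; apply lsum_le_in; auto. Qed.

Lemma lsum_nonneg l f : (forall x, 0 <= f x) -> 0 <= lsum l f.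
Proof. intros H; rewrite <- (lsum_0 l); apply lsum_le; auto. Qed.

Lemma lsum_abs l f : Rabs (lsum l f) <= lsum l (fun x => Rabs (f x)).
Proof.
  induction l; simpl; [rewrite Rabs_R0; lra|].
  eapply Rle_trans; [apply Rabs_triang|]; lra.
Qed.

Lemma lsum_app l l' f : lsum (l ++ l') f = lsum l f + lsum l' f.
Proof. induction l; simpl; [|rewrite IHl]; lra. Qed.

Lemma lsum_ind_filter l (P : A -> Prop) :
  lsum l (fun x => indic (P x)) = INR (length (filter (fun x => decP (P x)) l)).
Proof.
  induction l as [|x l IH]; auto.
  simpl lsum; simpl filter; rewrite IH; unfold indic; destruct (decP (P x)).
  - change (length (x :: ?u)) with (S (length u)); rewrite S_INR; lra.
  - lra.
Qed.

Lemma lsum_ind_le_1 l (P : A -> Prop) : NoDup l ->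
  (forall x y, In x l -> In y l -> P x -> P y -> x = y) ->
  lsum l (fun x => indic (P x)) <= 1.
Proof.
  induction l as [|x l IH]; intros Hd H; simpl; [lra|].
  inversion Hd; subst.
  destruct (ind_cases (P x)) as [[h ->] | [h ->]].
  - rewrite (lsum_ext_in l _ (fun _ => 0)), lsum_0; [lra|].
    intros y Hy; apply ind_0; intros Py.
    assert (x = y) by (apply H; simpl; auto); subst; contradiction.
  - assert (lsum l (fun x => indic (P x)) <= 1); [|lra].
    apply IH; auto; intros; apply H; simpl; auto.
Qed.

Lemma lsum_ind_unique l (P : A -> Prop) a : NoDup l -> In a l -> P a ->
  (forall x, In x l -> P x -> x = a) -> lsum l (fun x => indic (P x)) = 1.
Proof.
  intros Hd Ha Pa H; apply Rle_antisym.
  - apply lsum_ind_le_1; auto; intros x y Hx Hy Px Py.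
    rewrite (H x), (H y); auto.
  - clear Hd H; induction l as [|x l IH]; simpl in *; [tauto|].
    assert (H0 := ind_bounds (P x)).
    assert (H1 : 0 <= lsum l (fun x => indic (P x)))
      by (apply lsum_nonneg; intros; apply ind_bounds).
    destruct Ha as [->|Ha]; [rewrite ind_1; auto; lra|].
    specialize (IH Ha); lra.
Qed.
End ListSums.

Lemma lsum_map {A B} (h : A -> B) l f : lsum (map h l) f = lsum l (fun x => f (h x)).
Proof. induction l; simpl; congruence. Qed.

Lemma lsum_list_prod {A B} (l : list A) (l' : list B) f :
  lsum (list_prod l l') f = lsum l (fun a => lsum l' (fun b => f (a, b))).
Proof.
  induction l; simpl; auto.
  rewrite lsum_app, lsum_map, IHl; reflexivity.
Qed.

Lemma lsum_swap {A B} (l : list A) (l' : list B) f :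
  lsum l (fun a => lsum l' (fun b => f a b)) = lsum l' (fun b => lsum l (fun a => f a b)).
Proof.
  induction l; simpl; [symmetry; apply lsum_0|].
  now rewrite IHl, lsum_plus.
Qed.

Lemma NoDup_map_in {A B} (h : A -> B) l : NoDup l ->
  (forall x y, In x l -> In y l -> h x = h y -> x = y) -> NoDup (map h l).
Proof.
  induction 1 as [|x l Hx Hd IH]; intros H; simpl; constructor.
  - intros Hin; apply in_map_iff in Hin; destruct Hin as [y [E Hy]].
    assert (y = x) by (apply H; simpl; auto); subst; contradiction.
  - apply IH; intros; apply H; simpl; auto.
Qed.

Lemma lsum_ind_bij {A B} (l : list A) (l' : list B) (h : A -> B)
    (P : A -> Prop) (Q : B -> Prop) :
  NoDup l -> NoDup l' ->
  (forall x y, In x l -> In y l -> P x -> P y -> h x = h y -> x = y) ->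
  (forall x, In x l -> P x -> In (h x) l' /\ Q (h x)) ->
  (forall y, In y l' -> Q y -> exists x, In x l /\ P x /\ h x = y) ->
  lsum l (fun x => indic (P x)) = lsum l' (fun y => indic (Q y)).
Proof.
  intros Hd Hd' Hinj Hto Hfrom.
  rewrite !lsum_ind_filter; f_equal.
  rewrite <- (length_map h).
  apply Permutation_length, NoDup_Permutation.
  - apply NoDup_map_in; [now apply NoDup_filter|].
    intros x y Hx Hy; apply filter_In in Hx, Hy.
    destruct Hx as [Hx Px], Hy as [Hy Py]; apply Hinj; auto; now apply decP_true.
  - now apply NoDup_filter.
  - intros y; rewrite in_map_iff, filter_In, decP_true; split.
    + intros [x [E Hx]]; apply filter_In in Hx; destruct Hx as [Hx Px].
      subst; apply Hto; auto; now apply decP_true.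
    + intros [Hy Qy]; destruct (Hfrom y Hy Qy) as [x [Hx [Px E]]].
      exists x; split; auto; apply filter_In; split; auto; now apply decP_true.
Qed.

(** * Sums over intervals and boxes *)

Lemma in_Zrange n k : In k (Zrange n) <-> (Z.abs k <= Z.of_nat n)%Z.
Proof.
  unfold Zrange; rewrite in_map_iff; split.
  - intros [i [<- Hi]]; apply in_seq in Hi; lia.
  - intros H; exists (Z.to_nat (k + Z.of_nat n)); split; [lia|].
    apply in_seq; lia.
Qed.

Lemma NoDup_Zrange n : NoDup (Zrange n).
Proof.
  apply NoDup_map_in; [apply seq_NoDup|]; intros; lia.
Qed.

Lemma length_Zrange n : length (Zrange n) = (2 * n + 1)%nat.
Proof. unfold Zrange; now rewrite length_map, length_seq. Qed.

Lemma NoDup_list_prod {A B} (l : list A) (l' : list B) :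
  NoDup l -> NoDup l' -> NoDup (list_prod l l').
Proof.
  induction 1 as [|x l Hx Hd IH]; intros H'; simpl; [constructor|].
  apply NoDup_app; auto.
  - apply NoDup_map_in; auto; intros; congruence.
  - intros [a b] H1 H2; apply in_map_iff in H1; destruct H1 as [c [E _]].
    injection E as <- <-; apply in_prod_iff in H2; tauto.
Qed.

Lemma NoDup_box n : NoDup (box n).
Proof. unfold box; repeat apply NoDup_list_prod; apply NoDup_Zrange. Qed.

Lemma in_box n a : In a (box n) <-> (height a <= Z.of_nat n)%Z.
Proof.
  destruct a as [[[a0 a1] a2] a3]; unfold box, height, Z4.
  rewrite !in_prod_iff, !in_Zrange; lia.
Qed.

Lemma lsum_box n f : lsum (box n) f =
  lsum (Zrange n) (fun a0 => lsum (Zrange n) (fun a1 => lsum (Zrange n) (fun a2 =>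
    lsum (Zrange n) (fun a3 => f (a0, a1, a2, a3))))).
Proof. unfold box, Z4; now rewrite !lsum_list_prod. Qed.

Definition vol (n : nat) : R := INR (2 * n + 1).

Lemma vol_pos n : 1 <= vol n.
Proof. unfold vol; rewrite plus_INR; assert (H := pos_INR (2 * n)); simpl INR at 2; lra. Qed.

Lemma vol_eq n : vol n = 2 * INR n + 1.
Proof. unfold vol; rewrite plus_INR, mult_INR; simpl; lra. Qed.

Lemma lsum_Zrange_const n c : lsum (Zrange n) (fun _ => c) = vol n * c.
Proof. now rewrite lsum_const, length_Zrange. Qed.

Lemma lsum_box_mult n (f0 f1 f2 f3 : Z -> R) :
  lsum (box n) (fun '(a0, a1, a2, a3) => f0 a0 * f1 a1 * f2 a2 * f3 a3) =
  lsum (Zrange n) f0 * lsum (Zrange n) f1 * lsum (Zrange n) f2 * lsum (Zrange n) f3.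
Proof.
  rewrite lsum_box.
  rewrite !Rmult_assoc, <- lsum_scal_r; apply lsum_ext; intros a0.
  rewrite <- lsum_scal_r, <- lsum_scal; apply lsum_ext; intros a1.
  rewrite <- lsum_scal_r, <- !lsum_scal; apply lsum_ext; intros a2.
  rewrite <- !lsum_scal; apply lsum_ext; intros a3; ring.
Qed.

(** * Mean values over symmetric intervals *)

Definition mean1 (f : Z -> R) (d : R) : Prop :=
  Un_cv (fun n => lsum (Zrange n) f / vol n) d.

Lemma Un_cv_ext (u v : nat -> R) l : (forall n, u n = v n) -> Un_cv u l -> Un_cv v l.
Proof.
  intros E H eps Heps; destruct (H eps Heps) as [N HN]; exists N.
  intros n Hn; rewrite <- E; auto.
Qed.

Lemma Un_cv_const c : Un_cv (fun _ => c) c.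
Proof. intros eps Heps; exists O; intros; unfold Rdist; rewrite Rminus_diag, Rabs_R0; lra. Qed.

Lemma Un_cv_lsum {A} (l : list A) (u : A -> nat -> R) (d : A -> R) :
  (forall x, In x l -> Un_cv (u x) (d x)) ->
  Un_cv (fun n => lsum l (fun x => u x n)) (lsum l d).
Proof.
  induction l as [|x l IH]; intros H; simpl; [apply Un_cv_const|].
  apply (CV_plus (u x)); [apply H | apply IH; intros; apply H]; simpl; auto.
Qed.

Lemma inv_vol_cv : Un_cv (fun n => / vol n) 0.
Proof.
  intros eps Heps; destruct (archimed_cor1 eps Heps) as [N [HN HN0]]; exists N.
  intros n Hn; unfold Rdist; rewrite Rminus_0_r, Rabs_right.
  - apply Rle_lt_trans with (/ INR N); auto; apply Rinv_le_contravar.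
    + now apply lt_0_INR.
    + apply le_INR; lia.
  - apply Rle_ge, Rlt_le, Rinv_0_lt_compat; assert (H := vol_pos n); lra.
Qed.

Lemma mean1_ext f g d : (forall k, f k = g k) -> mean1 f d -> mean1 g d.
Proof.
  intros E; apply Un_cv_ext; intros n; now rewrite (lsum_ext _ f g).
Qed.

Lemma mean1_lsum {A} (l : list A) (F : A -> Z -> R) (d : A -> R) :
  (forall x, In x l -> mean1 (F x) (d x)) ->
  mean1 (fun k => lsum l (fun x => F x k)) (lsum l d).
Proof.
  intros H; unfold mean1.
  apply Un_cv_ext with (fun n => lsum l (fun x => lsum (Zrange n) (F x) / vol n)).
  - intros n; unfold Rdiv; now rewrite lsum_scal_r, lsum_swap.
  - now apply Un_cv_lsum.
Qed.

(** Squeezing with two limits: [J] is fixed first so that the limits of the means are close, and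
    only then is [n] sent to infinity. This lets a set that is a countable union of residue classes
    be exhausted by finite unions. *)
Lemma mean1_approx f d (g h : nat -> Z -> R) (dg dh : nat -> R) :
  (forall J k, g J k <= f k <= g J k + h J k) ->
  (forall J, mean1 (g J) (dg J)) -> (forall J, mean1 (h J) (dh J)) ->
  Un_cv dg d -> Un_cv dh 0 -> mean1 f d.
Proof.
  intros Hb Hg Hh Cg Ch eps Heps.
  destruct (Cg (eps / 4)) as [J1 H1]; [lra|].
  destruct (Ch (eps / 4)) as [J2 H2]; [lra|].
  set (J := max J1 J2).
  specialize (H1 J ltac:(lia)); specialize (H2 J ltac:(lia)).
  destruct (Hg J (eps / 4)) as [N1 H3]; [lra|].
  destruct (Hh J (eps / 4)) as [N2 H4]; [lra|].
  exists (max N1 N2); intros n Hn.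
  specialize (H3 n ltac:(lia)); specialize (H4 n ltac:(lia)).
  assert (V := vol_pos n); unfold Rdist in *.
  assert (I1 : lsum (Zrange n) (g J) / vol n <= lsum (Zrange n) f / vol n).
  { apply Rmult_le_compat_r; [apply Rlt_le, Rinv_0_lt_compat; lra|].
    apply lsum_le; intros; apply Hb. }
  assert (I2 : lsum (Zrange n) f / vol n <=
               lsum (Zrange n) (g J) / vol n + lsum (Zrange n) (h J) / vol n).
  { unfold Rdiv; rewrite <- Rmult_plus_distr_r, <- lsum_plus.
    apply Rmult_le_compat_r; [apply Rlt_le, Rinv_0_lt_compat; lra|].
    apply lsum_le; intros; apply Hb. }
  apply Rabs_def2 in H1, H2, H3, H4; apply Rabs_def1; lra.
Qed.

(** * Counting integers in a residue class *)

Lemma lsum_telescope (g : Z -> R) c L :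
  lsum (map (fun i => (Z.of_nat i - c)%Z) (seq 0 L)) (fun k => g k - g (k - 1)%Z) =
  g (Z.of_nat L - 1 - c)%Z - g (- 1 - c)%Z.
Proof.
  induction L as [|L IH].
  - simpl; ring.
  - rewrite seq_S, map_app, lsum_app, IH; simpl lsum.
    replace (Z.of_nat L - c - 1)%Z with (Z.of_nat L - 1 - c)%Z by lia.
    replace (Z.of_nat (S L) - 1 - c)%Z with (Z.of_nat L - c)%Z by lia.
    ring.
Qed.

(** The floor of [x / m] jumps by one exactly at multiples of [m]; as a discrete derivative the
    indicator then telescopes over an interval. *)
Lemma ind_divide_floor m x : (0 < m)%Z ->
  indic (m | x)%Z = IZR (x / m) - IZR ((x - 1) / m).
Proof.
  intros Hm; rewrite <- minus_IZR.
  assert (E := Z.div_mod x m ltac:(lia)); assert (B := Z.mod_pos_bound x m Hm).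
  destruct (Z.eq_dec (x mod m) 0) as [h|h].
  - rewrite ind_1 by now apply Z.mod_divide; [lia|].
    replace ((x - 1) / m)%Z with (x / m - 1)%Z.
    + f_equal; lia.
    + apply (Z.div_unique _ _ _ (m - 1)); lia.
  - rewrite ind_0 by (rewrite <- Z.mod_divide by lia; auto).
    replace ((x - 1) / m)%Z with (x / m)%Z.
    + f_equal; lia.
    + apply (Z.div_unique _ _ _ (x mod m - 1)); lia.
Qed.

Lemma count_residue n m r : (0 < m)%Z ->
  lsum (Zrange n) (fun k => indic (m | k - r)%Z) =
  IZR ((Z.of_nat n - r) / m) - IZR ((- Z.of_nat n - 1 - r) / m).
Proof.
  intros Hm; unfold Zrange.
  rewrite (lsum_ext _ _ (fun k => (fun y => IZR ((y - r) / m)) k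
                               - (fun y => IZR ((y - r) / m)) (k - 1)%Z)).
  - rewrite lsum_telescope; f_equal; apply f_equal, (f_equal (fun z => z / m)%Z); lia.
  - intros k; rewrite ind_divide_floor by auto; f_equal;
      apply f_equal, (f_equal (fun z => z / m)%Z); lia.
Qed.

Lemma floor_bounds x m : (0 < m)%Z -> IZR (x / m) <= IZR x / IZR m < IZR (x / m) + 1.
Proof.
  intros Hm; assert (Hm' : 0 < IZR m) by now apply IZR_lt.
  assert (E := Z.div_mod x m ltac:(lia)); assert (B := Z.mod_pos_bound x m Hm).
  rewrite <- plus_IZR; split.
  - apply Rmult_le_reg_r with (IZR m); auto.
    replace (IZR x / IZR m * IZR m) with (IZR x) by (field; lra).
    rewrite <- mult_IZR; apply IZR_le; lia.
  - apply Rmult_lt_reg_r with (IZR m); auto.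
    replace (IZR x / IZR m * IZR m) with (IZR x) by (field; lra).
    rewrite <- mult_IZR; apply IZR_lt; lia.
Qed.

Lemma mean1_residue m r : (0 < m)%Z -> mean1 (fun k => indic (m | k - r)%Z) (/ IZR m).
Proof.
  intros Hm; assert (Hm' : 0 < IZR m) by now apply IZR_lt.
  intros eps Heps; destruct (inv_vol_cv eps Heps) as [N HN]; exists N; intros n Hn.
  specialize (HN n Hn); assert (V := vol_pos n); unfold Rdist in *.
  rewrite Rminus_0_r in HN; apply Rabs_def2 in HN.
  rewrite count_residue by auto.
  assert (B1 := floor_bounds (Z.of_nat n - r) m Hm).
  assert (B2 := floor_bounds (- Z.of_nat n - 1 - r) m Hm).
  rewrite minus_IZR, <- INR_IZR_INZ in B1.
  rewrite !minus_IZR, opp_IZR, <- INR_IZR_INZ in B2.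
  set (q1 := IZR ((Z.of_nat n - r) / m)) in *;
    set (q2 := IZR ((- Z.of_nat n - 1 - r) / m)) in *.
  assert (E : (INR n - IZR r) / IZR m - (- INR n - 1 - IZR r) / IZR m = vol n * / IZR m)
    by (rewrite vol_eq; field; lra).
  (* Each floor lies below its quotient by less than 1, so the count is within 1 of [vol n / m],
     whatever [m] is. *)
  apply Rle_lt_trans with (/ vol n); [|lra].
  replace ((q1 - q2) / vol n - / IZR m) with ((q1 - q2 - vol n * / IZR m) * / vol n)
    by (field; lra).
  assert (0 < / vol n) by (apply Rinv_0_lt_compat; lra).
  rewrite Rabs_mult, (Rabs_right (/ vol n)) by lra.
  rewrite <- (Rmult_1_l (/ vol n)) at 2.
  apply Rmult_le_compat_r; [lra|].
  apply Rabs_le; lra.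
Qed.

(** Excluding 0 removes the additive constant that a general residue class would carry. Without it,
    the sum over all moduli between [N] and [n] in the tail estimate would not be controlled. *)
Lemma count_nonzero_multiples n m : (0 < m)%Z ->
  lsum (Zrange n) (fun k => indic (k <> 0 /\ (m | k))%Z) <= 2 * INR n / IZR m.
Proof.
  intros Hm.
  assert (H0 : lsum (Zrange n) (fun k => indic (k = 0)%Z) = 1).
  { apply lsum_ind_unique with 0%Z; auto using NoDup_Zrange; apply in_Zrange; lia. }
  assert (H : lsum (Zrange n) (fun k => indic (k <> 0 /\ (m | k))%Z) =
              lsum (Zrange n) (fun k => indic (m | k - 0)%Z) - 1).
  { rewrite <- H0, <- lsum_minus; apply lsum_ext; intros k.
    rewrite ind_and, Z.sub_0_r.
    destruct (Z.eq_dec k 0) as [->|h].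
    - rewrite (ind_0 (0 <> 0)%Z), (ind_1 (0 = 0)%Z), (ind_1 (m | 0)%Z);
        try lra; try lia; apply Z.divide_0_r.
    - rewrite (ind_1 (k <> 0)%Z), (ind_0 (k = 0)%Z) by auto; lra. }
  rewrite H, count_residue by auto.
  rewrite !Z.sub_0_r.
  (* Division rounds down, so the negative end gives minus the positive floor minus 1; the total is
     twice that floor plus 1, and the 1 is the multiple 0. *)
  assert (E : ((- Z.of_nat n - 1) / m = - (Z.of_nat n / m) - 1)%Z).
  { assert (E := Z.div_mod (Z.of_nat n) m ltac:(lia)).
    assert (B := Z.mod_pos_bound (Z.of_nat n) m Hm).
    symmetry; apply (Z.div_unique _ _ _ (m - 1 - Z.of_nat n mod m)); lia. }
  rewrite E, minus_IZR, opp_IZR.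
  assert (B := floor_bounds (Z.of_nat n) m Hm); rewrite <- INR_IZR_INZ in B.
  unfold Rdiv in *; lra.
Qed.

(** * Equidistribution of valuations and cubic classes *)

(* [f] has mean [delta] and is equidistributed among the residue classes modulo
   every [m] all of whose prime factors belong to [ps]. *)
Definition equidistributed (ps : list Z) (f : Z -> R) (delta : R) : Prop :=
  forall m r, (0 < m)%Z -> (forall q, prime q -> (q | m)%Z -> In q ps) ->
    mean1 (fun k => f k * indic (m | k - r)%Z) (delta / IZR m).

Lemma equidistributed_one ps : equidistributed ps (fun _ => 1) 1.
Proof.
  intros m r Hm _; apply mean1_ext with (fun k => indic (m | k - r)%Z).
  - intros; lra.
  - replace (1 / IZR m) with (/ IZR m) by lra; now apply mean1_residue.
Qed.

Lemma equidistributed_mean ps f d : equidistributed ps f d -> mean1 f d.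
Proof.
  intros H; specialize (H 1%Z 0%Z ltac:(lia)).
  rewrite Rdiv_1_r in H; refine (mean1_ext _ _ _ _ (H _)).
  - intros k; rewrite ind_1; [lra|apply Z.divide_1_l].
  - intros q Hq Hd; apply Z.divide_1_r_nonneg in Hd; [|apply prime_ge_2 in Hq; lia].
    apply prime_ge_2 in Hq; lia.
Qed.

Lemma crt m q r s : rel_prime m q -> exists x, forall k,
  ((m | k - r) /\ (q | k - s) <-> (m * q | k - x))%Z.
Proof.
  intros H; destruct (rel_prime_bezout _ _ H) as [a b E].
  exists (s * (a * m) + r * (b * q))%Z; intros k; split.
  - intros [[c Hc] [d Hd]].
    exists (c * b + d * a)%Z.
    replace (k - (s * (a * m) + r * (b * q)))%Z
      with ((k - s) * (a * m) + (k - r) * (b * q) + k * (1 - (a * m + b * q)))%Z by ring.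
    rewrite E, Hc, Hd; ring.
  - intros [c Hc]; split.
    + exists (c * q + (s - r) * a)%Z.
      replace (k - r)%Z with
        (k - (s * (a * m) + r * (b * q)) + (s - r) * (a * m)
         - r * (1 - (a * m + b * q)))%Z by ring.
      rewrite E, Hc; ring.
    + exists (c * m + (r - s) * b)%Z.
      replace (k - s)%Z with
        (k - (s * (a * m) + r * (b * q)) + (r - s) * (b * q)
         - s * (1 - (a * m + b * q)))%Z by ring.
      rewrite E, Hc; ring.
Qed.

(** The exponent is split as [3 * e + v] because [p^(3e)] is a cube and can be absorbed into a
    variable. The integer 0 has no type. *)
Definition has_type (p : Z) (cls : Z -> nat) (v c : nat) (k : Z) : Prop :=
  exists (e : nat) u, (k = p ^ Z.of_nat (3 * e + v) * u)%Z /\ ~ (p | u)%Z /\ cls u = c.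

(* Classes of units modulo [M], a power of [p], given by lists [U c] of
   representatives, each containing a third of the units modulo [M]. *)
Definition unit_classes (p M : Z) (cls : Z -> nat) (U : nat -> list Z) : Prop :=
  (exists e, M = p ^ Z.of_nat (S e))%Z /\
  (forall k l, (M | k - l)%Z -> cls k = cls l) /\
  (forall k, cls k < 3)%nat /\
  (forall c, (c < 3)%nat -> NoDup (U c) /\
     (Z.of_nat (length (U c)) * 3 * p = M * (p - 1))%Z /\
     forall u, In u (U c) <-> (0 <= u < M)%Z /\ ~ (p | u)%Z /\ cls u = c).

(** The geometric series over [e] of [p^(-(3e+v)) (1 - 1/p) / 3]: exact valuation [3e+v], and one of
    three equally large unit classes. *)
Definition type_density (p : R) (v : nat) : R :=
  (1 - / p) / (1 - (/ p) ^ 3) * (/ p) ^ v / 3.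

Lemma pow_unit_unique p a b u w : prime p -> ~ (p | u)%Z -> ~ (p | w)%Z ->
  (p ^ Z.of_nat a * u = p ^ Z.of_nat b * w)%Z -> a = b /\ u = w.
Proof.
  intros Hp; assert (P2 := prime_ge_2 _ Hp); revert b u w.
  assert (Hpow : forall n, (p ^ Z.of_nat (S n) = p * p ^ Z.of_nat n)%Z)
    by (intros; rewrite Nat2Z.inj_succ, Z.pow_succ_r; lia).
  induction a as [|a IH]; intros [|b] u w Hu Hw E.
  - rewrite Z.pow_0_r in E; split; lia.
  - exfalso; apply Hu; rewrite Hpow in E; rewrite Z.pow_0_r in E.
    exists (p ^ Z.of_nat b * w)%Z; lia.
  - exfalso; apply Hw; rewrite Hpow in E; rewrite Z.pow_0_r in E.
    exists (p ^ Z.of_nat a * u)%Z; lia.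
  - rewrite !Hpow in E; destruct (IH b u w Hu Hw); [|split; auto].
    apply (Z.mul_reg_l _ _ p); lia.
Qed.

Lemma pow_divide p a b : (a <= b)%nat -> (p ^ Z.of_nat a | p ^ Z.of_nat b)%Z.
Proof.
  intros H; exists (p ^ Z.of_nat (b - a))%Z.
  rewrite <- Z.pow_add_r by lia; f_equal; lia.
Qed.

Lemma pow_nat_pos p n : (0 < p)%Z -> (0 < p ^ Z.of_nat n)%Z.
Proof. intros; apply Z.pow_pos_nonneg; lia. Qed.

Section TypeStep.
Variables (p M : Z) (cls : Z -> nat) (U : nat -> list Z).
Hypothesis Hp : prime p.
Hypothesis HU : unit_classes p M cls U.
Variables (v c : nat).
Hypothesis Hc : (c < 3)%nat.

(** A single residue class: the integers [p^(3j+v) w] with [w] congruent to [u] modulo [M]. The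
    integers of type [(v, c)] are the disjoint union of these cells over all [j] and all [u] in
    [U c]. *)
Definition type_cell (ju : nat * Z) (k : Z) : Prop :=
  (p ^ Z.of_nat (3 * fst ju + v) * M | k - p ^ Z.of_nat (3 * fst ju + v) * snd ju)%Z.

Lemma type_cell_inv j u k : In u (U c) -> type_cell (j, u) k ->
  exists w, (k = p ^ Z.of_nat (3 * j + v) * w)%Z /\ (M | w - u)%Z /\ ~ (p | w)%Z /\ cls w = c.
Proof.
  destruct HU as [[e HM] [Hcls [_ HUc]]].
  destruct (HUc c Hc) as [_ [_ Hin]].
  intros Hu [q Hq]; cbn [fst snd] in Hq; apply Hin in Hu; destruct Hu as [Hb [Hnd Hcu]].
  exists (u + q * M)%Z; repeat split.
  - match type of Hq with (k - ?x = _)%Z => replace k with (k - x + x)%Z by ring end.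
    rewrite Hq; ring.
  - exists q; lia.
  - intros Hd; apply Hnd.
    replace u with (u + q * M - q * M)%Z by ring; apply Z.divide_sub_r; auto.
    apply Z.divide_mul_r; rewrite HM, Nat2Z.inj_succ, Z.pow_succ_r by lia.
    apply Z.divide_factor_l.
  - rewrite <- Hcu; apply Hcls; exists q; lia.
Qed.

(** The cells are disjoint because valuation and unit part are unique, and those with [j < J] miss
    only integers divisible by [p^(3J)]. The latter have density tending to 0, which is the form
    needed by [mean1_approx]. *)
Lemma type_cells_bounds J k :
  lsum (list_prod (seq 0 J) (U c)) (fun ju => indic (type_cell ju k))
    <= indic (has_type p cls v c k) <=
  lsum (list_prod (seq 0 J) (U c)) (fun ju => indic (type_cell ju k))
    + indic (p ^ Z.of_nat (3 * J) | k - 0)%Z.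
Proof.
  assert (P2 := prime_ge_2 _ Hp).
  destruct HU as [[e HM] [Hcls [_ HUc]]].
  destruct (HUc c Hc) as [Hnd [_ Hin]].
  assert (HMpos : (0 < M)%Z) by (rewrite HM; apply pow_nat_pos; lia).
  assert (Hnn : 0 <= lsum (list_prod (seq 0 J) (U c)) (fun ju => indic (type_cell ju k)))
    by (apply lsum_nonneg; intros; apply ind_bounds).
  assert (Hi := ind_bounds (p ^ Z.of_nat (3 * J) | k - 0)%Z).
  destruct (ind_cases (has_type p cls v c k)) as [[h ->] | [h ->]]; split.
  - apply lsum_ind_le_1; [apply NoDup_list_prod; auto using seq_NoDup|].
    intros [j u] [j' u'] H1 H2 C1 C2; apply in_prod_iff in H1, H2.
    destruct (type_cell_inv j u k) as [w [E [Hw [Hpw _]]]]; try tauto.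
    destruct (type_cell_inv j' u' k) as [w' [E' [Hw' [Hpw' _]]]]; try tauto.
    rewrite E in E'; apply pow_unit_unique in E'; auto; destruct E' as [Ej Ew].
    assert (j = j') by lia; subst w' j'; f_equal.
    destruct H1 as [_ H1], H2 as [_ H2]; apply Hin in H1, H2.
    destruct Hw as [q Hq], Hw' as [q' Hq'].
    assert (Eu : (u - u' = (q' - q) * M)%Z) by lia.
    destruct H1 as [H1 _], H2 as [H2 _]; clear - Eu H1 H2.
    destruct (Z.lt_trichotomy (q' - q) 0) as [h|[h|h]]; nia.
  - destruct h as [e' [u [Ek [Hu Hcu]]]].
    destruct (Nat.lt_ge_cases e' J) as [Hlt|Hge].
    + assert (Hu' : In (u mod M)%Z (U c)).
      { apply Hin; split; [apply Z.mod_pos_bound; lia|].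
        assert (HMu : (M | u - u mod M)%Z)
          by (exists (u / M)%Z; assert (E := Z.div_mod u M ltac:(lia)); lia).
        split.
        - intros Hd; apply Hu.
          replace u with (u mod M + (u - u mod M))%Z by ring.
          apply Z.divide_add_r; auto.
          apply Z.divide_trans with M; auto.
          rewrite HM, Nat2Z.inj_succ, Z.pow_succ_r by lia; apply Z.divide_factor_l.
        - rewrite <- Hcu; symmetry; now apply Hcls. }
      assert (Hone : In (e', (u mod M)%Z) (list_prod (seq 0 J) (U c)))
        by (apply in_prod; auto; apply in_seq; lia).
      assert (HC : type_cell (e', (u mod M)%Z) k).
      { exists (u / M)%Z; simpl fst; simpl snd; rewrite Ek.
        rewrite (Z.div_mod u M) at 1 by lia; ring. }
      assert (1 <= lsum (list_prod (seq 0 J) (U c)) (fun ju => indic (type_cell ju k))); [|lra].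
      clear - Hone HC; induction (list_prod (seq 0 J) (U c)) as [|x l IH]; [easy|].
      simpl; assert (B := ind_bounds (type_cell x k)).
      assert (0 <= lsum l (fun ju => indic (type_cell ju k)))
        by (apply lsum_nonneg; intros; apply ind_bounds).
      destruct Hone as [->|Hone]; [rewrite ind_1 by auto; lra|].
      specialize (IH Hone); lra.
    + rewrite (ind_1 (_ | k - 0)%Z); [lra|].
      rewrite Z.sub_0_r, Ek; apply Z.divide_mul_l, pow_divide; lia.
  - rewrite (lsum_ext_in _ _ (fun _ => 0)), lsum_0; [lra|].
    intros [j u] H1; apply in_prod_iff in H1; apply ind_0; intros C.
    destruct (type_cell_inv j u k) as [w [E [_ [Hpw Hcw]]]]; try tauto.
    apply h; exists j, w; auto.
  - lra.
Qed.

(** The inductive step for independence. Imposing a type at [p] spends the equidistribution modulo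
    powers of [p], so [p] leaves the list, while equidistribution for the remaining primes survives
    because each cell is a residue class modulo a power of [p] and merges with any class modulo [m]
    by the Chinese remainder theorem. *)
Lemma equidistributed_type ps f delta : ~ In p ps ->
  (forall k, 0 <= f k <= 1) ->
  equidistributed (p :: ps) f delta ->
  equidistributed ps (fun k => f k * indic (has_type p cls v c k))
    (delta * type_density (IZR p) v).
Proof.
  intros Hps Hf Heq m r Hm Hsupp.
  assert (P2 := prime_ge_2 _ Hp).
  assert (HU' := HU).
  destruct HU' as [[e HM] [Hcls [_ HUc]]].
  destruct (HUc c Hc) as [Hnd [Hlen Hin]].
  assert (HMpos : (0 < M)%Z) by (rewrite HM; apply pow_nat_pos; lia).
  assert (HpR : 2 <= IZR p) by (apply (IZR_le 2); lia).
  assert (HMR : 0 < IZR M) by now apply IZR_lt.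
  assert (HmR : 0 < IZR m) by now apply IZR_lt.
  set (t := / IZR p).
  assert (Ht : 0 < t <= / 2).
  { unfold t; split; [apply Rinv_0_lt_compat; lra|apply Rinv_le_contravar; lra]. }
  assert (Ht3 : 0 < t ^ 3 <= / 2).
  { split; [apply pow_lt; lra|]; simpl; nra. }
  apply mean1_approx with
    (g := fun J k => lsum (list_prod (seq 0 J) (U c))
                       (fun ju => f k * indic (m | k - r)%Z * indic (type_cell ju k)))
    (h := fun J k => indic (p ^ Z.of_nat (3 * J) | k - 0)%Z)
    (dg := fun J => lsum (list_prod (seq 0 J) (U c))
                      (fun ju => delta / (IZR m * (IZR p ^ (3 * fst ju + v) * IZR M))))
    (dh := fun J => (t ^ 3) ^ J).
  - intros J k; rewrite lsum_scal.
    assert (B := type_cells_bounds J k).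
    set (T := lsum _ _) in *; set (h := indic (_ | k - 0)%Z) in *.
    assert (Hh : 0 <= h <= 1) by apply ind_bounds.
    assert (F := Hf k); assert (I := ind_bounds (m | k - r)%Z).
    set (i := indic (has_type p cls v c k)) in *.
    assert (W : 0 <= f k * indic (m | k - r)%Z <= 1) by nra.
    replace (f k * i * indic (m | k - r)%Z) with (f k * indic (m | k - r)%Z * i) by ring.
    set (w := f k * indic (m | k - r)%Z) in *; split; nra.
  - intros J.
    apply (mean1_lsum _ (fun ju k => f k * indic (m | k - r)%Z * indic (type_cell ju k))).
    intros [j u] Hju; simpl fst.
    set (q := (p ^ Z.of_nat (3 * j + v) * M)%Z).
    assert (Hq : q = (p ^ Z.of_nat (3 * j + v + S e))%Z).
    { unfold q; rewrite HM, <- Z.pow_add_r by lia; f_equal; lia. }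
    assert (Hqpos : (0 < q)%Z) by (rewrite Hq; apply pow_nat_pos; lia).
    (* [q] is a power of [p], and the prime factors of [m] lie in [ps], which omits [p]. *)
    assert (Hrel : rel_prime m q).
    { rewrite Hq; apply rel_prime_Zpower_r; [lia|].
      apply rel_prime_sym, prime_rel_prime; auto. }
    destruct (crt m q r (p ^ Z.of_nat (3 * j + v) * u) Hrel) as [x Hx].
    replace (IZR m * (IZR p ^ (3 * j + v) * IZR M)) with (IZR (m * q)).
    2: { unfold q; rewrite !mult_IZR, <- pow_IZR; ring. }
    apply mean1_ext with (fun k => f k * indic (m * q | k - x)%Z).
    + intros k; unfold type_cell; simpl fst; simpl snd.
      rewrite Rmult_assoc, <- ind_and; f_equal; apply ind_ext; symmetry; apply Hx.
    + apply Heq; [lia|].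
      intros q' Hq' Hd; apply prime_mult in Hd; auto.
      destruct Hd as [Hd|Hd]; [right; auto|left].
      rewrite Hq in Hd; symmetry; apply prime_power_prime with (Z.of_nat (3 * j + v + S e)); auto; lia.
  - intros J.
    replace ((t ^ 3) ^ J) with (/ IZR (p ^ Z.of_nat (3 * J))).
    + apply mean1_residue, pow_nat_pos; lia.
    + rewrite <- pow_IZR, <- pow_mult; unfold t; now rewrite pow_inv.
  - assert (Hlen' : INR (length (U c)) * 3 = IZR M * (1 - t)).
    { rewrite INR_IZR_INZ; apply Rmult_eq_reg_r with (IZR p); [|lra].
      replace (IZR M * (1 - t) * IZR p) with (IZR M * (IZR p - 1))
        by (unfold t; field; lra).
      change 3 with (IZR 3); change 1 with (IZR 1).
      rewrite <- minus_IZR, <- !mult_IZR; now f_equal. }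
    (* [K] is the sum of the whole geometric series; its partial sum over [j < J] is
       [K - K * (t ^ 3) ^ J]. *)
    set (K := delta / IZR m * ((1 - t) * t ^ v / 3 / (1 - t ^ 3))).
    replace (delta * type_density (IZR p) v / IZR m) with (K - K * 0).
    2: { unfold K, type_density; fold t; field; lra. }
    apply Un_cv_ext with (fun J => K - K * (t ^ 3) ^ J).
    + intros J; rewrite lsum_list_prod; simpl fst.
      rewrite (lsum_ext _ _ (fun j => delta / IZR m * ((1 - t) * t ^ v / 3) * (t ^ 3) ^ j)).
      * induction J as [|J IH]; [simpl; ring|].
        rewrite seq_S, lsum_app, <- IH; simpl lsum; unfold K; simpl pow; field; simpl in Ht3; lra.
      * intros j; rewrite lsum_const.
        replace ((t ^ 3) ^ j * 1) with ((t ^ 3) ^ j) by ring.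
        replace (INR (length (U c))) with (IZR M * (1 - t) / 3) by lra.
        rewrite <- pow_mult, pow_add; unfold t.
        rewrite !pow_inv.
        assert (IZR p ^ (3 * j) <> 0) by (apply pow_nonzero; lra).
        assert (IZR p ^ v <> 0) by (apply pow_nonzero; lra).
        field; repeat split; auto; lra.
    + apply CV_minus; [apply Un_cv_const|].
      apply CV_mult; [apply Un_cv_const|].
      intros eps Heps; destruct (pow_lt_1_zero (t ^ 3)) with (y := eps) as [N HN]; auto.
      * rewrite Rabs_right; lra.
      * exists N; intros n Hn; unfold Rdist; rewrite Rminus_0_r; auto.
  - intros eps Heps; destruct (pow_lt_1_zero (t ^ 3)) with (y := eps) as [N HN]; auto.
    + rewrite Rabs_right; lra.
    + exists N; intros n Hn; unfold Rdist; rewrite Rminus_0_r; auto.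
Qed.
End TypeStep.

(** * Solubility over Q_p *)

Section Padic.
Local Open Scope Z_scope.

(** * Primitive and nontrivial zeros *)

Lemma padic_int_cong p x j k : padic_int p x -> (j <= k)%nat ->
  (p ^ Z.of_nat j | x k - x j).
Proof.
  intros Hx; induction 1 as [|k Hk IH].
  - rewrite Z.sub_diag; apply Z.divide_0_r.
  - replace (x (S k) - x j) with ((x (S k) - x k) + (x k - x j)) by ring.
    apply Z.divide_add_r; auto.
    apply Z.divide_trans with (p ^ Z.of_nat k); [now apply pow_divide | apply Hx].
Qed.

(** Coherence alone would need a shift by one index. The shift is 3 because dividing all variables
    by [p] divides the cubic form by [p^3], and the equation has to keep precision [p^k]
    afterwards. *)
Lemma padic_int_div p x : prime p -> padic_int p x -> (p | x 1%nat) ->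
  padic_int p (fun k => x (k + 3)%nat / p) /\ forall k, x (k + 3)%nat = p * (x (k + 3)%nat / p).
Proof.
  intros Hp Hx H1; assert (P2 := prime_ge_2 _ Hp).
  assert (E : forall k, x (k + 3)%nat = p * (x (k + 3)%nat / p)).
  { intros k; apply Z.div_exact; [lia|]; apply Z.mod_divide; [lia|].
    replace (x (k + 3)%nat) with ((x (k + 3)%nat - x 1%nat) + x 1%nat) by ring.
    apply Z.divide_add_r; auto.
    rewrite <- (Z.pow_1_r p) at 1; apply (padic_int_cong p x 1); auto; lia. }
  split; auto.
  intros k; apply (Z.mul_divide_cancel_l _ _ p); [lia|].
  rewrite Z.mul_sub_distr_l, <- !E.
  rewrite <- Z.pow_succ_r, <- Nat2Z.inj_succ by lia.
  apply Z.divide_trans with (p ^ Z.of_nat (k + 3)); [apply pow_divide; lia | apply Hx].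
Qed.

(** A nonzero solution becomes primitive after dividing out [p] finitely often. Nontriviality is
    stated at a finite level [N], which bounds the number of divisions and drives the induction. *)
Lemma padic_soluble_of_nontrivial p a0 a1 a2 a3 N : prime p -> forall x0 x1 x2 x3,
  padic_int p x0 -> padic_int p x1 -> padic_int p x2 -> padic_int p x3 ->
  ~ ((p ^ Z.of_nat N | x0 N) /\ (p ^ Z.of_nat N | x1 N) /\
     (p ^ Z.of_nat N | x2 N) /\ (p ^ Z.of_nat N | x3 N)) ->
  (forall k, (p ^ Z.of_nat k | diag_cubic (a0, a1, a2, a3) (x0 k, x1 k, x2 k, x3 k))) ->
  padic_soluble p (a0, a1, a2, a3).
Proof.
  intros Hp; assert (P2 := prime_ge_2 _ Hp).
  induction N as [|N IH]; intros x0 x1 x2 x3 H0 H1 H2 H3 Hn He.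
  - exfalso; apply Hn; rewrite Z.pow_0_r; repeat split; apply Z.divide_1_l.
  - destruct (classic ((p | x0 1%nat) /\ (p | x1 1%nat) /\ (p | x2 1%nat) /\ (p | x3 1%nat)))
      as [[D0 [D1 [D2 D3]]]|Hprim].
    2: { exists x0, x1, x2, x3; auto 10. }
    destruct (padic_int_div p x0) as [I0 E0]; auto.
    destruct (padic_int_div p x1) as [I1 E1]; auto.
    destruct (padic_int_div p x2) as [I2 E2]; auto.
    destruct (padic_int_div p x3) as [I3 E3]; auto.
    refine (IH _ _ _ _ I0 I1 I2 I3 _ _).
    + assert (L : forall x, padic_int p x -> (forall k, x (k + 3)%nat = p * (x (k + 3)%nat / p)) ->
        (p ^ Z.of_nat N | x (N + 3)%nat / p) -> (p ^ Z.of_nat (S N) | x (S N))).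
      { intros x Hx Ex Hd.
        replace (x (S N)) with (x (N + 3)%nat - (x (N + 3)%nat - x (S N))) by ring.
        apply Z.divide_sub_r; [|apply padic_int_cong; auto; lia].
        rewrite Ex, Nat2Z.inj_succ, Z.pow_succ_r by lia.
        now apply Z.mul_divide_mono_l. }
      intros [d0 [d1 [d2 d3]]]; apply Hn; auto.
    + intros k; specialize (He (k + 3)%nat); unfold diag_cubic in *.
      rewrite E0, E1, E2, E3 in He.
      set (y0 := x0 _ / p) in *; set (y1 := x1 _ / p) in *.
      set (y2 := x2 _ / p) in *; set (y3 := x3 _ / p) in *.
      apply (Z.mul_divide_cancel_l _ _ (p ^ 3)); [nia|].
      replace (p ^ 3 * p ^ Z.of_nat k) with (p ^ Z.of_nat (k + 3))
        by (rewrite <- Z.pow_add_r by lia; f_equal; lia).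
      replace (p ^ 3 * (a0 * y0 ^ 3 + a1 * y1 ^ 3 + a2 * y2 ^ 3 + a3 * y3 ^ 3)) with
        (a0 * (p * y0) ^ 3 + a1 * (p * y1) ^ 3 + a2 * (p * y2) ^ 3 + a3 * (p * y3) ^ 3)
        by ring; auto.
Qed.

Lemma padic_int_const p c : padic_int p (fun _ => c).
Proof. intros k; rewrite Z.sub_diag; apply Z.divide_0_r. Qed.

Lemma padic_int_scal p c x : padic_int p x -> padic_int p (fun k => c * x k).
Proof. intros H k; rewrite <- Z.mul_sub_distr_l; apply Z.divide_mul_r, H. Qed.

(** A unit multiplied by [p^e] is still visibly nonzero at level [e + 1]; this supplies the level
    needed for the descent to a primitive solution. *)
Lemma pow_scal_not_divide p x e : prime p -> padic_int p x -> ~ (p | x 1%nat) ->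
  ~ (p ^ Z.of_nat (S e) | p ^ Z.of_nat e * x (S e)).
Proof.
  intros Hp Hx Hn Hd; assert (P2 := prime_ge_2 _ Hp); apply Hn.
  rewrite Nat2Z.inj_succ, Z.pow_succ_r, (Z.mul_comm p) in Hd by lia.
  apply Z.mul_divide_cancel_l in Hd; [|assert (Q := pow_nat_pos p e); lia].
  replace (x 1%nat) with (x (S e) - (x (S e) - x 1%nat)) by ring.
  apply Z.divide_sub_r; auto.
  rewrite <- (Z.pow_1_r p) at 1; apply (padic_int_cong p x 1); auto; lia.
Qed.

(** The substitution of [p^(e_i) x_i] for each variable turns one form into the other up to the
    factor [p^s]. Clearing both sides by powers of [p] avoids division and negative exponents. *)
Lemma padic_soluble_rescale p a0 a1 a2 a3 b0 b1 b2 b3 e0 e1 e2 e3 s : prime p ->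
  b0 * p ^ Z.of_nat (3 * e0) = p ^ Z.of_nat s * a0 ->
  b1 * p ^ Z.of_nat (3 * e1) = p ^ Z.of_nat s * a1 ->
  b2 * p ^ Z.of_nat (3 * e2) = p ^ Z.of_nat s * a2 ->
  b3 * p ^ Z.of_nat (3 * e3) = p ^ Z.of_nat s * a3 ->
  padic_soluble p (a0, a1, a2, a3) -> padic_soluble p (b0, b1, b2, b3).
Proof.
  intros Hp E0 E1 E2 E3 [x0 [x1 [x2 [x3 [I0 [I1 [I2 [I3 [Hn He]]]]]]]]].
  assert (Hz : exists N, ~ ((p ^ Z.of_nat N | p ^ Z.of_nat e0 * x0 N) /\
     (p ^ Z.of_nat N | p ^ Z.of_nat e1 * x1 N) /\
     (p ^ Z.of_nat N | p ^ Z.of_nat e2 * x2 N) /\ (p ^ Z.of_nat N | p ^ Z.of_nat e3 * x3 N))).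
  { destruct (classic (p | x0 1%nat)) as [D0|D0].
    2: { exists (S e0); intros [H _]; revert H; now apply pow_scal_not_divide. }
    destruct (classic (p | x1 1%nat)) as [D1|D1].
    2: { exists (S e1); intros [_ [H _]]; revert H; now apply pow_scal_not_divide. }
    destruct (classic (p | x2 1%nat)) as [D2|D2].
    2: { exists (S e2); intros [_ [_ [H _]]]; revert H; now apply pow_scal_not_divide. }
    exists (S e3); intros [_ [_ [_ H]]]; revert H; apply pow_scal_not_divide; tauto. }
  destruct Hz as [N HN].
  refine (padic_soluble_of_nontrivial p b0 b1 b2 b3 N Hp _ _ _ _
    (padic_int_scal _ _ _ I0) (padic_int_scal _ _ _ I1)
    (padic_int_scal _ _ _ I2) (padic_int_scal _ _ _ I3) HN _).
  intros k; specialize (He k); unfold diag_cubic in *.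
  assert (P3 : forall e, (p ^ Z.of_nat e) ^ 3 = p ^ Z.of_nat (3 * e))
    by (intros e; rewrite <- Z.pow_mul_r by lia; f_equal; lia).
  rewrite !Z.pow_mul_l, !P3, !Z.mul_assoc, E0, E1, E2, E3.
  rewrite <- !Z.mul_assoc, <- !Z.mul_add_distr_l; now apply Z.divide_mul_r.
Qed.

Lemma padic_soluble_swap01 p a0 a1 a2 a3 :
  padic_soluble p (a0, a1, a2, a3) -> padic_soluble p (a1, a0, a2, a3).
Proof.
  intros [x0 [x1 [x2 [x3 [I0 [I1 [I2 [I3 [Hn He]]]]]]]]].
  exists x1, x0, x2, x3; repeat split; auto; [tauto|].
  intros k; specialize (He k); unfold diag_cubic in *.
  now rewrite (Z.add_comm (a1 * _)).
Qed.

Lemma padic_soluble_rot p a0 a1 a2 a3 :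
  padic_soluble p (a0, a1, a2, a3) -> padic_soluble p (a1, a2, a3, a0).
Proof.
  intros [x0 [x1 [x2 [x3 [I0 [I1 [I2 [I3 [Hn He]]]]]]]]].
  exists x1, x2, x3, x0; repeat split; auto; [tauto|].
  intros k; specialize (He k); unfold diag_cubic in *.
  now rewrite Z.add_comm, !Z.add_assoc.
Qed.

Lemma padic_soluble_zero p a1 a2 a3 : prime p -> padic_soluble p (0, a1, a2, a3).
Proof.
  intros Hp; exists (fun _ => 1), (fun _ => 0), (fun _ => 0), (fun _ => 0).
  repeat split; try apply padic_int_const.
  - intros [H _]; apply Z.divide_1_r_nonneg in H; apply prime_ge_2 in Hp; lia.
  - intros k; replace (diag_cubic _ _) with 0; [apply Z.divide_0_r|].
    unfold diag_cubic; ring.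
Qed.

(** * Hensel lifting for one cubic variable *)

Lemma padic_sequence p (P : nat -> Z -> Prop) s0 : P O s0 ->
  (forall k s, P k s -> exists s', P (S k) s' /\ (p ^ Z.of_nat k | s' - s)) ->
  exists s, padic_int p s /\ forall k, P k (s k).
Proof.
  intros H0 Hs.
  set (next := fun k (s : {s | P k s}) =>
    let (s', H) := constructive_indefinite_description _ (Hs k (proj1_sig s) (proj2_sig s)) in
    exist (P (S k)) s' (proj1 H)).
  set (seq := fix seq k : {s | P k s} :=
    match k with O => exist _ s0 H0 | S k => next k (seq k) end).
  exists (fun k => proj1_sig (seq k)); split.
  - intros k; simpl; unfold next.
    destruct (constructive_indefinite_description _ _) as [s' [H1 H2]]; auto.
  - intros k; apply proj2_sig.
Qed.

Lemma linear_congruence p c q : prime p -> ~ (p | c) -> exists t, (p | q + c * t).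
Proof.
  intros Hp Hc; destruct (rel_prime_bezout p c) as [a b E]; [now apply prime_rel_prime|].
  exists (- q * b); exists (q * a).
  replace (q + c * (- q * b)) with (q * a * p + q * (1 - (a * p + b * c))) by ring.
  rewrite E; ring.
Qed.

(* Modulus to which a simple root of a cubic [u s^3 + w] must be known. *)
Definition hensel_modulus (p M : Z) : Prop := (p <> 3 /\ M = p) \/ (p = 3 /\ M = 9).

Lemma not_divide_mult p a b : prime p -> ~ (p | a) -> ~ (p | b) -> ~ (p | a * b).
Proof. intros Hp Ha Hb H; apply prime_mult in H; tauto. Qed.

Lemma divide_cube p x : prime p -> (p | x ^ 3) -> (p | x).
Proof.
  intros Hp H; replace (x ^ 3) with (x * (x * x)) in H by ring.
  apply prime_mult in H; auto; destruct H as [H|H]; auto.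
  apply prime_mult in H; tauto.
Qed.

Lemma not_divide_cong p x y : (p | x - y) -> ~ (p | y) -> ~ (p | x).
Proof.
  intros H Hy Hx; apply Hy; replace y with (x - (x - y)) by ring; now apply Z.divide_sub_r.
Qed.

(** Newton iteration with the invariant that [M * p^k] divides the value at step [k]. The correction
    is always [p^(k+1) t]; the congruence that fixes [t] is linear modulo [p]. *)
Lemma hensel_cube p M u w s0 : prime p -> hensel_modulus p M ->
  ~ (p | u) -> ~ (p | s0) -> (M | u * s0 ^ 3 + w) ->
  exists s, padic_int p s /\ (forall k, (p ^ Z.of_nat k | u * s k ^ 3 + w)) /\ ~ (p | s 1%nat).
Proof.
  intros Hp HM Hu H0 E; assert (P2 := prime_ge_2 _ Hp).
  destruct (padic_sequence p
    (fun k s => (M * p ^ Z.of_nat k | u * s ^ 3 + w) /\ ~ (p | s)) s0) as [s [Hs Hr]].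
  - rewrite Z.pow_0_r, Z.mul_1_r; auto.
  - intros k s [[q Hq] Hns].
    rewrite Nat2Z.inj_succ, Z.pow_succ_r by lia; set (E' := p ^ Z.of_nat k) in *.
    assert (Hfin : forall t, ~ (p | s + p * E' * t)).
    { intros t; apply not_divide_cong with s; auto; exists (E' * t); ring. }
    assert (Hcong : forall t, (E' | s + p * E' * t - s)) by (intros t; exists (p * t); ring).
    destruct HM as [[Hp3 ->]|[-> ->]].
    (* Here the derivative [3 u s^2] is a unit modulo [p]. *)
    + destruct (linear_congruence p (3 * u * s ^ 2) q) as [t [r Ht]]; auto.
      { apply not_divide_mult; [auto|apply not_divide_mult; auto|].
        - intros H; apply prime_div_prime in H; auto using prime_3.
        - replace (s ^ 2) with (s * s) by ring; now apply not_divide_mult. }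
      exists (s + p * E' * t); split; [split|]; auto.
      exists (r + 3 * u * s * E' * t ^ 2 + p * u * E' ^ 2 * t ^ 3).
      replace (u * (s + p * E' * t) ^ 3 + w) with ((u * s ^ 3 + w) +
        p * E' * (3 * u * s ^ 2 * t) + p ^ 2 * E' * (3 * u * s * E' * t ^ 2)
        + p ^ 3 * E' ^ 3 * u * t ^ 3) by ring.
      rewrite Hq; replace (3 * u * s ^ 2 * t) with (r * p - q) by (rewrite <- Ht; ring); ring.
    (* At 3 the derivative has valuation exactly one. The correction [3 E' t] changes the value by
       [9 E' u s^2 t] modulo [27 E'], which is why the start must be known modulo 9. *)
    + destruct (linear_congruence 3 (u * s ^ 2) q) as [t [r Ht]]; auto.
      { apply not_divide_mult; auto.
        replace (s ^ 2) with (s * s) by ring; now apply not_divide_mult. }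
      exists (s + 3 * E' * t); split; [split|]; auto.
      exists (r + u * s * E' * t ^ 2 + u * E' ^ 2 * t ^ 3).
      replace (u * (s + 3 * E' * t) ^ 3 + w) with ((u * s ^ 3 + w) +
        9 * E' * (u * s ^ 2 * t) + 27 * E' * (u * s * E' * t ^ 2)
        + 27 * E' ^ 3 * u * t ^ 3) by ring.
      rewrite Hq; replace (u * s ^ 2 * t) with (r * 3 - q) by (rewrite <- Ht; ring); ring.
  - exists s; split; [|split]; auto; [|apply Hr].
    intros k; apply Z.divide_trans with (M * p ^ Z.of_nat k); [|apply Hr].
    apply Z.divide_factor_r.
Qed.

(** Only the first variable is lifted; the second and third stay fixed integers and the fourth is
    set to 0. Hence only [b0] has to be a unit, and [b1], [b2] may be divisible by [p]. *)
Lemma padic_soluble_three_terms p M a0 a1 a2 a3 b0 b1 b2 e0 e1 e2 T s0 x1 x2 :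
  prime p -> hensel_modulus p M ->
  a0 * p ^ Z.of_nat (3 * e0) = p ^ Z.of_nat T * b0 ->
  a1 * p ^ Z.of_nat (3 * e1) = p ^ Z.of_nat T * b1 ->
  a2 * p ^ Z.of_nat (3 * e2) = p ^ Z.of_nat T * b2 ->
  ~ (p | b0) -> ~ (p | s0) -> (M | b0 * s0 ^ 3 + (b1 * x1 ^ 3 + b2 * x2 ^ 3)) ->
  padic_soluble p (a0, a1, a2, a3).
Proof.
  intros Hp HM E0 E1 E2 Hb Hs Hd; assert (P2 := prime_ge_2 _ Hp).
  destruct (hensel_cube p M b0 _ s0 Hp HM Hb Hs Hd) as [s [Is [Hr Hs1]]].
  refine (padic_soluble_of_nontrivial p a0 a1 a2 a3 (S e0) Hp _ _ _ _
    (padic_int_scal _ (p ^ Z.of_nat e0) _ Is) (padic_int_const _ (p ^ Z.of_nat e1 * x1))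
    (padic_int_const _ (p ^ Z.of_nat e2 * x2)) (padic_int_const _ 0) _ _).
  - intros [H _]; revert H; now apply pow_scal_not_divide.
  - intros k; specialize (Hr k); unfold diag_cubic.
    assert (P3 : forall e, (p ^ Z.of_nat e) ^ 3 = p ^ Z.of_nat (3 * e))
      by (intros e; rewrite <- Z.pow_mul_r by lia; f_equal; lia).
    rewrite !Z.pow_mul_l, !P3, !Z.mul_assoc, E0, E1, E2.
    replace (_ + _) with
      (p ^ Z.of_nat T * (b0 * s k ^ 3 + (b1 * x1 ^ 3 + b2 * x2 ^ 3))) by ring.
    now apply Z.divide_mul_r.
Qed.

Lemma padic_soluble_pair p M a0 a1 a2 a3 v n0 n1 u0 u1 s :
  prime p -> hensel_modulus p M ->
  a0 = p ^ Z.of_nat (3 * n0 + v) * u0 -> a1 = p ^ Z.of_nat (3 * n1 + v) * u1 ->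
  ~ (p | u0) -> ~ (p | u1) -> (M | u0 * s ^ 3 + u1) ->
  padic_soluble p (a0, a1, a2, a3).
Proof.
  intros Hp HM -> -> Hu0 Hu1 Hd; assert (P2 := prime_ge_2 _ Hp).
  (* Each of the two coefficients receives the exponent of the other, so both become [p^T] times a
     unit. The third variable is 0, so its exponent and [b2] are chosen merely to satisfy the
     required identity. *)
  refine (padic_soluble_three_terms p M _ _ a2 a3 u0 u1
    (a2 * p ^ Z.of_nat (2 * (3 * n0 + 3 * n1 + v))) n1 n0
    (3 * n0 + 3 * n1 + v) (3 * n0 + 3 * n1 + v) s 1 0 Hp HM _ _ _ Hu0 _ _).
  - rewrite Z.mul_shuffle0, <- Z.pow_add_r by lia; do 2 f_equal; lia.
  - rewrite Z.mul_shuffle0, <- Z.pow_add_r by lia; do 2 f_equal; lia.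
  - rewrite Z.mul_shuffle3, <- Z.pow_add_r by lia; do 2 f_equal; lia.
  - intros Hs; apply Hu1.
    replace u1 with (u0 * s ^ 3 + u1 - u0 * s ^ 3) by ring; apply Z.divide_sub_r.
    + apply Z.divide_trans with M; auto.
      destruct HM as [[_ ->]|[-> ->]]; [apply Z.divide_refl | now exists 3].
    + apply Z.divide_mul_r; replace (s ^ 3) with (s * (s * s)) by ring.
      now apply Z.divide_mul_l.
  - now replace (u0 * s ^ 3 + _) with (u0 * s ^ 3 + u1) by ring.
Qed.

(** * Reduction to coefficients of valuation 0, 1 or 2 *)

Lemma unit_part_exists p k : prime p -> k <> 0 -> exists n u,
  k = p ^ Z.of_nat n * u /\ ~ (p | u).
Proof.
  intros Hp; assert (P2 := prime_ge_2 _ Hp).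
  assert (H : forall N k, (Z.abs_nat k < N)%nat -> k <> 0 -> exists n u,
    k = p ^ Z.of_nat n * u /\ ~ (p | u)).
  { induction N as [|N IH]; intros k' Hk Hk0; [lia|].
    destruct (classic (p | k')) as [[q Hq]|Hd].
    - destruct (IH q) as [n [u [E Hu]]]; [nia|nia|].
      exists (S n), u; split; auto.
      rewrite Nat2Z.inj_succ, Z.pow_succ_r, Hq, E by lia; ring.
    - exists O, k'; split; auto; rewrite Z.pow_0_r; ring. }
  intros Hk; apply (H (S (Z.abs_nat k))); auto; lia.
Qed.

Lemma has_type_exists p cls k : prime p -> (forall k, cls k < 3)%nat -> k <> 0 ->
  exists v c, (v < 3)%nat /\ (c < 3)%nat /\ has_type p cls v c k.
Proof.
  intros Hp Hcls Hk; destruct (unit_part_exists p k Hp Hk) as [n [u [E Hu]]].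
  exists (n mod 3)%nat, (cls u); split; [apply Nat.mod_upper_bound; lia|].
  split; [apply Hcls|]; exists (n / 3)%nat, u; split; auto.
  rewrite E; do 3 f_equal; apply Nat.div_mod; lia.
Qed.

Lemma has_type_unique p cls k v c v' c' : prime p -> (v < 3)%nat -> (v' < 3)%nat ->
  has_type p cls v c k -> has_type p cls v' c' k -> (v, c) = (v', c').
Proof.
  intros Hp Hv Hv' [e [u [E [Hu Hc]]]] [e' [u' [E' [Hu' Hc']]]].
  rewrite E in E'; apply pow_unit_unique in E'; auto; destruct E' as [En <-].
  assert (v = v') by lia; congruence.
Qed.

Lemma has_type_nonzero p cls v c k : prime p -> has_type p cls v c k -> k <> 0.
Proof.
  intros Hp [e [u [E [Hu _]]]] Hk; apply Hu.
  assert (H := pow_nat_pos p (3 * e + v)); assert (P2 := prime_ge_2 _ Hp).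
  assert (u = 0) by nia; subst; apply Z.divide_0_r.
Qed.

(** Multiplying the whole form by [p^rho] rotates all valuations modulo 3 together, and cubes of [p]
    go into the variables. The free choice of [rho] allows any one valuation to be moved to 0. *)
Lemma padic_soluble_normal_form p cls a0 a1 a2 a3 v0 v1 v2 v3 c0 c1 c2 c3 rho : prime p ->
  has_type p cls v0 c0 a0 -> has_type p cls v1 c1 a1 ->
  has_type p cls v2 c2 a2 -> has_type p cls v3 c3 a3 ->
  padic_soluble p (a0, a1, a2, a3) ->
  exists u0 u1 u2 u3, (~ (p | u0) /\ cls u0 = c0) /\ (~ (p | u1) /\ cls u1 = c1) /\
    (~ (p | u2) /\ cls u2 = c2) /\ (~ (p | u3) /\ cls u3 = c3) /\
    padic_soluble p (p ^ Z.of_nat ((v0 + rho) mod 3) * u0, p ^ Z.of_nat ((v1 + rho) mod 3) * u1,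
      p ^ Z.of_nat ((v2 + rho) mod 3) * u2, p ^ Z.of_nat ((v3 + rho) mod 3) * u3).
Proof.
  intros Hp [e0 [u0 [E0 [N0 C0]]]] [e1 [u1 [E1 [N1 C1]]]]
    [e2 [u2 [E2 [N2 C2]]]] [e3 [u3 [E3 [N3 C3]]]] Hsol.
  exists u0, u1, u2, u3; do 4 (split; [auto|]).
  assert (L : forall v e u, p ^ Z.of_nat ((v + rho) mod 3) * u
     * p ^ Z.of_nat (3 * (e + (v + rho) / 3)) = p ^ Z.of_nat rho * (p ^ Z.of_nat (3 * e + v) * u)).
  { intros v e u; rewrite Z.mul_shuffle0, Z.mul_assoc, <- !Z.pow_add_r by lia.
    do 2 f_equal; assert (D := Nat.div_mod (v + rho) 3 ltac:(lia)); lia. }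
  revert Hsol; apply (padic_soluble_rescale p _ _ _ _ _ _ _ _
    (e0 + (v0 + rho) / 3) (e1 + (v1 + rho) / 3) (e2 + (v2 + rho) / 3)
    (e3 + (v3 + rho) / 3) rho); auto; subst; apply L.
Qed.

Lemma padic_soluble_truncated p b0 b1 b2 b3 : prime p -> padic_soluble p (b0, b1, b2, b3) ->
  exists y0 y1 y2 y3, (p ^ 3 | b0 * y0 ^ 3 + b1 * y1 ^ 3 + b2 * y2 ^ 3 + b3 * y3 ^ 3) /\
    ~ ((p | y0) /\ (p | y1) /\ (p | y2) /\ (p | y3)).
Proof.
  intros Hp [x0 [x1 [x2 [x3 [I0 [I1 [I2 [I3 [Hn He]]]]]]]]].
  exists (x0 3%nat), (x1 3%nat), (x2 3%nat), (x3 3%nat); split; [apply (He 3%nat)|].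
  assert (L : forall x, padic_int p x -> (p | x 3%nat) -> (p | x 1%nat)).
  { intros x Hx H; replace (x 1%nat) with (x 3%nat - (x 3%nat - x 1%nat)) by ring.
    apply Z.divide_sub_r; auto.
    rewrite <- (Z.pow_1_r p) at 1; apply (padic_int_cong p x 1); auto. }
  intros [D0 [D1 [D2 D3]]]; apply Hn; auto.
Qed.

End Padic.

(** * Local solubility in terms of valuations and cubic classes *)

(** The six orderings bring every unordered pair into the first two places, and the four rotations
    alone bring every triple into the first three. This suffices for the patterns below, so the 24
    permutations are not all listed. *)
Definition any_arrangement {T : Type} (f : T -> T -> T -> T -> bool) (t0 t1 t2 t3 : T) : bool :=
  f t0 t1 t2 t3 || f t1 t2 t3 t0 || f t2 t3 t0 t1 || f t3 t0 t1 t2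
  || f t0 t2 t1 t3 || f t1 t3 t2 t0.

Definition same_type (s t : nat * nat) : bool :=
  Nat.eqb (fst s) (fst t) && Nat.eqb (snd s) (snd t).

(* A type is a pair (valuation mod 3, cubic class of the unit part). *)
Definition soluble_types_1mod3 : nat * nat -> nat * nat -> nat * nat -> nat * nat -> bool :=
  any_arrangement (fun s t u _ => same_type s t
    || (Nat.eqb (fst s) (fst t) && Nat.eqb (fst t) (fst u))).

(** A pair of equal valuation either cancels outright, being in the same class modulo 9, or cancels
    modulo 3 with the remaining error corrected by a coefficient one valuation higher. *)
Definition soluble_types_3 : nat * nat -> nat * nat -> nat * nat -> nat * nat -> bool :=
  any_arrangement (fun s t u w => same_type s t
    || (Nat.eqb (fst s) (fst t) && (Nat.eqb (fst u) ((fst s + 1) mod 3)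
                                    || Nat.eqb (fst w) ((fst s + 1) mod 3)))).

Section Local.
Local Open Scope Z_scope.

Lemma padic_soluble_swap12 p a0 a1 a2 a3 :
  padic_soluble p (a0, a1, a2, a3) -> padic_soluble p (a0, a2, a1, a3).
Proof.
  intros H; apply padic_soluble_rot, padic_soluble_swap01 in H.
  now do 3 apply padic_soluble_rot in H.
Qed.

Lemma padic_soluble_arrangement p {T : Type} (f : T -> T -> T -> T -> bool) (C : T -> Z -> Prop) :
  (forall s0 s1 s2 s3 b0 b1 b2 b3, C s0 b0 -> C s1 b1 -> C s2 b2 -> C s3 b3 ->
     f s0 s1 s2 s3 = true -> padic_soluble p (b0, b1, b2, b3)) ->
  forall t0 t1 t2 t3 a0 a1 a2 a3, C t0 a0 -> C t1 a1 -> C t2 a2 -> C t3 a3 ->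
  any_arrangement f t0 t1 t2 t3 = true -> padic_soluble p (a0, a1, a2, a3).
Proof.
  intros H t0 t1 t2 t3 a0 a1 a2 a3 C0 C1 C2 C3 Hf; unfold any_arrangement in Hf.
  rewrite !orb_true_iff in Hf; destruct Hf as [[[[[Hf|Hf]|Hf]|Hf]|Hf]|Hf].
  - now apply (H t0 t1 t2 t3).
  - do 3 apply padic_soluble_rot; now apply (H t1 t2 t3 t0).
  - do 2 apply padic_soluble_rot; now apply (H t2 t3 t0 t1).
  - apply padic_soluble_rot; now apply (H t3 t0 t1 t2).
  - apply padic_soluble_swap12; now apply (H t0 t2 t1 t3).
  - do 3 apply padic_soluble_rot; apply padic_soluble_swap12; now apply (H t1 t3 t2 t0).
Qed.

(** Four valuations modulo 3 must contain a coincidence. As every residue is a cube modulo [p], such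
    a pair already has a zero, so a single trivial class is enough. *)
Lemma padic_soluble_2mod3 p a0 a1 a2 a3 : prime p ->
  (forall u, exists s, (p | s ^ 3 - u)) -> p <> 3 ->
  a0 <> 0 -> a1 <> 0 -> a2 <> 0 -> a3 <> 0 -> padic_soluble p (a0, a1, a2, a3).
Proof.
  intros Hp Hcube Hp3 N0 N1 N2 N3.
  set (cls := fun _ : Z => O).
  assert (Hcls : forall k, (cls k < 3)%nat) by (unfold cls; lia).
  destruct (has_type_exists p cls a0) as [v0 [c0 [V0 [_ T0]]]]; auto.
  destruct (has_type_exists p cls a1) as [v1 [c1 [V1 [_ T1]]]]; auto.
  destruct (has_type_exists p cls a2) as [v2 [c2 [V2 [_ T2]]]]; auto.
  destruct (has_type_exists p cls a3) as [v3 [c3 [V3 [_ T3]]]]; auto.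
  apply (padic_soluble_arrangement p (fun s t _ _ => Nat.eqb s t)
    (fun v a => exists c, has_type p cls v c a)) with v0 v1 v2 v3; eauto.
  - intros s0 s1 s2 s3 b0 b1 b2 b3 [d0 [e0 [u0 [E0 [U0 _]]]]] [d1 [e1 [u1 [E1 [U1 _]]]]] _ _ Hs.
    apply Nat.eqb_eq in Hs; subst s1.
    destruct (linear_congruence p u0 u1 Hp U0) as [t Ht].
    destruct (Hcube t) as [s Hs].
    apply (padic_soluble_pair p p b0 b1 b2 b3 s0 e0 e1 u0 u1 s); auto.
    + left; auto.
    + replace (u0 * s ^ 3 + u1) with ((u1 + u0 * t) + u0 * (s ^ 3 - t)) by ring.
      apply Z.divide_add_r; auto; now apply Z.divide_mul_r.
  - unfold any_arrangement; rewrite !orb_true_iff, !Nat.eqb_eq; lia.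
Qed.

Lemma padic_soluble_triple p a0 a1 a2 a3 v e0 e1 e2 u0 u1 u2 x0 x1 x2 : prime p -> p <> 3 ->
  a0 = p ^ Z.of_nat (3 * e0 + v) * u0 -> a1 = p ^ Z.of_nat (3 * e1 + v) * u1 ->
  a2 = p ^ Z.of_nat (3 * e2 + v) * u2 -> ~ (p | u0) -> ~ (p | x0) ->
  (p | u0 * x0 ^ 3 + u1 * x1 ^ 3 + u2 * x2 ^ 3) -> padic_soluble p (a0, a1, a2, a3).
Proof.
  intros Hp Hp3 -> -> -> Hu Hx Hd; assert (P2 := prime_ge_2 _ Hp).
  refine (padic_soluble_three_terms p p _ _ _ a3 u0 u1 u2 (e1 + e2) (e0 + e2) (e0 + e1)
    (3 * (e0 + e1 + e2) + v) x0 x1 x2 Hp (or_introl (conj Hp3 eq_refl)) _ _ _ Hu Hx _);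
    try (rewrite Z.mul_shuffle0, <- Z.pow_add_r by lia; do 2 f_equal; lia).
  now rewrite Z.add_assoc.
Qed.

Definition delta (r v : nat) : Z := if Nat.eqb v r then 1 else 0.

Section OneModThree.
Variables (p : Z) (cls : Z -> nat).
Hypothesis Hp : prime p.
Hypothesis Hp3 : p <> 3.
Hypothesis Hcls : forall u w, ~ (p | u) -> ~ (p | w) ->
  (cls u = cls w <-> exists s, (p | u * s ^ 3 + w)).
Hypothesis Hcurve : forall u0 u1 u2, ~ (p | u0) -> ~ (p | u1) -> ~ (p | u2) ->
  exists x0 x1 x2, (p | u0 * x0 ^ 3 + u1 * x1 ^ 3 + u2 * x2 ^ 3) /\
    ~ ((p | x0) /\ (p | x1) /\ (p | x2)).

Lemma pair_anisotropic u w y z : ~ (p | u) -> ~ (p | w) -> cls u <> cls w ->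
  (p | u * y ^ 3 + w * z ^ 3) -> (p | y) /\ (p | z).
Proof.
  intros Hu Hw Hc Hd.
  destruct (classic (p | z)) as [Hz|Hz].
  - split; auto; apply divide_cube; auto.
    assert (H : (p | u * y ^ 3)).
    { replace (u * y ^ 3) with (u * y ^ 3 + w * z ^ 3 - w * (z ^ 2) * z) by ring.
      apply Z.divide_sub_r; auto; now apply Z.divide_mul_r. }
    apply prime_mult in H; tauto.
  - exfalso; apply Hc, Hcls; auto.
    destruct (linear_congruence p z (-1) Hp Hz) as [i [q Hi]].
    exists (y * i).
    replace (u * (y * i) ^ 3 + w) with
      ((u * y ^ 3 + w * z ^ 3) * i ^ 3 - w * ((z * i) ^ 3 - 1)) by ring.
    apply Z.divide_sub_r; [now apply Z.divide_mul_l|].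
    apply Z.divide_mul_r; exists (q * ((z * i) ^ 2 + z * i + 1)).
    replace ((z * i) ^ 3 - 1) with ((-1 + z * i) * ((z * i) ^ 2 + z * i + 1)) by ring.
    rewrite Hi; ring.
Qed.

(** When no soluble pattern occurs, at most two coefficients share the valuation [r], and two that
    do lie in different classes. The part of the form at level [r] then has no nontrivial zero
    modulo [p]. *)
Lemma level_anisotropic r v0 v1 v2 v3 c0 c1 c2 c3 u0 u1 u2 u3 y0 y1 y2 y3 :
  ~ (p | u0) /\ cls u0 = c0 -> ~ (p | u1) /\ cls u1 = c1 ->
  ~ (p | u2) /\ cls u2 = c2 -> ~ (p | u3) /\ cls u3 = c3 ->
  soluble_types_1mod3 (v0, c0) (v1, c1) (v2, c2) (v3, c3) = false ->
  (p | delta r v0 * (u0 * y0 ^ 3) + delta r v1 * (u1 * y1 ^ 3)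
     + delta r v2 * (u2 * y2 ^ 3) + delta r v3 * (u3 * y3 ^ 3)) ->
  (v0 = r -> (p | y0)) /\ (v1 = r -> (p | y1)) /\ (v2 = r -> (p | y2)) /\ (v3 = r -> (p | y3)).
Proof.
  intros [N0 C0] [N1 C1] [N2 C2] [N3 C3] Hf Hd; subst.
  assert (L1 : forall u y, ~ (p | u) -> (p | u * y ^ 3) -> (p | y)).
  { intros u y Hu H; apply prime_mult in H; auto; destruct H; [tauto|]; now apply divide_cube. }
  unfold soluble_types_1mod3, any_arrangement, same_type in Hf; simpl fst in Hf; simpl snd in Hf.
  rewrite !orb_false_iff, !andb_false_iff, !Nat.eqb_neq in Hf.
  destruct Hf as [[[[[[P01 T012] [P12 T123]] [P23 T230]] [P30 T301]] [P02 _]] [P13 _]].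
  assert (Q01 : v0 = r -> v1 = r -> cls u0 <> cls u1)
    by (clear - P01; destruct P01; congruence).
  assert (Q12 : v1 = r -> v2 = r -> cls u1 <> cls u2)
    by (clear - P12; destruct P12; congruence).
  assert (Q23 : v2 = r -> v3 = r -> cls u2 <> cls u3)
    by (clear - P23; destruct P23; congruence).
  assert (Q02 : v0 = r -> v2 = r -> cls u0 <> cls u2)
    by (clear - P02; destruct P02; congruence).
  assert (Q13 : v1 = r -> v3 = r -> cls u1 <> cls u3)
    by (clear - P13; destruct P13; congruence).
  assert (Q03 : v0 = r -> v3 = r -> cls u0 <> cls u3)
    by (clear - P30; destruct P30; congruence).
  assert (R012 : v0 = r -> v1 = r -> v2 = r -> False)
    by (clear - T012; destruct T012; congruence).
  assert (R123 : v1 = r -> v2 = r -> v3 = r -> False)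
    by (clear - T123; destruct T123; congruence).
  assert (R230 : v2 = r -> v3 = r -> v0 = r -> False)
    by (clear - T230; destruct T230; congruence).
  assert (R301 : v3 = r -> v0 = r -> v1 = r -> False)
    by (clear - T301; destruct T301; congruence).
  clear P01 P12 P23 P30 P02 P13 T012 T123 T230 T301.
  unfold delta in Hd.
  destruct (Nat.eqb_spec v0 r) as [E0|E0], (Nat.eqb_spec v1 r) as [E1|E1],
    (Nat.eqb_spec v2 r) as [E2|E2], (Nat.eqb_spec v3 r) as [E3|E3];
    try (exfalso; now apply R012); try (exfalso; now apply R123);
    try (exfalso; now apply R230); try (exfalso; now apply R301);
    rewrite ?Z.mul_1_l, ?Z.mul_0_l, ?Z.add_0_l, ?Z.add_0_r in Hd;
    first [ apply pair_anisotropic in Hd; [|assumption|assumption|eauto 2]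
          | apply L1 in Hd; [|assumption] | idtac ];
    repeat split; intros E; try (now elim E0); try (now elim E1);
    try (now elim E2); try (now elim E3); auto; apply Hd.
Qed.

Lemma level_split v w : (v < 3)%nat ->
  p ^ Z.of_nat v * w = delta 0 v * w + p * (delta 1 v * w) + p ^ 2 * (delta 2 v * w).
Proof.
  intros Hv; destruct v as [|[|[|]]]; try lia; unfold delta; simpl Nat.eqb; cbv iota.
  - rewrite Z.pow_0_r; ring.
  - change (Z.of_nat 1) with 1; rewrite Z.pow_1_r; ring.
  - change (Z.of_nat 2) with 2; ring.
Qed.

(** Descent through the levels. Modulo [p], the level 0 part forces its variables to be divisible by
    [p], so it vanishes modulo [p^3]; dividing by [p] exposes level 1, then level 2. All variables
    end up divisible by [p], against primitivity. *)
Lemma soluble_types_necessary_1mod3 a0 a1 a2 a3 t0 t1 t2 t3 :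
  (fst t0 < 3)%nat -> (fst t1 < 3)%nat -> (fst t2 < 3)%nat -> (fst t3 < 3)%nat ->
  has_type p cls (fst t0) (snd t0) a0 -> has_type p cls (fst t1) (snd t1) a1 ->
  has_type p cls (fst t2) (snd t2) a2 -> has_type p cls (fst t3) (snd t3) a3 ->
  padic_soluble p (a0, a1, a2, a3) -> soluble_types_1mod3 t0 t1 t2 t3 = true.
Proof.
  destruct t0 as [v0 c0], t1 as [v1 c1], t2 as [v2 c2], t3 as [v3 c3]; simpl fst; simpl snd.
  intros V0 V1 V2 V3 T0 T1 T2 T3 Hsol; assert (P2 := prime_ge_2 _ Hp).
  apply not_false_iff_true; intros Hf.
  destruct (padic_soluble_normal_form p cls _ _ _ _ _ _ _ _ _ _ _ _ 0 Hp T0 T1 T2 T3 Hsol)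
    as [u0 [u1 [u2 [u3 [U0 [U1 [U2 [U3 Hn]]]]]]]].
  rewrite !Nat.add_0_r, !Nat.mod_small in Hn by auto.
  destruct (padic_soluble_truncated _ _ _ _ _ Hp Hn) as [y0 [y1 [y2 [y3 [Hd Hprim]]]]].
  rewrite <- !Z.mul_assoc in Hd.
  rewrite (level_split v0), (level_split v1), (level_split v2), (level_split v3) in Hd by auto.
  assert (L := fun r => level_anisotropic r v0 v1 v2 v3 c0 c1 c2 c3
    u0 u1 u2 u3 y0 y1 y2 y3 U0 U1 U2 U3 Hf).
  set (S := fun r => delta r v0 * (u0 * y0 ^ 3) + delta r v1 * (u1 * y1 ^ 3)
     + delta r v2 * (u2 * y2 ^ 3) + delta r v3 * (u3 * y3 ^ 3)).
  assert (Hd' : (p ^ 3 | S 0%nat + p * S 1%nat + p ^ 2 * S 2%nat)).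
  { eapply eq_ind; [exact Hd|unfold S; ring]. }
  assert (Hcube : forall r, (p | S r) -> (p ^ 3 | S r)).
  { intros r Hr; destruct (L r Hr) as [L0 [L1 [L2 L3]]].
    assert (A : forall v u y, (v = r -> (p | y)) -> (p ^ 3 | delta r v * (u * y ^ 3))).
    { intros v u y H; unfold delta; destruct (Nat.eqb_spec v r) as [E|E].
      - destruct (H E) as [q ->]; exists (u * q ^ 3); ring.
      - rewrite Z.mul_0_l; apply Z.divide_0_r. }
    unfold S; repeat apply Z.divide_add_r; auto. }
  assert (D0 : (p | S 0%nat)).
  { replace (S 0%nat) with (S 0%nat + p * S 1%nat + p ^ 2 * S 2%nat
      - p * (S 1%nat + p * S 2%nat)) by ring.
    apply Z.divide_sub_r; [|apply Z.divide_factor_l].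
    apply Z.divide_trans with (p ^ 3); auto; exists (p ^ 2); ring. }
  assert (D1 : (p | S 1%nat)).
  { destruct (Hcube _ D0) as [q Hq], Hd' as [q' Hq'].
    exists (p * q' - p * q - S 2%nat).
    apply Z.mul_reg_l with p; [lia|].
    replace (p * S 1%nat) with (S 0%nat + p * S 1%nat + p ^ 2 * S 2%nat
      - S 0%nat - p ^ 2 * S 2%nat) by ring.
    rewrite Hq', Hq; ring. }
  assert (D2 : (p | S 2%nat)).
  { destruct (Hcube _ D0) as [q Hq], (Hcube _ D1) as [q1 Hq1], Hd' as [q' Hq'].
    exists (q' - q - p * q1).
    apply Z.mul_reg_l with (p ^ 2); [nia|].
    replace (p ^ 2 * S 2%nat) with (S 0%nat + p * S 1%nat + p ^ 2 * S 2%nat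
      - S 0%nat - p * S 1%nat) by ring.
    rewrite Hq', Hq, Hq1; ring. }
  apply L in D0, D1, D2; apply Hprim.
  assert (A : forall v (D : Prop), (v < 3)%nat ->
    (v = 0%nat -> D) -> (v = 1%nat -> D) -> (v = 2%nat -> D) -> D).
  { intros v D Hv A0 A1 A2; assert (v = 0 \/ v = 1 \/ v = 2)%nat as [?|[?|?]] by lia; auto. }
  repeat split; [apply (A v0) | apply (A v1) | apply (A v2) | apply (A v3)];
    auto; first [apply D0 | apply D1 | apply D2].
Qed.

(** Two equal types give a zero of a binary form. Three equal valuations give a point on a diagonal
    cubic curve modulo [p], lifted along whichever coordinate is a unit; this is the reason for the
    three cases. *)
Lemma soluble_types_sufficient_1mod3 t0 t1 t2 t3 a0 a1 a2 a3 :
  has_type p cls (fst t0) (snd t0) a0 -> has_type p cls (fst t1) (snd t1) a1 ->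
  has_type p cls (fst t2) (snd t2) a2 -> has_type p cls (fst t3) (snd t3) a3 ->
  soluble_types_1mod3 t0 t1 t2 t3 = true -> padic_soluble p (a0, a1, a2, a3).
Proof.
  apply (padic_soluble_arrangement p _ (fun t a => has_type p cls (fst t) (snd t) a)).
  clear t0 t1 t2 t3 a0 a1 a2 a3; intros [v0 c0] [v1 c1] [v2 c2] [v3 c3] a0 a1 a2 a3; unfold same_type; simpl fst; simpl snd.
  intros [e0 [u0 [E0 [U0 C0]]]] [e1 [u1 [E1 [U1 C1]]]] [e2 [u2 [E2 [U2 C2]]]] _ H.
  rewrite orb_true_iff, !andb_true_iff, !Nat.eqb_eq in H; destruct H as [[Ev Ec]|[Ev Ev']]; subst v1.
  - destruct (proj1 (Hcls u0 u1 U0 U1)) as [s Hs]; [congruence|].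
    apply (padic_soluble_pair p p a0 a1 a2 a3 v0 e0 e1 u0 u1 s); auto; left; auto.
  - subst v2; destruct (Hcurve u0 u1 u2 U0 U1 U2) as [x0 [x1 [x2 [Hd Hn]]]].
    destruct (classic (p | x0)) as [D0|D0].
    2: { exact (padic_soluble_triple p _ _ _ a3 v0 e0 e1 e2 u0 u1 u2 x0 x1 x2
           Hp Hp3 E0 E1 E2 U0 D0 Hd). }
    destruct (classic (p | x1)) as [D1|D1].
    2: { apply padic_soluble_swap01.
         refine (padic_soluble_triple p _ _ _ a3 v0 e1 e0 e2 u1 u0 u2 x1 x0 x2
           Hp Hp3 E1 E0 E2 U1 D1 _); now rewrite (Z.add_comm (u1 * _)). }
    apply padic_soluble_swap12, padic_soluble_swap01.
    refine (padic_soluble_triple p _ _ _ a3 v0 e2 e0 e1 u2 u0 u1 x2 x0 x1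
           Hp Hp3 E2 E0 E1 U2 _ _); [tauto|].
    eapply eq_ind; [exact Hd|ring].
Qed.
End OneModThree.

(* The cubes of units modulo 9 are 1 and -1. *)
Definition cubic_class_9 (u : Z) : nat :=
  match (u mod 9)%Z with 2%Z | 7%Z => 1 | 4%Z | 5%Z => 2 | _ => 0 end.

Definition units_9 : list Z := [1; 2; 4; 5; 7; 8].

Lemma in_units_9 u : ~ (3 | u) -> In (u mod 9) units_9.
Proof.
  intros Hu; assert (B := Z.mod_pos_bound u 9 ltac:(lia)).
  assert (E := Z.div_mod u 9 ltac:(lia)); set (r := u mod 9) in *.
  assert (r <> 0 /\ r <> 3 /\ r <> 6).
  { repeat split; intros Hr; apply Hu;
      [exists (3 * (u / 9)) | exists (3 * (u / 9) + 1) | exists (3 * (u / 9) + 2)]; lia. }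
  simpl; lia.
Qed.

Lemma cubic_class_9_mod u : cubic_class_9 (u mod 9) = cubic_class_9 u.
Proof. unfold cubic_class_9; now rewrite Z.mod_mod by lia. Qed.

Lemma mod_9_cong u : (9 | u - u mod 9).
Proof. exists (u / 9); assert (E := Z.div_mod u 9 ltac:(lia)); lia. Qed.

Lemma units_9_pair u w : ~ (3 | u) -> ~ (3 | w) -> cubic_class_9 u = cubic_class_9 w ->
  exists s, (9 | u * s ^ 3 + w).
Proof.
  intros Hu Hw Hc.
  assert (H : forallb (fun r => forallb (fun q =>
    negb (Nat.eqb (cubic_class_9 r) (cubic_class_9 q)) || ((r + q) mod 9 =? 0)
     || ((- r + q) mod 9 =? 0)) units_9) units_9 = true) by now vm_compute.
  rewrite forallb_forall in H; specialize (H _ (in_units_9 u Hu)).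
  rewrite forallb_forall in H; specialize (H _ (in_units_9 w Hw)).
  rewrite !cubic_class_9_mod, Hc, Nat.eqb_refl in H; simpl negb in H; rewrite orb_false_l in H.
  apply orb_true_iff in H; rewrite !Z.eqb_eq in H.
  assert (Du := mod_9_cong u); assert (Dw := mod_9_cong w).
  destruct H as [H|H]; apply Z.mod_divide in H; try lia; [exists 1 | exists (-1)].
  - replace (u * 1 ^ 3 + w) with ((u - u mod 9) + (w - w mod 9) + (u mod 9 + w mod 9)) by ring.
    apply Z.divide_add_r; auto; now apply Z.divide_add_r.
  - replace (u * (-1) ^ 3 + w) with ((w - w mod 9) - (u - u mod 9) + (- (u mod 9) + w mod 9)) by ring.
    apply Z.divide_add_r; auto; now apply Z.divide_sub_r.
Qed.

(** A sign [y] makes [u + w y^3] divisible by 3, and [z] in [{-1, 0, 1}] then corrects the multiple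
    of 3 modulo 9. *)
Lemma units_9_three_terms u w x : ~ (3 | u) -> ~ (3 | w) -> ~ (3 | x) ->
  exists y z, (9 | u * 1 ^ 3 + (w * y ^ 3 + 3 * x * z ^ 3)).
Proof.
  intros Hu Hw Hx.
  assert (H : forallb (fun r => forallb (fun q => forallb (fun s => existsb (fun y => existsb (fun z =>
    (r + (q * y ^ 3 + 3 * s * z ^ 3)) mod 9 =? 0) [-1; 0; 1]) [-1; 1]) units_9) units_9) units_9
     = true) by now vm_compute.
  rewrite forallb_forall in H; specialize (H _ (in_units_9 u Hu)).
  rewrite forallb_forall in H; specialize (H _ (in_units_9 w Hw)).
  rewrite forallb_forall in H; specialize (H _ (in_units_9 x Hx)).
  apply existsb_exists in H; destruct H as [y [_ H]].
  apply existsb_exists in H; destruct H as [z [_ H]].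
  apply Z.eqb_eq, Z.mod_divide in H; [|lia].
  exists y, z.
  replace (u * 1 ^ 3 + (w * y ^ 3 + 3 * x * z ^ 3)) with
    ((u - u mod 9) + (w - w mod 9) * y ^ 3 + (x - x mod 9) * (3 * z ^ 3)
     + (u mod 9 + (w mod 9 * y ^ 3 + 3 * (x mod 9) * z ^ 3))) by ring.
  apply Z.divide_add_r; auto; apply Z.divide_add_r; [apply Z.divide_add_r|];
    try apply Z.divide_mul_l; apply mod_9_cong.
Qed.

(** Up to sign the three units are 1, 2, 4 modulo 9, and cubes are 0, 1, -1. A signed sum of a
    nonempty subset of [{1, 2, 4}] is nonzero and at most 7 in absolute value, so it is never
    divisible by 9. *)
Lemma units_9_triple_anisotropic u0 u1 u2 y0 y1 y2 :
  ~ (3 | u0) -> ~ (3 | u1) -> ~ (3 | u2) ->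
  cubic_class_9 u0 <> cubic_class_9 u1 -> cubic_class_9 u0 <> cubic_class_9 u2 ->
  cubic_class_9 u1 <> cubic_class_9 u2 ->
  (9 | u0 * y0 ^ 3 + u1 * y1 ^ 3 + u2 * y2 ^ 3) -> (3 | y0) /\ (3 | y1) /\ (3 | y2).
Proof.
  intros N0 N1 N2 C01 C02 C12 Hd.
  assert (H : forallb (fun r0 => forallb (fun r1 => forallb (fun r2 =>
    forallb (fun s0 => forallb (fun s1 => forallb (fun s2 =>
      Nat.eqb (cubic_class_9 r0) (cubic_class_9 r1) || Nat.eqb (cubic_class_9 r0) (cubic_class_9 r2)
      || Nat.eqb (cubic_class_9 r1) (cubic_class_9 r2)
      || negb ((r0 * s0 ^ 3 + r1 * s1 ^ 3 + r2 * s2 ^ 3) mod 9 =? 0)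
      || ((s0 =? 0) && (s1 =? 0) && (s2 =? 0)))
    [0; 1; 2]) [0; 1; 2]) [0; 1; 2]) units_9) units_9) units_9 = true) by now vm_compute.
  assert (I3 : forall y, In (y mod 3) [0; 1; 2])
    by (intros y; assert (B := Z.mod_pos_bound y 3 ltac:(lia)); simpl; lia).
  assert (Y3 : forall y, (9 | y ^ 3 - (y mod 3) ^ 3)).
  { intros y; assert (E := Z.div_mod y 3 ltac:(lia)); set (q := y / 3) in *; set (s := y mod 3) in *.
    exists (3 * q ^ 3 + 3 * q ^ 2 * s + q * s ^ 2); rewrite E; ring. }
  rewrite forallb_forall in H; specialize (H _ (in_units_9 u0 N0)).
  rewrite forallb_forall in H; specialize (H _ (in_units_9 u1 N1)).
  rewrite forallb_forall in H; specialize (H _ (in_units_9 u2 N2)).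
  rewrite forallb_forall in H; specialize (H _ (I3 y0)).
  rewrite forallb_forall in H; specialize (H _ (I3 y1)).
  rewrite forallb_forall in H; specialize (H _ (I3 y2)).
  rewrite !cubic_class_9_mod, !orb_true_iff, !andb_true_iff, !Nat.eqb_eq in H.
  rewrite negb_true_iff, Z.eqb_neq, !Z.eqb_eq in H.
  destruct H as [[[[H|H]|H]|H]|[[H0 H1] H2]]; try tauto.
  - exfalso; apply H, Z.mod_divide; [lia|].
    replace (_ + _ + _) with (u0 * y0 ^ 3 + u1 * y1 ^ 3 + u2 * y2 ^ 3
      - ((u0 - u0 mod 9) * y0 ^ 3 + (u1 - u1 mod 9) * y1 ^ 3 + (u2 - u2 mod 9) * y2 ^ 3)
      - ((y0 ^ 3 - (y0 mod 3) ^ 3) * (u0 mod 9) + (y1 ^ 3 - (y1 mod 3) ^ 3) * (u1 mod 9)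
         + (y2 ^ 3 - (y2 mod 3) ^ 3) * (u2 mod 9))) by ring.
    apply Z.divide_sub_r; [apply Z.divide_sub_r; auto|];
      (apply Z.divide_add_r; [apply Z.divide_add_r|]); apply Z.divide_mul_l; auto using mod_9_cong.
  - repeat split; apply Z.mod_divide; auto; lia.
Qed.

Lemma hensel_modulus_3 : hensel_modulus 3 9.
Proof. right; auto. Qed.

Lemma soluble_types_sufficient_3 t0 t1 t2 t3 a0 a1 a2 a3 :
  (fst t0 < 3)%nat /\ has_type 3 cubic_class_9 (fst t0) (snd t0) a0 ->
  (fst t1 < 3)%nat /\ has_type 3 cubic_class_9 (fst t1) (snd t1) a1 ->
  (fst t2 < 3)%nat /\ has_type 3 cubic_class_9 (fst t2) (snd t2) a2 ->
  (fst t3 < 3)%nat /\ has_type 3 cubic_class_9 (fst t3) (snd t3) a3 ->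
  soluble_types_3 t0 t1 t2 t3 = true -> padic_soluble 3 (a0, a1, a2, a3).
Proof.
  apply (padic_soluble_arrangement 3 _
    (fun t a => (fst t < 3)%nat /\ has_type 3 cubic_class_9 (fst t) (snd t) a)).
  clear; intros [v0 c0] [v1 c1] [v2 c2] [v3 c3] a0 a1 a2 a3; unfold same_type; simpl fst; simpl snd.
  intros [V0 [e0 [u0 [E0 [U0 C0]]]]] [V1 [e1 [u1 [E1 [U1 C1]]]]] H2 H3 H.
  assert (A : forall b2 b3 v2 c2, (v2 < 3)%nat /\ has_type 3 cubic_class_9 v2 c2 b2 ->
    v0 = v1 -> v2 = ((v0 + 1) mod 3)%nat -> padic_soluble 3 (a0, a1, b2, b3)).
  { clear H2 H3 H; intros b2 b3 w d [_ [e2 [u2 [-> [U2 C2]]]]] <- ->.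
    destruct (units_9_three_terms u0 u1 u2 U0 U1 U2) as [y [z Hd]].
    (* [q] is 1 exactly when the valuation wraps around from 2 to 0; the extra cube [3^(3q)]
       restores the true difference of one, which appears as the factor 3 in [3 * u2]. *)
    assert (Hq : exists q, ((v0 + 1) mod 3 + 3 * q = v0 + 1)%nat)
      by (exists ((v0 + 1) / 3)%nat; assert (D := Nat.div_mod (v0 + 1) 3 ltac:(lia)); lia).
    destruct Hq as [q Hq]; subst a0 a1.
    refine (padic_soluble_three_terms 3 9 _ _ _ b3 u0 u1 (3 * u2)
      (e1 + e2) (e0 + e2) (e0 + e1 + q) (3 * (e0 + e1 + e2) + v0) 1 y z prime_3
      hensel_modulus_3 _ _ _ U0 _ Hd).
    - rewrite Z.mul_shuffle0, <- Z.pow_add_r by lia; do 2 f_equal; lia.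
    - rewrite Z.mul_shuffle0, <- Z.pow_add_r by lia; do 2 f_equal; lia.
    - rewrite Z.mul_shuffle0, <- Z.pow_add_r, Z.mul_assoc, (Z.mul_comm _ 3) by lia.
      rewrite <- Z.pow_succ_r by lia; do 2 f_equal; lia.
    - intros D; apply Z.divide_1_r_nonneg in D; lia. }
  rewrite orb_true_iff, !andb_true_iff, orb_true_iff, !Nat.eqb_eq in H.
  destruct H as [[Ev Ec]|[Ev [H|H]]].
  - destruct (units_9_pair u0 u1 U0 U1) as [s Hs]; [congruence|]; subst v1.
    apply (padic_soluble_pair 3 9 a0 a1 a2 a3 v0 e0 e1 u0 u1 s);
      auto using prime_3, hensel_modulus_3.
  - now apply A with v2 c2.
  - do 2 apply padic_soluble_rot.
    apply padic_soluble_swap01; do 2 apply padic_soluble_rot.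
    now apply A with v3 c3.
Qed.

(** The only obstruction at 3: three coefficients of one valuation with pairwise different classes,
    and the fourth two valuations higher modulo 3. *)
Definition obstructed_types_3 (t0 t1 t2 t3 : nat * nat) : bool :=
  Nat.eqb (fst t0) (fst t1) && Nat.eqb (fst t0) (fst t2)
  && Nat.eqb (fst t3) ((fst t0 + 2) mod 3)
  && negb (Nat.eqb (snd t0) (snd t1)) && negb (Nat.eqb (snd t0) (snd t2))
  && negb (Nat.eqb (snd t1) (snd t2)).

Lemma obstructed_types_insoluble_3 t0 t1 t2 t3 a0 a1 a2 a3 :
  (fst t0 < 3)%nat ->
  has_type 3 cubic_class_9 (fst t0) (snd t0) a0 -> has_type 3 cubic_class_9 (fst t1) (snd t1) a1 ->
  has_type 3 cubic_class_9 (fst t2) (snd t2) a2 -> has_type 3 cubic_class_9 (fst t3) (snd t3) a3 ->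
  obstructed_types_3 t0 t1 t2 t3 = true -> ~ padic_soluble 3 (a0, a1, a2, a3).
Proof.
  destruct t0 as [v0 c0], t1 as [v1 c1], t2 as [v2 c2], t3 as [v3 c3].
  unfold obstructed_types_3; simpl fst; simpl snd; intros V0 T0 T1 T2 T3 H Hsol.
  rewrite !andb_true_iff, !negb_true_iff, !Nat.eqb_neq, !Nat.eqb_eq in H.
  destruct H as [[[[[-> ->] E3] C01] C02] C12].
  (* This rotation puts the triple at valuation 0 and the fourth coefficient at valuation 2. Modulo
     9 the triple then forces its three variables to be divisible by 3, and modulo 27 the fourth
     variable follows. *)
  destruct (padic_soluble_normal_form 3 _ _ _ _ _ _ _ _ _ _ _ _ _ (3 - v2) prime_3 T0 T1 T2 T3 Hsol)
    as [u0 [u1 [u2 [u3 [[U0 D0] [[U1 D1] [[U2 D2] [[U3 D3] Hn]]]]]]]].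
  assert (M0 : ((v2 + (3 - v2)) mod 3 = 0)%nat)
    by (replace (v2 + (3 - v2))%nat with 3%nat by lia; reflexivity).
  assert (M3 : ((v3 + (3 - v2)) mod 3 = 2)%nat)
    by (subst v3; destruct v2 as [|[|[|]]]; [reflexivity..|lia]).
  rewrite M0, M3 in Hn; change (3 ^ Z.of_nat 0) with 1 in Hn; change (3 ^ Z.of_nat 2) with 9 in Hn.
  destruct (padic_soluble_truncated _ _ _ _ _ prime_3 Hn) as [y0 [y1 [y2 [y3 [Hd Hprim]]]]].
  rewrite !Z.mul_1_l in Hd; apply Hprim; change (3 ^ 3) with 27 in Hd.
  assert (H : (3 | y0) /\ (3 | y1) /\ (3 | y2)).
  { apply (units_9_triple_anisotropic u0 u1 u2); auto; try congruence.
    destruct Hd as [q Hq]; exists (3 * q - u3 * y3 ^ 3); lia. }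
  destruct H as [[z0 ->] [[z1 ->] [z2 ->]]].
  assert (H : (3 | u3 * y3 ^ 3)).
  { destruct Hd as [q Hq]; exists (q - u0 * z0 ^ 3 - u1 * z1 ^ 3 - u2 * z2 ^ 3).
    apply Z.mul_reg_l with 9; [lia|].
    replace (9 * (u3 * y3 ^ 3)) with (9 * u3 * y3 ^ 3) by ring.
    replace (9 * u3 * y3 ^ 3) with (u0 * (z0 * 3) ^ 3 + u1 * (z1 * 3) ^ 3 + u2 * (z2 * 3) ^ 3
      + 9 * u3 * y3 ^ 3 - 27 * (u0 * z0 ^ 3 + u1 * z1 ^ 3 + u2 * z2 ^ 3)) by ring.
    rewrite Hq; ring. }
  repeat split; try apply Z.divide_factor_r.
  apply prime_mult in H; [|apply prime_3]; destruct H; [tauto|].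
  apply divide_cube; auto using prime_3.
Qed.

Definition types : list (nat * nat) := list_prod [0; 1; 2]%nat [0; 1; 2]%nat.

Lemma in_types v c : (v < 3)%nat -> (c < 3)%nat -> In (v, c) types.
Proof. intros Hv Hc; apply in_prod; simpl; lia. Qed.

(** Checked over all [9^4] quadruples. By hand: failing [soluble_types_3] leaves only the valuation
    patterns [v,v,v,v] and [v,v,v,v+2], and in the first one two of the four coefficients share one
    of the three classes. *)
Lemma obstructed_types_3_complete t0 t1 t2 t3 :
  In t0 types -> In t1 types -> In t2 types -> In t3 types ->
  soluble_types_3 t0 t1 t2 t3 = false ->
  obstructed_types_3 t0 t1 t2 t3 = true \/ obstructed_types_3 t1 t2 t3 t0 = true \/
  obstructed_types_3 t2 t3 t0 t1 = true \/ obstructed_types_3 t3 t0 t1 t2 = true.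
Proof.
  intros I0 I1 I2 I3 Hf.
  assert (H : forallb (fun t0 => forallb (fun t1 => forallb (fun t2 => forallb (fun t3 =>
    soluble_types_3 t0 t1 t2 t3 || (obstructed_types_3 t0 t1 t2 t3 || (obstructed_types_3 t1 t2 t3 t0
    || (obstructed_types_3 t2 t3 t0 t1 || obstructed_types_3 t3 t0 t1 t2))))
    types) types) types) types = true) by now vm_compute.
  rewrite forallb_forall in H; specialize (H _ I0).
  rewrite forallb_forall in H; specialize (H _ I1).
  rewrite forallb_forall in H; specialize (H _ I2).
  rewrite forallb_forall in H; specialize (H _ I3).
  rewrite Hf, orb_false_l, !orb_true_iff in H; auto.
Qed.

Lemma soluble_types_necessary_3 t0 t1 t2 t3 a0 a1 a2 a3 :
  In t0 types -> In t1 types -> In t2 types -> In t3 types ->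
  has_type 3 cubic_class_9 (fst t0) (snd t0) a0 -> has_type 3 cubic_class_9 (fst t1) (snd t1) a1 ->
  has_type 3 cubic_class_9 (fst t2) (snd t2) a2 -> has_type 3 cubic_class_9 (fst t3) (snd t3) a3 ->
  padic_soluble 3 (a0, a1, a2, a3) -> soluble_types_3 t0 t1 t2 t3 = true.
Proof.
  intros I0 I1 I2 I3 T0 T1 T2 T3 Hsol; apply not_false_iff_true; intros Hf.
  assert (B : forall t, In t types -> (fst t < 3)%nat)
    by (intros [v c] Ht; apply in_prod_iff in Ht; simpl in *; lia).
  destruct (obstructed_types_3_complete t0 t1 t2 t3) as [H|[H|[H|H]]]; auto.
  - now apply (obstructed_types_insoluble_3 t0 t1 t2 t3 a0 a1 a2 a3) in H; auto.
  - apply (obstructed_types_insoluble_3 t1 t2 t3 t0 a1 a2 a3 a0) in H; auto.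
    now apply H, padic_soluble_rot.
  - apply (obstructed_types_insoluble_3 t2 t3 t0 t1 a2 a3 a0 a1) in H; auto.
    now apply H, padic_soluble_rot, padic_soluble_rot.
  - apply (obstructed_types_insoluble_3 t3 t0 t1 t2 a3 a0 a1 a2) in H; auto.
    now apply H, padic_soluble_rot, padic_soluble_rot, padic_soluble_rot.
Qed.
End Local.

(** * Mean values of finite products of local conditions *)

Definition types4 : list (nat * nat * (nat * nat) * (nat * nat) * (nat * nat)) :=
  list_prod (list_prod (list_prod types types) types) types.

Definition type_rule := nat * nat -> nat * nat -> nat * nat -> nat * nat -> bool.

Definition nonzero4 (a : Z4) : Prop :=
  let '(a0, a1, a2, a3) := a in (a0 <> 0 /\ a1 <> 0 /\ a2 <> 0 /\ a3 <> 0)%Z.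

(** Vectors with a zero coordinate are excluded although they are always soluble, since they have no
    types; they have density 0. *)
Definition local_indic (p : Z) (a : Z4) : R := indic (nonzero4 a /\ padic_soluble p a).

Definition governed_by (p : Z) (phi : type_rule) : Prop :=
  prime p /\ exists M cls U, unit_classes p M cls U /\
  forall t0 t1 t2 t3 a0 a1 a2 a3,
    In t0 types -> In t1 types -> In t2 types -> In t3 types ->
    has_type p cls (fst t0) (snd t0) a0 -> has_type p cls (fst t1) (snd t1) a1 ->
    has_type p cls (fst t2) (snd t2) a2 -> has_type p cls (fst t3) (snd t3) a3 ->
    (padic_soluble p (a0, a1, a2, a3) <-> phi t0 t1 t2 t3 = true).

Definition type_sum (x : R) (phi : type_rule) : R :=
  lsum types4 (fun '(t0, t1, t2, t3) => (if phi t0 t1 t2 t3 then 1 else 0) *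
    (type_density x (fst t0) * type_density x (fst t1) *
     type_density x (fst t2) * type_density x (fst t3))).

Lemma lsum_indic_single {A} (l : list A) (g : A -> R) (P : A -> Prop) a : NoDup l -> In a l -> P a ->
  (forall x, In x l -> P x -> x = a) -> lsum l (fun x => g x * indic (P x)) = g a.
Proof.
  intros Hd Ha Pa Hu.
  rewrite (lsum_ext_in _ _ (fun x => g a * indic (P x))).
  - rewrite lsum_scal, (lsum_ind_unique l P a) by auto; ring.
  - intros x Hx; destruct (ind_cases (P x)) as [[h ->] | [h ->]]; [|ring].
    now rewrite (Hu x).
Qed.

Lemma NoDup_types4 : NoDup types4.
Proof.
  assert (H : NoDup types) by (apply NoDup_list_prod; repeat constructor; simpl; lia).
  unfold types4; auto using NoDup_list_prod.
Qed.

Lemma in_types4 t0 t1 t2 t3 : In (t0, t1, t2, t3) types4 ->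
  (fst t0 < 3 /\ snd t0 < 3)%nat /\ (fst t1 < 3 /\ snd t1 < 3)%nat /\
  (fst t2 < 3 /\ snd t2 < 3)%nat /\ (fst t3 < 3 /\ snd t3 < 3)%nat.
Proof.
  assert (H : forall t, In t types -> (fst t < 3 /\ snd t < 3)%nat).
  { intros [v c] Ht; apply in_prod_iff in Ht; simpl in *; lia. }
  unfold types4; rewrite !in_prod_iff; intros [[[? ?] ?] ?]; auto 10.
Qed.

(** Each vector with nonzero coordinates has exactly one quadruple of types, any other vector has
    none. The local condition thus becomes a finite sum of products of functions of one coordinate,
    to which one-dimensional means apply. *)
Lemma local_indic_expansion p M cls U (phi : type_rule) : prime p -> unit_classes p M cls U ->
  (forall t0 t1 t2 t3 a0 a1 a2 a3,
    In t0 types -> In t1 types -> In t2 types -> In t3 types ->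
    has_type p cls (fst t0) (snd t0) a0 -> has_type p cls (fst t1) (snd t1) a1 ->
    has_type p cls (fst t2) (snd t2) a2 -> has_type p cls (fst t3) (snd t3) a3 ->
    (padic_soluble p (a0, a1, a2, a3) <-> phi t0 t1 t2 t3 = true)) ->
  forall a0 a1 a2 a3, local_indic p (a0, a1, a2, a3) =
  lsum types4 (fun '(t0, t1, t2, t3) => (if phi t0 t1 t2 t3 then 1 else 0) *
    (indic (has_type p cls (fst t0) (snd t0) a0) * indic (has_type p cls (fst t1) (snd t1) a1) *
     indic (has_type p cls (fst t2) (snd t2) a2) * indic (has_type p cls (fst t3) (snd t3) a3))).
Proof.
  intros Hp [_ [_ [Hcls _]]] Hphi a0 a1 a2 a3.
  set (P := fun '(t0, t1, t2, t3) =>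
    has_type p cls (fst t0) (snd t0) a0 /\ has_type p cls (fst t1) (snd t1) a1 /\
    has_type p cls (fst t2) (snd t2) a2 /\ has_type p cls (fst t3) (snd t3) a3).
  set (g := fun '(t0, t1, t2, t3) => if phi t0 t1 t2 t3 then 1 else 0).
  transitivity (lsum types4 (fun t => g t * indic (P t))).
  2: { apply lsum_ext; intros [[[t0 t1] t2] t3]; unfold g, P; rewrite !ind_and; ring. }
  unfold local_indic; destruct (classic (nonzero4 (a0, a1, a2, a3))) as [Hnz|Hnz].
  - assert (Hnz' := Hnz); destruct Hnz' as [N0 [N1 [N2 N3]]].
    destruct (has_type_exists p cls a0) as [v0 [c0 [V0 [C0 T0]]]]; auto.
    destruct (has_type_exists p cls a1) as [v1 [c1 [V1 [C1 T1]]]]; auto.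
    destruct (has_type_exists p cls a2) as [v2 [c2 [V2 [C2 T2]]]]; auto.
    destruct (has_type_exists p cls a3) as [v3 [c3 [V3 [C3 T3]]]]; auto.
    rewrite (lsum_indic_single _ _ _ ((v0, c0), (v1, c1), (v2, c2), (v3, c3))).
    + specialize (Hphi (v0, c0) (v1, c1) (v2, c2) (v3, c3) a0 a1 a2 a3).
      rewrite ind_and, ind_1, Rmult_1_l by auto.
      unfold g; destruct (phi _ _ _ _);
        [apply ind_1 | apply ind_0]; rewrite Hphi; auto using in_types; discriminate.
    + apply NoDup_types4.
    + unfold types4; apply in_prod; [apply in_prod; [apply in_prod|]|]; now apply in_types.
    + unfold P; auto.
    + intros [[[[w0 d0] [w1 d1]] [w2 d2]] [w3 d3]] Hin [H0 [H1 [H2 H3]]].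
      apply in_types4 in Hin; cbn [fst snd] in *; destruct Hin as [[? _] [[? _] [[? _] [? _]]]].
      rewrite (has_type_unique p cls a0 w0 d0 v0 c0), (has_type_unique p cls a1 w1 d1 v1 c1),
        (has_type_unique p cls a2 w2 d2 v2 c2), (has_type_unique p cls a3 w3 d3 v3 c3); auto.
  - rewrite ind_0 by tauto; symmetry.
    rewrite (lsum_ext _ _ (fun _ => 0)), lsum_0; auto.
    intros [[[t0 t1] t2] t3]; rewrite ind_0; [ring|].
    intros [H0 [H1 [H2 H3]]]; apply Hnz.
    repeat split; eapply has_type_nonzero; eauto.
Qed.

Definition lprod {A : Type} (l : list A) (f : A -> R) : R :=
  fold_right (fun a s => f a * s) 1 l.

Lemma vol4_pos n : 0 < vol n ^ 4.
Proof. apply pow_lt; assert (H := vol_pos n); lra. Qed.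

Definition mean4 (F : Z4 -> R) (d : R) : Prop :=
  Un_cv (fun n => lsum (box n) F / vol n ^ 4) d.

Lemma mean4_product f0 f1 f2 f3 d0 d1 d2 d3 :
  mean1 f0 d0 -> mean1 f1 d1 -> mean1 f2 d2 -> mean1 f3 d3 ->
  mean4 (fun '(a0, a1, a2, a3) => f0 a0 * f1 a1 * f2 a2 * f3 a3) (d0 * d1 * d2 * d3).
Proof.
  intros H0 H1 H2 H3; unfold mean4.
  apply Un_cv_ext with (fun n => lsum (Zrange n) f0 / vol n * (lsum (Zrange n) f1 / vol n)
     * (lsum (Zrange n) f2 / vol n) * (lsum (Zrange n) f3 / vol n)).
  - intros n; rewrite lsum_box_mult; assert (V := vol_pos n); field; lra.
  - repeat apply CV_mult; auto.
Qed.

(** Induction on the primes, with arbitrary weights [f0] to [f3] so that the hypothesis can be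
    reused: after expansion at the first prime, each indicator of a type joins the weight on its
    coordinate and [equidistributed_type] restores the assumptions for the other primes. *)
Lemma mean4_local_conditions (phi : Z -> type_rule) ps : NoDup ps ->
  (forall p, In p ps -> governed_by p (phi p)) ->
  forall f0 f1 f2 f3 d0 d1 d2 d3,
  (forall k, 0 <= f0 k <= 1) -> (forall k, 0 <= f1 k <= 1) ->
  (forall k, 0 <= f2 k <= 1) -> (forall k, 0 <= f3 k <= 1) ->
  equidistributed ps f0 d0 -> equidistributed ps f1 d1 ->
  equidistributed ps f2 d2 -> equidistributed ps f3 d3 ->
  mean4 (fun '(a0, a1, a2, a3) => f0 a0 * f1 a1 * f2 a2 * f3 a3
          * lprod ps (fun p => local_indic p (a0, a1, a2, a3)))
    (d0 * d1 * d2 * d3 * lprod ps (fun p => type_sum (IZR p) (phi p))).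
Proof.
  induction ps as [|p ps IH]; intros Hnd Hps f0 f1 f2 f3 d0 d1 d2 d3 B0 B1 B2 B3 Q0 Q1 Q2 Q3.
  - simpl; rewrite Rmult_1_r.
    assert (H := mean4_product f0 f1 f2 f3 d0 d1 d2 d3
      (equidistributed_mean _ _ _ Q0) (equidistributed_mean _ _ _ Q1)
      (equidistributed_mean _ _ _ Q2) (equidistributed_mean _ _ _ Q3)).
    revert H; apply Un_cv_ext; intros n; f_equal; apply lsum_ext.
    intros [[[a0 a1] a2] a3]; ring.
  - apply NoDup_cons_iff in Hnd; destruct Hnd as [Hp Hnd].
    destruct (Hps p (or_introl eq_refl)) as [Hprime [M [cls [U [HU Hphi]]]]].
    assert (Hexp := local_indic_expansion p M cls U (phi p) Hprime HU Hphi).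
    set (h := fun t k => indic (has_type p cls (fst t) (snd t) k)) in *.
    set (td := fun t : nat * nat => type_density (IZR p) (fst t)).
    set (L := lprod ps (fun p => type_sum (IZR p) (phi p))).
    replace (d0 * d1 * d2 * d3 * lprod (p :: ps) (fun p => type_sum (IZR p) (phi p))) with
      (lsum types4 (fun t => let '(t0, t1, t2, t3) := t in
        (if phi p t0 t1 t2 t3 then 1 else 0) *
        ((d0 * td t0) * (d1 * td t1) * (d2 * td t2) * (d3 * td t3) * L))).
    2: { simpl lprod; fold L; unfold type_sum.
         rewrite <- Rmult_assoc, <- lsum_scal, <- lsum_scal_r; apply lsum_ext.
         intros [[[t0 t1] t2] t3]; unfold td; ring. }
    unfold mean4.
    apply Un_cv_ext with (fun n => lsum types4 (fun t => let '(t0, t1, t2, t3) := t in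
      (if phi p t0 t1 t2 t3 then 1 else 0) * (lsum (box n) (fun '(a0, a1, a2, a3) =>
        (f0 a0 * h t0 a0) * (f1 a1 * h t1 a1) * (f2 a2 * h t2 a2) * (f3 a3 * h t3 a3)
          * lprod ps (fun p => local_indic p (a0, a1, a2, a3))) / vol n ^ 4))).
    + intros n.
      rewrite (lsum_ext _ _ (fun t => lsum (box n) (fun a => (let '(a0, a1, a2, a3) := a in
         let '(t0, t1, t2, t3) := t in (if phi p t0 t1 t2 t3 then 1 else 0) *
         ((f0 a0 * h t0 a0) * (f1 a1 * h t1 a1) * (f2 a2 * h t2 a2) * (f3 a3 * h t3 a3)
          * lprod ps (fun p => local_indic p (a0, a1, a2, a3)))) * / vol n ^ 4))).
      2: { intros [[[t0 t1] t2] t3]; unfold Rdiv.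
           rewrite lsum_scal_r, <- Rmult_assoc, <- lsum_scal; f_equal; apply lsum_ext.
           intros [[[a0 a1] a2] a3]; auto. }
      rewrite lsum_swap; unfold Rdiv; rewrite <- lsum_scal_r; apply lsum_ext.
      intros [[[a0 a1] a2] a3]; rewrite lsum_scal_r; f_equal.
      simpl lprod; rewrite Hexp, <- Rmult_assoc, <- lsum_scal, <- lsum_scal_r.
      apply lsum_ext; intros [[[t0 t1] t2] t3]; unfold h; ring.
    + apply (Un_cv_lsum types4 (fun t n => let '(t0, t1, t2, t3) := t in
      (if phi p t0 t1 t2 t3 then 1 else 0) * (lsum (box n) (fun '(a0, a1, a2, a3) =>
        (f0 a0 * h t0 a0) * (f1 a1 * h t1 a1) * (f2 a2 * h t2 a2) * (f3 a3 * h t3 a3)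
          * lprod ps (fun p => local_indic p (a0, a1, a2, a3))) / vol n ^ 4))).
      intros [[[t0 t1] t2] t3] Hin.
      apply in_types4 in Hin; destruct Hin as [[_ ?] [[_ ?] [[_ ?] [_ ?]]]].
      apply CV_mult; [apply Un_cv_const|].
      assert (Bh : forall f t, (forall k, 0 <= f k <= 1) -> forall k, 0 <= f k * h t k <= 1).
      { intros f t Hf k; assert (F := Hf k); unfold h.
        assert (I := ind_bounds (has_type p cls (fst t) (snd t) k)); nra. }
      apply IH; auto; try (intros q Hq; apply Hps; now right);
        now apply (equidistributed_type p M cls U Hprime HU).
Qed.

(** * Evaluation of the local densities *)

Definition valuation_weight (t : nat * nat * (nat * nat) * (nat * nat) * (nat * nat)) : nat :=
  let '(t0, t1, t2, t3) := t in (fst t0 + fst t1 + fst t2 + fst t3)%nat.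

Definition weight_count (phi : type_rule) (j : nat) : Z :=
  Z.of_nat (length (filter (fun t => let '(t0, t1, t2, t3) := t in
    phi t0 t1 t2 t3 && Nat.eqb (valuation_weight t) j) types4)).

Lemma length_filter_lsum {A} (f : A -> bool) l :
  IZR (Z.of_nat (length (filter f l))) = lsum l (fun x => if f x then 1 else 0).
Proof.
  induction l as [|x l IH]; auto; simpl filter; simpl lsum; rewrite <- IH.
  destruct (f x); [|ring].
  change (length (x :: ?u)) with (S (length u)); rewrite Nat2Z.inj_succ, succ_IZR; ring.
Qed.

Lemma lsum_seq_pow (t : R) n w : (w < n)%nat ->
  lsum (seq 0 n) (fun j => (if Nat.eqb w j then 1 else 0) * t ^ j) = t ^ w.
Proof.
  intros Hw.
  rewrite (lsum_ext _ _ (fun j => t ^ j * indic (j = w))).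
  - apply lsum_indic_single; auto using seq_NoDup; apply in_seq; lia.
  - intros j; destruct (Nat.eqb_spec w j); [rewrite ind_1 | rewrite ind_0]; auto; ring.
Qed.

(** The density of a quadruple of types depends only on the sum of its valuations, at most 8. The
    factor 81 comes from the three classes in each of four coordinates. *)
Lemma type_sum_by_weight x phi : x <> 0 -> 1 - (/ x) ^ 3 <> 0 ->
  type_sum x phi = ((1 - / x) / (1 - (/ x) ^ 3)) ^ 4 / 81 *
    lsum (seq 0 9) (fun j => IZR (weight_count phi j) * (/ x) ^ j).
Proof.
  intros Hx Hx3; unfold type_sum, weight_count.
  rewrite (lsum_ext (seq 0 9) _ (fun j => lsum types4 (fun t =>
    (let '(t0, t1, t2, t3) := t in if phi t0 t1 t2 t3 then 1 else 0) *
     ((if Nat.eqb (valuation_weight t) j then 1 else 0) * (/ x) ^ j)))).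
  2: { intros j; rewrite length_filter_lsum, <- lsum_scal_r; apply lsum_ext.
       intros [[[t0 t1] t2] t3].
       destruct (phi t0 t1 t2 t3), (Nat.eqb _ j); simpl andb; cbv iota; ring. }
  rewrite lsum_swap, <- lsum_scal; apply lsum_ext_in; intros [[[t0 t1] t2] t3] Hin.
  rewrite lsum_scal, lsum_seq_pow.
  - unfold valuation_weight, type_density; rewrite !pow_add.
    set (K := (1 - / x) / (1 - (/ x) ^ 3)); field.
  - apply in_types4 in Hin; unfold valuation_weight; lia.
Qed.

Lemma weight_counts_1mod3 : map (weight_count soluble_types_1mod3) (seq 0 9) =
  [81; 324; 594; 648; 675; 648; 594; 324; 81]%Z.
Proof. now vm_compute. Qed.

Lemma weight_counts_3 : map (weight_count soluble_types_3) (seq 0 9) =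
  [81; 324; 738; 1224; 1539; 1296; 810; 252; 81]%Z.
Proof. now vm_compute. Qed.

Lemma lsum_weight_counts phi x l : map (weight_count phi) (seq 0 9) = l ->
  lsum (seq 0 9) (fun j => IZR (weight_count phi j) * x ^ j) =
  fold_right (fun c s => IZR c + x * s) 0 l.
Proof. intros <-; simpl; ring. Qed.

(** With [t = 1/x], the counting polynomial is 81 times [1 + t + t^2] times the three quadratic
    factors of [sigma_p]. The factor [1 + t + t^2] cancels one of the four copies of
    [(1-t)/(1-t^3)], leaving the cube. *)
Lemma type_sum_1mod3 x : 2 <= x -> type_sum x soluble_types_1mod3 = sigma_p x.
Proof.
  intros Hx.
  assert (Hx3 : x ^ 3 - 1 <> 0) by (simpl; nra).
  rewrite type_sum_by_weight, (lsum_weight_counts _ _ _ weight_counts_1mod3).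
  - unfold sigma_p; simpl fold_right; field; split; lra.
  - lra.
  - replace (1 - (/ x) ^ 3) with ((x ^ 3 - 1) / x ^ 3) by (field; lra).
    apply Rmult_integral_contrapositive_currified; auto.
    apply Rinv_neq_0_compat, pow_nonzero; lra.
Qed.

Lemma type_sum_3 : type_sum 3 soluble_types_3 = sigma_3.
Proof.
  rewrite type_sum_by_weight, (lsum_weight_counts _ _ _ weight_counts_3) by lra.
  unfold sigma_3; simpl fold_right; field.
Qed.

Lemma sigma_p_bounds x : 2 <= x -> 0 <= sigma_p x <= 1.
Proof.
  intros Hx; set (t := / x).
  assert (Ht : 0 < t <= / 2)
    by (unfold t; split; [apply Rinv_0_lt_compat | apply Rinv_le_contravar]; lra).
  assert (E : sigma_p x = (1 - t + t ^ 2) * (1 + t + t ^ 2 / 3) * (1 + 3 * t + 3 * t ^ 2)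
                          / (1 + t + t ^ 2) ^ 3).
  { assert (Hx3 : x ^ 3 - 1 <> 0) by (simpl; nra).
    unfold sigma_p, t; field; repeat split; try lra; simpl; nra. }
  assert (Hden : 0 < (1 + t + t ^ 2) ^ 3) by (apply pow_lt; nra).
  rewrite E; split.
  - apply Rmult_le_pos; [|apply Rlt_le, Rinv_0_lt_compat; auto].
    repeat apply Rmult_le_pos; nra.
  - apply Rmult_le_reg_r with ((1 + t + t ^ 2) ^ 3); auto.
    unfold Rdiv at 1; rewrite Rmult_assoc, Rinv_l, Rmult_1_r, Rmult_1_l by lra.
    (* Denominator minus numerator is exactly [8/3 (t(1+t))^2], so the factor never exceeds 1. *)
    apply Rminus_le; replace (_ - _) with (- (8 / 3 * (t * (1 + t)) ^ 2)) by field.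
    assert (H := pow2_ge_0 (t * (1 + t))); lra.
Qed.

(** * Cubic classes modulo a prime *)

Module CubicClasses.
From mathcomp Require Import all_boot all_algebra all_fingroup all_solvable all_field.
From mathcomp Require Import ssrZ zify ring.
Import GRing.Theory.
Local Open Scope ring_scope.

Section FiniteField.
Variables (F : finFieldType) (m : nat).
Hypothesis cardF : #|F| = (3 * m).+1.

Lemma m_gt0 : (0 < m)%N.
Proof.
have : (1 < #|F|)%N by apply: finNzRing_gt1.
by rewrite cardF; case: m.
Qed.

(** All [3m] nonzero elements are roots of unity of order dividing [3m], which is enough to force a
    primitive one in a field. *)
Lemma primitive_root_exists : exists z : F, (3 * m).-primitive_root z.
Proof.
have n0 : (0 < 3 * m)%N by rewrite muln_gt0 m_gt0.
pose rs := [seq x <- enum F | x != 0].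
have hall : all (3 * m).-unity_root rs.
  apply/allP=> x; rewrite mem_filter => /andP [x0 _].
  apply/unity_rootP; apply: (mulfI x0).
  by rewrite -exprS -cardF expf_card mulr1.
have hu : uniq rs by apply/filter_uniq/enum_uniq.
have hs : (3 * m <= size rs)%N.
  rewrite size_filter -[count _ _]/(count (predC1 0) _).
  have := count_predC (pred1 (0 : F)) (enum F).
  rewrite -cardE cardF count_uniq_mem ?enum_uniq // mem_enum inE.
  rewrite add1n => - [<-]; exact: leqnn.
by have /hasP [z _ hz] := has_prim_root n0 hall hu hs; exists z.
Qed.

Variable z : F.
Hypothesis hz : (3 * m).-primitive_root z.

(** The discrete logarithm to base [z], reduced modulo 3; this does not depend on the choice of
    logarithm since 3 divides [3m]. The value at 0 is the default 0. *)
Definition cls (x : F) : nat :=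
  if [pick i : 'I_(3 * m) | x == z ^+ i] is Some i then (i %% 3)%N else 0%N.

Lemma z_neq0 : z != 0.
Proof.
apply/eqP=> z0; have := prim_expr_order hz.
rewrite z0 expr0n muln_eq0 /= -[m == 0%N]negbK -lt0n m_gt0 /=.
by move/eqP; rewrite eq_sym oner_eq0.
Qed.

Lemma logz x : x != 0 -> exists i : nat, x = z ^+ i.
Proof.
move=> x0.
have /(prim_rootP hz) [i ->] : x ^+ (3 * m) = 1.
  apply: (mulfI x0).
  by rewrite -exprS -cardF expf_card mulr1.
by exists i.
Qed.

Lemma clsX i : cls (z ^+ i) = (i %% 3)%N.
Proof.
rewrite /cls; case: pickP => [j|].
  rewrite (eq_prim_root_expr hz) => /eqP.
  move/(congr1 (modn^~ 3)); rewrite !modn_dvdm ?dvdn_mulr //.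
have n0 : (0 < 3 * m)%N by rewrite muln_gt0 m_gt0.
move/(_ (Ordinal (ltn_pmod i n0))) => /=.
by rewrite (prim_expr_mod hz) eqxx.
Qed.

Lemma cls_lt3 x : (cls x < 3)%N.
Proof. by rewrite /cls; case: pickP => // i _; rewrite ltn_mod. Qed.

Lemma clsM x y : x != 0 -> y != 0 -> cls (x * y) = ((cls x + cls y) %% 3)%N.
Proof.
move=> /logz [i ->] /logz [j ->].
by rewrite -exprD !clsX modnDml modnDmr.
Qed.

Lemma cls_cube s : s != 0 -> cls (s ^+ 3) = 0%N.
Proof. by move=> /logz [i ->]; rewrite -exprM clsX modnMl. Qed.

Lemma cube_of_cls x : x != 0 -> cls x = 0%N -> exists s, s ^+ 3 = x.
Proof.
move=> /logz [i ->]; rewrite clsX => h.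
exists (z ^+ (i %/ 3)); rewrite -exprM.
by rewrite {2}(divn_eq i 3) h addn0.
Qed.

(** -1 is its own cube. *)
Lemma clsN x : cls (- x) = cls x.
Proof.
have [->|x0] := eqVneq x 0; first by rewrite oppr0.
have -> : - x = (-1) ^+ 3 * x by rewrite -signr_odd /= expr1 mulN1r.
rewrite clsM ?expf_neq0 ?oppr_eq0 ?oner_eq0 // cls_cube ?oppr_eq0 ?oner_eq0 //.
by rewrite add0n modn_small ?cls_lt3.
Qed.

Lemma clsV x : x != 0 -> ((cls x^-1 + cls x) %% 3)%N = 0%N.
Proof.
move=> x0; rewrite -clsM ?invr_eq0 // mulVf //.
by have := clsX 0; rewrite expr0.
Qed.

Lemma eq_clsP x y : x != 0 -> y != 0 ->
  (cls x = cls y <-> exists s, x * s ^+ 3 + y = 0).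
Proof.
move=> x0 y0; split=> [h|[s hs]].
  have hq : cls (- y * x^-1) = 0%N.
    rewrite clsM ?oppr_eq0 ?invr_eq0 // clsN -h addnC; exact: clsV.
  have [|s hs] := cube_of_cls _ _ hq; first by rewrite mulf_neq0 ?oppr_eq0 ?invr_eq0.
  by exists s; rewrite hs mulrC mulfVK // addNr.
have s0 : s != 0.
  apply/eqP=> s0; move: hs; rewrite s0 expr0n /= mulr0 add0r => /eqP.
  by rewrite (negbTE y0).
have -> : y = - (x * s ^+ 3) by apply/eqP; rewrite -addr_eq0 addrC hs.
rewrite clsN clsM ?expf_neq0 // cls_cube // addn0.
by rewrite modn_small ?cls_lt3.
Qed.

Definition class (c : nat) : {set F} := [set x | (x != 0) && (cls x == c)].

(** Multiplication by [z] permutes the three classes cyclically, so each has a third of the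
    units. *)
Lemma card_class_succ c : (c < 3)%N -> #|class c| = #|class (c.+1 %% 3)|.
Proof.
move=> c3; rewrite -(card_imset _ (mulfI z_neq0)).
apply: eq_card => y; rewrite !inE; apply/imsetP/andP => [[x]|[y0 /eqP hy]].
  rewrite inE => /andP [x0 /eqP hx] ->.
  rewrite mulf_neq0 ?z_neq0 // clsM ?z_neq0 // hx.
  have := clsX 1; rewrite expr1 => ->.
  by rewrite modnDml add1n.
exists (z^-1 * y); last by rewrite mulVKf ?z_neq0.
rewrite inE mulf_neq0 ?invr_eq0 ?z_neq0 //=.
apply/eqP; rewrite clsM ?invr_eq0 ?z_neq0 // hy.
have := clsV _ z_neq0.
have := clsX 1; rewrite expr1 => ->; move: (cls_lt3 z^-1).
case: (cls z^-1) => [|[|[|]]] //.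
by move: c3; case: c {hy} => [|[|[|]]].
Qed.

Lemma card_class c : (c < 3)%N -> #|class c| = m.
Proof.
have h0 := card_class_succ 0 isT; have h1 := card_class_succ 1 isT.
rewrite /= in h0 h1.
rewrite -[(1 %% 3)%N]/1%N in h0; rewrite -[(2 %% 3)%N]/2%N in h1.
have hs : (#|class 0| + #|class 1| + #|class 2|)%N = (3 * m)%N.
  have <- : (\sum_(x : F | x != 0%R) 1)%N = (3 * m)%N.
    by rewrite sum1_card cardC1 cardF.
  rewrite -!sum1_card.
  rewrite [RHS](partition_big (fun x => inord (cls x) : 'I_3) xpredT) //=.
  rewrite !big_ord_recl big_ord0 addn0 addnA.
  by congr (_ + _ + _)%N; apply: eq_bigl => x; rewrite inE; congr (_ && _);
     rewrite -val_eqE /= inordK ?cls_lt3.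
move: hs; rewrite -h1 -h0 => hs.
have h : #|class 0| = m by move: hs; set k := #|_|; lia.
by case: c => [|[|[|]]] // _; rewrite -?h1 -h0.
Qed.

(* If no y in C1 has y + 1 in C2, then y |-> -(y+1) (when y + 1 is in C0) and
   y |-> -(1+1/y) (when y + 1 is in C1) injects C1 into C0 minus -1. *)
Lemma consecutive_classes : exists y : F,
  [/\ y != 0, y + 1 != 0, cls y = 1%N & cls (y + 1) = 2%N].
Proof.
case: (pickP (fun y : F => [&& y != 0, y + 1 != 0, cls y == 1%N & cls (y + 1) == 2%N])).
  by move=> y /and4P [y0 y1 /eqP h1 /eqP h2]; exists y.
move=> hno; exfalso.
have c1 : cls 1 = 0%N by have := clsX 0; rewrite expr0.
have y1 (y : F) : y != 0 -> cls y = 1%N -> y + 1 != 0.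
  move=> y0 hy; apply/eqP=> h.
  have hy1 : y = -1 by apply/eqP; rewrite -addr_eq0 h.
  by move: hy; rewrite hy1 clsN c1.
have cases (y : F) : y != 0 -> cls y = 1%N -> cls (y + 1) = 0%N \/ cls (y + 1) = 1%N.
  move=> y0 hy; have := hno y; rewrite y0 (y1 _ y0 hy) hy /=.
  by have := cls_lt3 (y + 1); case: (cls (y + 1)) => [|[|[|]]]; auto.
pose f y := if cls (y + 1) == 0%N then - (y + 1) else - (1 + y^-1).
have clsVy (y : F) : y != 0 -> cls y = 1%N -> cls y^-1 = 2%N.
  move=> y0 hy; have := clsV _ y0; rewrite hy.
  by have := cls_lt3 y^-1; case: (cls y^-1) => [|[|[|]]].
have sumV (y : F) : y != 0 -> 1 + y^-1 = (y + 1) * y^-1.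
  by move=> y0; rewrite mulrDl divff // mul1r.
have finj : {in class 1 &, injective f}.
  move=> a b; rewrite !inE => /andP [a0 /eqP ha] /andP [b0 /eqP hb].
  rewrite /f; case: ifP => h1; case: ifP => h2 /oppr_inj.
  - by move/addIr.
  - rewrite addrC => /addrI h; exfalso.
    by have := clsVy _ b0 hb; rewrite -h ha.
  - rewrite [RHS]addrC => /addrI h; exfalso.
    by have := clsVy _ a0 ha; rewrite h hb.
  - by move/addrI/invr_inj.
have fsub : f @: class 1 \subset class 0 :\ (-1).
  apply/subsetP => x /imsetP [y]; rewrite inE => /andP [y0 /eqP hy] ->.
  have yy := y1 _ y0 hy.
  rewrite !inE /f; case: ifP => h.
    rewrite eqr_opp oppr_eq0 yy clsN h andbT -subr_eq0 addrK.
    by rewrite y0.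
  have h1 : cls (y + 1) = 1%N by case: (cases y y0 hy) h => ->.
  rewrite eqr_opp oppr_eq0 clsN -subr_eq0 addrAC subrr add0r invr_eq0 y0 /=.
  rewrite sumV // mulf_neq0 ?invr_eq0 //= clsM ?invr_eq0 // h1.
  by rewrite (clsVy _ y0 hy).
have := subset_leq_card fsub; rewrite card_in_imset // card_class //.
have := cardsD1 (-1) (class 0); rewrite card_class // inE oppr_eq0 oner_eq0 clsN c1 /=.
by rewrite add1n => hm h; move: h; rewrite -ltnS -hm ltnn.
Qed.

Lemma diagonal_cubic_curve_point u0 u1 u2 : u0 != 0 -> u1 != 0 -> u2 != 0 ->
  exists x0 x1 x2 : F,
    u0 * x0 ^+ 3 + u1 * x1 ^+ 3 + u2 * x2 ^+ 3 = 0 /\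
    ~ (x0 = 0 /\ x1 = 0 /\ x2 = 0).
Proof.
move=> h0 h1 h2.
have one0 : (1 : F) <> 0 by apply/eqP/oner_neq0.
have e3 : (0 : F) ^+ 3 = 0 by rewrite expr0n.
have e13 : (1 : F) ^+ 3 = 1 by rewrite expr1n.
have [/(eq_clsP _ _ h0 h1) [s hs]|n01] := eqVneq (cls u0) (cls u1).
  by exists s, 1, 0; rewrite e13 e3 mulr0 mulr1 hs addr0; split=> // - [_ []].
have [/(eq_clsP _ _ h0 h2) [s hs]|n02] := eqVneq (cls u0) (cls u2).
  by exists s, 0, 1; rewrite e13 e3 mulr0 mulr1 addr0 hs; split=> // - [_ []].
have [/(eq_clsP _ _ h1 h2) [s hs]|n12] := eqVneq (cls u1) (cls u2).
  by exists 0, s, 1; rewrite e13 e3 mulr0 mulr1 add0r hs; split=> // - [_ []].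
have [y [y0 y1 cy cy1]] := consecutive_classes.
have c1 : cls 1 = 0%N by have := clsX 0; rewrite expr0.
(* The elements [1], [y], [-(y+1)] represent the classes 0, 1, 2 and add up to 0. Each [u_i x_i^3]
   can be made equal to the representative of the class of [u_i], and the three classes are distinct
   here. *)
pose w (c : nat) := if c == 0%N then 1 else if c == 1%N then y else - (y + 1).
have wne c : w c != 0 by rewrite /w; case: ifP; [rewrite oner_neq0|case: ifP; rewrite ?oppr_eq0].
have wcls c : (c < 3)%N -> cls (w c) = c.
  by rewrite /w; case: c => [|[|[|]]] //= _; rewrite clsN.
have sol (u : F) : u != 0 -> exists x, u * x ^+ 3 = w (cls u) /\ x <> 0.
  move=> unz.
  have [s /eqP] : exists s, u * s ^+ 3 + - w (cls u) = 0.
    by apply/eq_clsP; rewrite ?oppr_eq0 ?wne // clsN wcls ?cls_lt3.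
  rewrite subr_eq0 => /eqP hs; exists s; split=> // s0.
  by move: hs; rewrite s0 e3 mulr0 => /esym/eqP; rewrite (negbTE (wne _)).
have [x0 [e0 x00]] := sol _ h0; have [x1 [e1 _]] := sol _ h1.
have [x2 [e2 _]] := sol _ h2.
exists x0, x1, x2; split; last by case.
rewrite e0 e1 e2.
move: n01 n02 n12 (cls_lt3 u0) (cls_lt3 u1) (cls_lt3 u2).
case: (cls u0) => [|[|[|]]] //; case: (cls u1) => [|[|[|]]] //;
  case: (cls u2) => [|[|[|]]] // _ _ _ _ _ _; rewrite /w /=; ring.
Qed.

End FiniteField.

(* MathComp rebinds the delimiter %Z to its own integers. *)
Delimit Scope Z_scope with coqZ.

(** * From the finite field back to the integers *)

Definition red (p : nat) (k : Z) : 'F_p := (int_of_Z k)%:~R.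

Lemma redD p k l : red p (k + l)%coqZ = red p k + red p l.
Proof. by rewrite /red -[(k + l)%coqZ]/(k + l) rmorphD /= rmorphD. Qed.

Lemma redM p k l : red p (k * l)%coqZ = red p k * red p l.
Proof. by rewrite /red -[(k * l)%coqZ]/(k * l) rmorphM /= rmorphM. Qed.

Lemma red_nat p n : red p (Z.of_nat n) = n%:R.
Proof.
rewrite /red; have -> : int_of_Z (Z.of_nat n) = n%:Z by lia.
by rewrite pmulrn.
Qed.

Lemma red_eq0 (p : nat) k : prime.prime p ->
  red p k = 0 <-> Z.divide (Z.of_nat p) k.
Proof.
move=> pp.
have h0 n : red p (Z.of_nat n) = 0 <-> Z.divide (Z.of_nat p) (Z.of_nat n).
  rewrite red_nat; split.
    move/eqP; rewrite -(dvdn_pcharf (pchar_Fp pp)) => /dvdnP [q ->].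
    by exists (Z.of_nat q); lia.
  move=> [q hq]; apply/eqP; rewrite -(dvdn_pcharf (pchar_Fp pp)).
  apply/dvdnP; exists (Z.to_nat q); have := prime_gt0 pp.
  have [q0|q0] := Z_lt_le_dec q 0; nia.
have [k0|k0] := Z_lt_le_dec k 0.
  have -> : k = Z.mul (-1) (Z.of_nat (Z.to_nat (- k))) by lia.
  rewrite redM; split.
    move/eqP; rewrite mulf_eq0 => /orP [/eqP h|/eqP /h0 h].
      by move: h; rewrite /red /= => /eqP; rewrite oppr_eq0 oner_eq0.
    by apply: Z.divide_mul_r.
  move=> h; suff -> : red p (Z.of_nat (Z.to_nat (- k))) = 0 by rewrite mulr0.
  by apply/h0; case: h => q hq; exists (Z.opp q); lia.
by have -> : k = Z.of_nat (Z.to_nat k) by lia.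
Qed.

Lemma red_surj p (x : 'F_p) : exists k, red p k = x.
Proof. by exists (Z.of_nat x); rewrite red_nat natr_Zp. Qed.

Lemma prime_of_nat_prime p : Znumtheory.prime (Z.of_nat p) -> prime.prime p.
Proof.
move=> pp; have p1 := prime_ge_2 _ pp.
apply/primeP; split; first by lia.
move=> d /dvdnP [q hq].
have hd : Z.divide (Z.of_nat d) (Z.of_nat p) by exists (Z.of_nat q); lia.
by have := prime_divisors _ pp _ hd; lia.
Qed.

Lemma InP (T : eqType) (x : T) s : reflect (In x s) (x \in s).
Proof.
elim: s => [|y s IH]; first by constructor.
rewrite inE; apply: (iffP orP) => [[/eqP ->|/IH]|[->|/IH]] /=; auto.
Qed.

Lemma uniq_NoDup_map (T : eqType) U (f : T -> U) s : injective f -> uniq s -> NoDup (map f s).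
Proof.
move=> finj; elim: s => [_|x s IH /= /andP [xs us]]; first by constructor.
constructor; last by apply: IH.
by move=> /in_map_iff [y [/finj -> /InP ys]]; rewrite ys in xs.
Qed.

(** Packages the finite field results as statements about integers modulo [p], in the shape required
    by [unit_classes] with modulus [p] and by the two hypotheses on classes and curves modulo
    [p]. *)
Lemma cubic_classes_mod_prime (p : Z) : Znumtheory.prime p -> Z.modulo p 3 = 1%coqZ ->
  exists (c : Z -> nat) (U : nat -> list Z),
    (forall k, lt (c k) 3) /\
    (forall k l, Z.divide p (k - l) -> c k = c l) /\
    (forall u w, ~ Z.divide p u -> ~ Z.divide p w ->
       (c u = c w <-> exists s, Z.divide p (u * Z.pow s 3 + w)%coqZ)) /\
    (forall u0 u1 u2, ~ Z.divide p u0 -> ~ Z.divide p u1 -> ~ Z.divide p u2 ->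
       exists x0 x1 x2,
         Z.divide p (u0 * Z.pow x0 3 + u1 * Z.pow x1 3 + u2 * Z.pow x2 3)%coqZ /\
         ~ (Z.divide p x0 /\ Z.divide p x1 /\ Z.divide p x2)) /\
    (forall i, lt i 3 -> NoDup (U i) /\ (Z.of_nat (length (U i)) * 3 = p - 1)%coqZ /\
       forall u, In u (U i) <-> (Z.le 0 u /\ Z.lt u p) /\ ~ Z.divide p u /\ c u = i).
Proof.
move=> ppZ; have p2 := prime_ge_2 _ ppZ.
have [pn hpn] : exists n, p = Z.of_nat n by exists (Z.to_nat p); lia.
subst p => p3; have pp := prime_of_nat_prime _ ppZ.
have [m hm] : exists m, pn = (3 * m).+1.
  exists (Z.to_nat (Z.div (Z.of_nat pn) 3)).
  by have := Z.div_mod (Z.of_nat pn) 3; have := Z.div_pos (Z.of_nat pn) 3; lia.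
have cF : #|'F_pn| = (3 * m).+1 by rewrite card_Fp.
have [z hz] := primitive_root_exists _ _ cF.
have redX k : red pn (Z.pow k 3) = red pn k ^+ 3.
  have -> : Z.pow k 3 = Z.mul k (Z.mul k k) by lia.
  by rewrite !redM !exprS expr0 mulr1.
have ne k : ~ Z.divide (Z.of_nat pn) k -> red pn k != 0.
  by move=> h; apply/eqP=> h'; apply/h/red_eq0.
have red_modp k l : Z.divide (Z.of_nat pn) (k - l) -> red pn k = red pn l.
  move=> /red_eq0 -/(_ pp) h.
  have -> : k = Z.add (k - l)%coqZ l by lia.
  by rewrite redD h add0r.
exists (fun k => cls _ m z (red pn k)).
exists (fun i => List.map (fun x : 'F_pn => Z.of_nat x) (enum (class _ m z i))).
split; first by move=> k; apply/ltP/cls_lt3.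
split; first by move=> k l /red_modp ->.
split.
  move=> u w /ne u0 /ne w0; rewrite (eq_clsP _ _ cF _ hz _ _ u0 w0); split.
    move=> [s]; have [k <-] := red_surj _ s => h.
    by exists k; apply/red_eq0 => //; rewrite redD redM redX.
  move=> [s /red_eq0 h]; exists (red pn s).
  by rewrite -redX -redM -redD; apply: h.
split.
  move=> u0 u1 u2 /ne h0 /ne h1 /ne h2.
  have [x0 [x1 [x2 []]]] := diagonal_cubic_curve_point _ _ cF _ hz _ _ _ h0 h1 h2.
  have [k0 <-] := red_surj _ x0; have [k1 <-] := red_surj _ x1.
  have [k2 <-] := red_surj _ x2; move=> he hn.
  exists k0, k1, k2; split.
    by apply/red_eq0 => //; rewrite !redD (redM _ u0) (redM _ u1) (redM _ u2) !redX.
  by move=> [/red_eq0 a [/red_eq0 b /red_eq0 c]]; apply: hn; rewrite a ?b ?c.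
move=> i /ltP i3; split; [|split].
- apply: uniq_NoDup_map; last exact: enum_uniq.
  by move=> x y h; apply: val_inj => /=; lia.
- rewrite length_map -[length _]/(size _) -cardE (card_class _ _ cF _ hz) //; lia.
- move=> u; rewrite in_map_iff; split.
    move=> [x [<- /InP]]; rewrite mem_enum inE => /andP [x0 /eqP hx].
    have redx : red pn (Z.of_nat x) = x by rewrite red_nat natr_Zp.
    rewrite redx; split.
      have := ltn_ord x; rewrite [X in (_ < X)%N]Fp_cast //; lia.
    by split=> // /red_eq0; rewrite redx => /(_ pp) /eqP; rewrite (negbTE x0).
  move=> [[u0 up] [/ne hu hc]]; exists (red pn u); split.
    have [n hn] : exists n, u = Z.of_nat n by exists (Z.to_nat u); lia.
    by rewrite hn red_nat val_Fp_nat // modn_small //; lia.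
  by apply/InP; rewrite mem_enum inE hu hc eqxx.
Qed.

Lemma cube_mod_prime (p u : Z) : Znumtheory.prime p -> Z.modulo p 3 = 2%coqZ ->
  exists s, Z.divide p (Z.pow s 3 - u)%coqZ.
Proof.
move=> ppZ; have p2 := prime_ge_2 _ ppZ.
have [pn hpn] : exists n, p = Z.of_nat n by exists (Z.to_nat p); lia.
subst p => p3; have pp := prime_of_nat_prime _ ppZ.
have [m hm] : exists m, pn = (3 * m).+2.
  exists (Z.to_nat (Z.div (Z.of_nat pn) 3)).
  by have := Z.div_mod (Z.of_nat pn) 3; have := Z.div_pos (Z.of_nat pn) 3; lia.
have redX k : red pn (Z.pow k 3) = red pn k ^+ 3.
  have -> : Z.pow k 3 = Z.mul k (Z.mul k k) by lia.
  by rewrite !redM !exprS expr0 mulr1.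
(* The cube root of [u] is [u^(2m+1)]: three times this exponent is [p + (p - 1)], and Fermat gives
   [u] back. *)
have [s hs] := red_surj pn (red pn u ^+ (2 * m).+1).
exists s; apply/red_eq0 => //.
have -> : Z.sub (Z.pow s 3) u = Z.add (Z.pow s 3) (Z.mul (-1) u) by lia.
rewrite redD redM redX hs -exprM.
have -> : ((2 * m).+1 * 3 = pn + (pn - 1))%N by lia.
have fer : red pn u ^+ pn = red pn u.
  by have := expf_card (red pn u); rewrite card_Fp.
rewrite exprD fer -exprS -subSn ?subn1 /=; last by lia.
by rewrite fer /red /= mulN1r subrr.
Qed.

End CubicClasses.

(** * The primes 3 and p = 1 mod 3 *)

Lemma governed_by_1mod3 p : prime p -> (p mod 3 = 1)%Z -> governed_by p soluble_types_1mod3.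
Proof.
  intros Hp H1; assert (P2 := prime_ge_2 _ Hp); split; auto.
  assert (Hp3 : p <> 3%Z) by (intros ->; discriminate).
  destruct (CubicClasses.cubic_classes_mod_prime p Hp H1) as [c [U [Hc [Hmod [Heq [Hcurve HU]]]]]].
  exists p, c, U; split; [split; [|split; [|split]]|]; auto.
  - exists O; change (Z.of_nat 1) with 1%Z; now rewrite Z.pow_1_r.
  - intros i Hi; destruct (HU i Hi) as [Hnd [Hlen Hin]]; split; [|split]; auto; nia.
  - intros t0 t1 t2 t3 a0 a1 a2 a3 I0 I1 I2 I3 T0 T1 T2 T3; split.
    + assert (B : forall t, In t types -> (fst t < 3)%nat)
        by (intros [v d] Ht; apply in_prod_iff in Ht; simpl in *; lia).
      apply (soluble_types_necessary_1mod3 p c); auto.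
    + now apply (soluble_types_sufficient_1mod3 p c).
Qed.

Lemma governed_by_3 : governed_by 3 soluble_types_3.
Proof.
  split; [apply prime_3|].
  exists 9%Z, cubic_class_9, (fun c => filter (fun u => Nat.eqb (cubic_class_9 u) c) units_9).
  split; [split; [|split; [|split]]|].
  - now exists 1%nat.
  - intros k l Hd; rewrite <- (cubic_class_9_mod k), <- (cubic_class_9_mod l); f_equal.
    destruct Hd as [q Hq]; replace k with (l + q * 9)%Z by lia; now rewrite Z.mod_add by lia.
  - intros k; unfold cubic_class_9; destruct (k mod 9)%Z as [|q|q]; try lia.
    do 3 (destruct q; try lia).
  - intros c Hc; split; [|split].
    + apply NoDup_filter; unfold units_9; repeat constructor; simpl; lia.
    + destruct c as [|[|[|]]]; try lia; reflexivity.
    + intros u; rewrite filter_In, Nat.eqb_eq; split.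
      * intros [Hu Hcu]; repeat split; auto; try (unfold units_9 in Hu; simpl in Hu; lia).
        intros [q Hq]; unfold units_9 in Hu; simpl in Hu; lia.
      * intros [Hb [Hd Hcu]]; split; auto; apply in_units_9 in Hd.
        now rewrite Z.mod_small in Hd.
  - intros t0 t1 t2 t3 a0 a1 a2 a3 I0 I1 I2 I3 T0 T1 T2 T3; split.
    + now apply soluble_types_necessary_3.
    + assert (B : forall t, In t types -> (fst t < 3)%nat)
        by (intros [v d] Ht; apply in_prod_iff in Ht; simpl in *; lia).
      apply soluble_types_sufficient_3; auto.
Qed.

Definition primes_1mod3 (N : nat) : list Z :=
  filter (fun p => if prime_dec p then Z.eqb (p mod 3) 1 else false) (map Z.of_nat (seq 1 N)).

Definition obstructing_primes (N : nat) : list Z := (3 :: primes_1mod3 N)%Z.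

Lemma in_primes_1mod3 N p :
  In p (primes_1mod3 N) <-> prime p /\ (p mod 3 = 1)%Z /\ (p <= Z.of_nat N)%Z.
Proof.
  unfold primes_1mod3; rewrite filter_In, in_map_iff; split.
  - intros [[n [<- Hn]] H]; apply in_seq in Hn.
    destruct (prime_dec (Z.of_nat n)); [|discriminate].
    apply Z.eqb_eq in H; split; [|split]; auto; lia.
  - intros [Hp [H1 HN]]; assert (P2 := prime_ge_2 _ Hp); split.
    + exists (Z.to_nat p); split; [lia|apply in_seq; lia].
    + destruct (prime_dec p); [now apply Z.eqb_eq|contradiction].
Qed.

Lemma lprod_app {A} (l l' : list A) f : lprod (l ++ l') f = lprod l f * lprod l' f.
Proof. induction l; simpl; [|rewrite IHl]; ring. Qed.

Lemma lprod_ext_in {A} (l : list A) f g : (forall x, In x l -> f x = g x) -> lprod l f = lprod l g.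
Proof. induction l as [|x l IH]; simpl; intros H; auto. rewrite (H x), IH; auto. Qed.

Lemma lprod_primes_partial_prod N :
  lprod (primes_1mod3 N) (fun p => sigma_p (IZR p)) = partial_prod N.
Proof.
  induction N as [|N IH]; [reflexivity|].
  unfold primes_1mod3; rewrite seq_S, map_app, filter_app, lprod_app.
  fold (primes_1mod3 N); rewrite IH; cbn [partial_prod]; f_equal.
  change (1 + N)%nat with (S N); cbn [map filter].
  destruct (prime_dec (Z.of_nat (S N))); [|reflexivity].
  destruct (Z.eq_dec (Z.of_nat (S N) mod 3) 1) as [e|e].
  - rewrite (proj2 (Z.eqb_eq _ _) e), INR_IZR_INZ; apply Rmult_1_r.
  - rewrite (proj2 (Z.eqb_neq _ _) e); reflexivity.
Qed.

Definition type_rule_at (p : Z) : type_rule :=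
  if Z.eqb p 3 then soluble_types_3 else soluble_types_1mod3.

Lemma mean4_obstructing_primes N :
  mean4 (fun a => lprod (obstructing_primes N) (fun p => local_indic p a))
    (sigma_3 * partial_prod N).
Proof.
  assert (N3 : ~ In 3%Z (primes_1mod3 N)).
  { intros H; apply in_primes_1mod3 in H; destruct H as [_ [H _]]; discriminate. }
  assert (H := mean4_local_conditions type_rule_at (obstructing_primes N)).
  assert (one : forall k : Z, 0 <= (fun _ : Z => 1) k <= 1) by (intros; lra).
  refine (_ (H _ _ (fun _ => 1) (fun _ => 1) (fun _ => 1) (fun _ => 1) 1 1 1 1
    one one one one (equidistributed_one _) (equidistributed_one _)
    (equidistributed_one _) (equidistributed_one _))); clear H.
  - replace (1 * 1 * 1 * 1 * lprod (obstructing_primes N) _) with (sigma_3 * partial_prod N).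
    + apply Un_cv_ext; intros n; f_equal; apply lsum_ext.
      intros [[[a0 a1] a2] a3]; ring.
    + unfold obstructing_primes; simpl lprod.
      unfold type_rule_at at 1; rewrite Z.eqb_refl, type_sum_3, <- lprod_primes_partial_prod.
      rewrite (lprod_ext_in _ (fun p => type_sum _ _) (fun p => sigma_p (IZR p))); [ring|].
      intros p Hp; apply in_primes_1mod3 in Hp; destruct Hp as [Hp [H1 _]].
      unfold type_rule_at; destruct (Z.eqb_spec p 3) as [->|_]; [discriminate|].
      apply type_sum_1mod3, (IZR_le 2); apply prime_ge_2 in Hp; lia.
  - constructor; auto.
    apply NoDup_filter, NoDup_map_in; [apply seq_NoDup|intros; lia].
  - intros p [<-|Hp]; [apply governed_by_3|].
    apply in_primes_1mod3 in Hp; destruct Hp as [Hp [H1 _]].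
    unfold type_rule_at; destruct (Z.eqb_spec p 3) as [->|_]; [discriminate|].
    now apply governed_by_1mod3.
Qed.

(** * Comparison with everywhere local solubility *)

Lemma real_soluble_always a : real_soluble a.
Proof.
  destruct a as [[[a0 a1] a2] a3]; unfold real_soluble.
  destruct (Z.eq_dec a0 0) as [->|H0].
  - exists 1, 0, 0, 0; split; [intros [H _]; lra|ring].
  - assert (H0' : IZR a0 <> 0) by now apply not_0_IZR.
    assert (Hpos : forall y, 0 < y -> exists c, c ^ 3 = y).
    { intros y Hy; exists (Rpower y (/ 3)).
      rewrite <- Rpower_pow by apply exp_pos.
      rewrite Rpower_mult; replace (/ 3 * INR 3) with 1 by (simpl; field).
      now apply Rpower_1. }
    assert (Hc : forall y, exists c, c ^ 3 = y).
    { intros y; destruct (Rtotal_order y 0) as [H|[->|H]].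
      - destruct (Hpos (- y)) as [c Hc]; [lra|]; exists (- c).
        replace ((- c) ^ 3) with (- c ^ 3) by ring; lra.
      - exists 0; ring.
      - now apply Hpos. }
    destruct (Hc (- IZR a1 / IZR a0)) as [c E].
    exists c, 1, 0, 0; split; [intros [_ [H _]]; lra|].
    rewrite E; field; auto.
Qed.

Lemma padic_soluble_of_zero_coordinate p a : prime p -> ~ nonzero4 a -> padic_soluble p a.
Proof.
  intros Hp; destruct a as [[[a0 a1] a2] a3]; unfold nonzero4; intros H.
  destruct (Z.eq_dec a0 0) as [->|]; [now apply padic_soluble_zero|].
  destruct (Z.eq_dec a1 0) as [->|].
  { do 3 apply padic_soluble_rot; now apply padic_soluble_zero. }
  destruct (Z.eq_dec a2 0) as [->|].
  { do 2 apply padic_soluble_rot; now apply padic_soluble_zero. }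
  destruct (Z.eq_dec a3 0) as [->|]; [|tauto].
  apply padic_soluble_rot; now apply padic_soluble_zero.
Qed.

(** * The tail over large primes *)

Definition two_divisible (p : Z) (a : Z4) : Prop :=
  let '(a0, a1, a2, a3) := a in
  ((p | a0) /\ (p | a1)) \/ ((p | a0) /\ (p | a2)) \/ ((p | a0) /\ (p | a3)) \/
  ((p | a1) /\ (p | a2)) \/ ((p | a1) /\ (p | a3)) \/ ((p | a2) /\ (p | a3))%Z.

(** If at most one valuation were nonzero modulo 3, three coefficients would share valuation 0,
    which is a soluble pattern. *)
Lemma insoluble_types_1mod3_two_positive t0 t1 t2 t3 :
  In t0 types -> In t1 types -> In t2 types -> In t3 types ->
  soluble_types_1mod3 t0 t1 t2 t3 = false ->
  let pos t := negb (Nat.eqb (fst t) 0) in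
  (pos t0 && pos t1) || ((pos t0 && pos t2) || ((pos t0 && pos t3) ||
  ((pos t1 && pos t2) || ((pos t1 && pos t3) || (pos t2 && pos t3))))) = true.
Proof.
  intros I0 I1 I2 I3 Hf pos.
  assert (H : forallb (fun t0 => forallb (fun t1 => forallb (fun t2 => forallb (fun t3 =>
    soluble_types_1mod3 t0 t1 t2 t3 ||
    ((pos t0 && pos t1) || ((pos t0 && pos t2) || ((pos t0 && pos t3) ||
     ((pos t1 && pos t2) || ((pos t1 && pos t3) || (pos t2 && pos t3)))))))
    types) types) types) types = true) by now vm_compute.
  rewrite forallb_forall in H; specialize (H _ I0).
  rewrite forallb_forall in H; specialize (H _ I1).
  rewrite forallb_forall in H; specialize (H _ I2).
  rewrite forallb_forall in H; specialize (H _ I3).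
  now rewrite Hf, orb_false_l in H.
Qed.

Lemma has_type_divide p cls v c k : has_type p cls v c k -> v <> O -> (p | k)%Z.
Proof.
  intros [e [u [-> _]]] Hv; apply Z.divide_mul_l.
  replace (3 * e + v)%nat with (S (3 * e + v - 1)) by lia.
  rewrite Nat2Z.inj_succ, Z.pow_succ_r by lia; apply Z.divide_factor_l.
Qed.

Lemma insoluble_two_divisible p a : prime p -> (p mod 3 = 1)%Z -> ~ padic_soluble p a ->
  nonzero4 a /\ two_divisible p a.
Proof.
  intros Hp H1 Hs.
  assert (Hnz : nonzero4 a) by (apply NNPP; intros H; now apply Hs, padic_soluble_of_zero_coordinate).
  split; auto; destruct a as [[[a0 a1] a2] a3]; destruct Hnz as [N0 [N1 [N2 N3]]].
  destruct (governed_by_1mod3 p Hp H1) as [_ [M [cls [U [[_ [_ [Hcls _]]] Hphi]]]]].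
  destruct (has_type_exists p cls a0) as [v0 [c0 [V0 [C0 T0]]]]; auto.
  destruct (has_type_exists p cls a1) as [v1 [c1 [V1 [C1 T1]]]]; auto.
  destruct (has_type_exists p cls a2) as [v2 [c2 [V2 [C2 T2]]]]; auto.
  destruct (has_type_exists p cls a3) as [v3 [c3 [V3 [C3 T3]]]]; auto.
  assert (Hf : soluble_types_1mod3 (v0, c0) (v1, c1) (v2, c2) (v3, c3) = false).
  { apply not_true_iff_false; intros Hf; apply Hs.
    now apply (Hphi (v0, c0) (v1, c1) (v2, c2) (v3, c3)); auto using in_types. }
  apply insoluble_types_1mod3_two_positive in Hf; auto using in_types; cbn [fst] in Hf.
  rewrite !orb_true_iff, !andb_true_iff, !negb_true_iff, !Nat.eqb_neq in Hf.
  unfold two_divisible.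
  destruct Hf as [[Hi Hj]|[[Hi Hj]|[[Hi Hj]|[[Hi Hj]|[[Hi Hj]|[Hi Hj]]]]]];
    eauto 12 using has_type_divide.
Qed.

Lemma adelic_soluble_of_obstructing a :
  (forall p, prime p -> p = 3%Z \/ (p mod 3 = 1)%Z -> padic_soluble p a) -> adelic_soluble a.
Proof.
  intros H; split; [apply real_soluble_always|]; intros p Hp; assert (P2 := prime_ge_2 _ Hp).
  destruct (Z.eq_dec p 3) as [->|H3]; [apply H; auto|].
  assert (B := Z.mod_pos_bound p 3 ltac:(lia)).
  assert (Hm : (p mod 3 <> 0)%Z).
  { intros Hm; apply Z.mod_divide in Hm; [|lia].
    apply prime_div_prime in Hm; auto using prime_3. }
  assert (Hm' : (p mod 3 = 1 \/ p mod 3 = 2)%Z) by lia.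
  destruct Hm' as [Hm'|Hm']; [apply H; auto|].
  destruct (classic (nonzero4 a)) as [Hnz|Hnz]; [|now apply padic_soluble_of_zero_coordinate].
  destruct a as [[[a0 a1] a2] a3]; destruct Hnz as [N0 [N1 [N2 N3]]].
  apply padic_soluble_2mod3; auto.
  intros u; now apply CubicClasses.cube_mod_prime.
Qed.

Lemma lprod_local_indic_0_1 ps a :
  (lprod ps (fun p => local_indic p a) = 0 /\ exists p, In p ps /\ ~ (nonzero4 a /\ padic_soluble p a))
  \/ (lprod ps (fun p => local_indic p a) = 1 /\ forall p, In p ps -> nonzero4 a /\ padic_soluble p a).
Proof.
  induction ps as [|p ps IH]; simpl; [right; split; auto; tauto|].
  unfold local_indic at 1 3.
  destruct (ind_cases (nonzero4 a /\ padic_soluble p a)) as [[h ->]|[h ->]].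
  - destruct IH as [[-> [q [Hq Hs]]]|[-> Hall]].
    + left; split; [ring|]; exists q; auto.
    + right; split; [ring|]; intros q [<-|Hq]; auto.
  - left; split; [ring|]; exists p; auto.
Qed.

Definition zero_count (a : Z4) : R :=
  let '(a0, a1, a2, a3) := a in
  indic (a0 = 0%Z) + indic (a1 = 0%Z) + indic (a2 = 0%Z) + indic (a3 = 0%Z).

(** It will be summed over all integers [m > N] and not only over primes; this overcounts
    harmlessly, since the sum of [1/m^2] converges. *)
Definition pair_count (m : Z) (a : Z4) : R :=
  let '(a0, a1, a2, a3) := a in
  let d k := indic (k <> 0 /\ (m | k))%Z in
  d a0 * d a1 + d a0 * d a2 + d a0 * d a3 + d a1 * d a2 + d a1 * d a3 + d a2 * d a3.

Lemma lsum_ge_term {A} (l : list A) f a : (forall x, 0 <= f x) -> In a l -> f a <= lsum l f.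
Proof.
  intros Hf; induction l as [|x l IH]; intros Ha; [easy|]; simpl.
  assert (H := Hf x); assert (H' := lsum_nonneg l f Hf).
  destruct Ha as [->|Ha]; [|specialize (IH Ha)]; lra.
Qed.

Lemma zero_count_nonneg a : 0 <= zero_count a.
Proof.
  destruct a as [[[a0 a1] a2] a3]; unfold zero_count.
  assert (H0 := ind_bounds (a0 = 0%Z)); assert (H1 := ind_bounds (a1 = 0%Z)).
  assert (H2 := ind_bounds (a2 = 0%Z)); assert (H3 := ind_bounds (a3 = 0%Z)); lra.
Qed.

Lemma zero_count_ge_1 a : ~ nonzero4 a -> 1 <= zero_count a.
Proof.
  destruct a as [[[a0 a1] a2] a3]; unfold zero_count, nonzero4; intros H.
  assert (H0 := ind_bounds (a0 = 0%Z)); assert (H1 := ind_bounds (a1 = 0%Z)).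
  assert (H2 := ind_bounds (a2 = 0%Z)); assert (H3 := ind_bounds (a3 = 0%Z)).
  destruct (Z.eq_dec a0 0) as [E|E]; [rewrite (ind_1 (a0 = 0%Z)); auto; lra|].
  destruct (Z.eq_dec a1 0) as [E1|E1]; [rewrite (ind_1 (a1 = 0%Z)); auto; lra|].
  destruct (Z.eq_dec a2 0) as [E2|E2]; [rewrite (ind_1 (a2 = 0%Z)); auto; lra|].
  destruct (Z.eq_dec a3 0) as [E3|E3]; [rewrite (ind_1 (a3 = 0%Z)); auto; lra|tauto].
Qed.

Lemma pair_count_nonneg m a : 0 <= pair_count m a.
Proof.
  destruct a as [[[a0 a1] a2] a3]; unfold pair_count.
  assert (B : forall k, 0 <= indic (k <> 0 /\ (m | k))%Z) by (intros; apply ind_bounds).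
  assert (H0 := B a0); assert (H1 := B a1); assert (H2 := B a2); assert (H3 := B a3).
  repeat apply Rplus_le_le_0_compat; now apply Rmult_le_pos.
Qed.

Lemma pair_count_ge_1 m a : nonzero4 a -> two_divisible m a -> 1 <= pair_count m a.
Proof.
  destruct a as [[[a0 a1] a2] a3]; unfold pair_count, nonzero4, two_divisible.
  intros [N0 [N1 [N2 N3]]] H.
  assert (B : forall k, 0 <= indic (k <> 0 /\ (m | k))%Z <= 1) by (intros; apply ind_bounds).
  assert (B0 := B a0); assert (B1 := B a1); assert (B2 := B a2); assert (B3 := B a3).
  destruct H as [[Hi Hj]|[[Hi Hj]|[[Hi Hj]|[[Hi Hj]|[[Hi Hj]|[Hi Hj]]]]]];
    match type of Hi with (_ | ?x)%Z => rewrite (ind_1 (x <> 0 /\ (m | x))%Z) in * by auto end;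
    match type of Hj with (_ | ?x)%Z => rewrite (ind_1 (x <> 0 /\ (m | x))%Z) in * by auto end;
    nra.
Qed.

Lemma two_divisible_le m a n : (0 < m)%Z -> nonzero4 a -> two_divisible m a -> In a (box n) ->
  (m <= Z.of_nat n)%Z.
Proof.
  destruct a as [[[a0 a1] a2] a3]; unfold nonzero4, two_divisible.
  intros Hm [N0 [N1 [N2 N3]]] H Hb; apply in_box in Hb; unfold height in Hb.
  assert (L : forall x, (x <> 0 -> (m | x) -> m <= Z.abs x)%Z).
  { intros x Hx Hd; apply Z.divide_pos_le; [lia|]; now apply Z.divide_abs_r. }
  destruct H as [[Hi _]|[[Hi _]|[[Hi _]|[[Hi _]|[[Hi _]|[Hi _]]]]]];
    apply L in Hi; auto; lia.
Qed.

(** The two indicators differ only if a coordinate is zero or some prime [p > N] obstructs. In the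
    latter case [p] divides two nonzero coordinates, so [p <= n] and the finite range of [m]
    suffices. *)
Lemma adelic_indic_approx N n a : In a (box n) ->
  Rabs (indic (adelic_soluble a) - lprod (obstructing_primes N) (fun p => local_indic p a))
  <= zero_count a + lsum (seq (N + 1) (n - N)) (fun m => pair_count (Z.of_nat m) a).
Proof.
  intros Ha.
  assert (Hz := zero_count_nonneg a).
  assert (Hs : 0 <= lsum (seq (N + 1) (n - N)) (fun m => pair_count (Z.of_nat m) a))
    by (apply lsum_nonneg; intros; apply pair_count_nonneg).
  destruct (classic (nonzero4 a)) as [Hnz|Hnz].
  2: { apply zero_count_ge_1 in Hnz; assert (I := ind_bounds (adelic_soluble a)).
       apply Rabs_le; destruct (lprod_local_indic_0_1 (obstructing_primes N) a)
         as [[-> _]|[-> _]]; lra. }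
  destruct (ind_cases (adelic_soluble a)) as [[h ->]|[h ->]];
    destruct (lprod_local_indic_0_1 (obstructing_primes N) a) as [[-> [p [Hp Hn]]]|[-> Hall]].
  - exfalso; apply Hn; split; auto; apply h.
    destruct Hp as [<-|Hp]; [apply prime_3|]; now apply in_primes_1mod3 in Hp.
  - rewrite Rminus_diag, Rabs_R0; lra.
  - rewrite Rminus_diag, Rabs_R0; lra.
  - assert (Hex : exists p, prime p /\ (p = 3%Z \/ (p mod 3 = 1)%Z) /\ ~ padic_soluble p a).
    { apply NNPP; intros Hno; apply h, adelic_soluble_of_obstructing; intros p Hp H3.
      apply NNPP; intros Hsol; apply Hno; exists p; auto. }
    destruct Hex as [p [Hp [H3 Hsol]]]; assert (P2 := prime_ge_2 _ Hp).
    assert (Hnin : ~ In p (obstructing_primes N)) by (intros Hin; now apply Hsol, Hall).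
    destruct H3 as [->|H1]; [exfalso; apply Hnin; now left|].
    destruct (insoluble_two_divisible p a Hp H1 Hsol) as [_ H2].
    assert (Hpn := two_divisible_le p a n ltac:(lia) Hnz H2 Ha).
    assert (HpN : (Z.of_nat N < p)%Z).
    { apply Z.nle_gt; intros Hle; apply Hnin; right; apply in_primes_1mod3; auto. }
    assert (H := lsum_ge_term (seq (N + 1) (n - N)) (fun m => pair_count (Z.of_nat m) a)
      (Z.to_nat p) ltac:(intros; apply pair_count_nonneg) ltac:(apply in_seq; lia)).
    cbv beta in H; rewrite Z2Nat.id in H by lia.
    apply pair_count_ge_1 in H2; auto.
    rewrite Rminus_0_l, Rabs_Ropp, Rabs_R1; lra.
Qed.

Lemma lsum_zero_count n : lsum (box n) zero_count = 4 * vol n ^ 3.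
Proof.
  set (e := fun k => indic (k = 0%Z)); set (u := fun _ : Z => 1).
  rewrite (lsum_ext _ _ (fun a =>
    (fun '(a0, a1, a2, a3) => e a0 * u a1 * u a2 * u a3) a +
    (fun '(a0, a1, a2, a3) => u a0 * e a1 * u a2 * u a3) a +
    (fun '(a0, a1, a2, a3) => u a0 * u a1 * e a2 * u a3) a +
    (fun '(a0, a1, a2, a3) => u a0 * u a1 * u a2 * e a3) a)).
  2: { intros [[[a0 a1] a2] a3]; unfold zero_count, e, u; ring. }
  rewrite !lsum_plus, !lsum_box_mult.
  assert (E : lsum (Zrange n) e = 1).
  { apply lsum_ind_unique with 0%Z; auto using NoDup_Zrange; apply in_Zrange; lia. }
  assert (V : lsum (Zrange n) u = vol n) by (unfold u; rewrite lsum_Zrange_const; ring).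
  rewrite E, V; ring.
Qed.

Lemma lsum_pair_count n m : (1 <= m)%nat ->
  lsum (box n) (pair_count (Z.of_nat m)) <= 6 * vol n ^ 4 / INR m ^ 2.
Proof.
  intros Hm; set (d := fun k => indic (k <> 0 /\ (Z.of_nat m | k))%Z); set (u := fun _ : Z => 1).
  rewrite (lsum_ext _ _ (fun a =>
    (fun '(a0, a1, a2, a3) => d a0 * d a1 * u a2 * u a3) a +
    (fun '(a0, a1, a2, a3) => d a0 * u a1 * d a2 * u a3) a +
    (fun '(a0, a1, a2, a3) => d a0 * u a1 * u a2 * d a3) a +
    (fun '(a0, a1, a2, a3) => u a0 * d a1 * d a2 * u a3) a +
    (fun '(a0, a1, a2, a3) => u a0 * d a1 * u a2 * d a3) a +
    (fun '(a0, a1, a2, a3) => u a0 * u a1 * d a2 * d a3) a)).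
  2: { intros [[[a0 a1] a2] a3]; unfold pair_count; cbv zeta; unfold d, u; ring. }
  rewrite !lsum_plus, !lsum_box_mult.
  assert (V : lsum (Zrange n) u = vol n) by (unfold u; rewrite lsum_Zrange_const; ring).
  rewrite V.
  assert (Hm' : 1 <= INR m) by now apply (le_INR 1).
  assert (D : lsum (Zrange n) d <= vol n / INR m).
  { eapply Rle_trans; [apply count_nonzero_multiples; lia|].
    rewrite <- INR_IZR_INZ, vol_eq.
    apply Rmult_le_compat_r; [apply Rlt_le, Rinv_0_lt_compat; lra|lra]. }
  assert (D0 : 0 <= lsum (Zrange n) d) by (apply lsum_nonneg; intros; apply ind_bounds).
  assert (V1 := vol_pos n); set (x := lsum (Zrange n) d) in *.
  assert (X : x * x <= (vol n / INR m) * (vol n / INR m)) by (apply Rmult_le_compat; lra).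
  replace (6 * vol n ^ 4 / INR m ^ 2) with
    (6 * vol n ^ 2 * ((vol n / INR m) * (vol n / INR m))) by (field; lra).
  replace (_ + _) with (6 * vol n ^ 2 * (x * x)) by ring.
  apply Rmult_le_compat_l; auto; nra.
Qed.

(** Compares [1/m^2] with the telescoping difference [1/(m-1) - 1/m]. *)
Lemma inv_square_tail N k : (1 <= N)%nat ->
  lsum (seq (N + 1) k) (fun m => / INR m ^ 2) <= / INR N - / INR (N + k).
Proof.
  intros HN; induction k as [|k IH].
  - rewrite Nat.add_0_r; simpl; lra.
  - rewrite seq_S, lsum_app; unfold lsum at 2; cbn [fold_right].
    replace (N + 1 + k)%nat with (S (N + k)) by lia.
    replace (N + S k)%nat with (S (N + k)) by lia.
    assert (Hp : 1 <= INR (N + k)) by (apply (le_INR 1); lia).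
    rewrite S_INR; set (x := INR (N + k)) in *.
    assert (/ (x + 1) ^ 2 <= / x - / (x + 1)); [|lra].
    replace (/ x - / (x + 1)) with (/ (x * (x + 1))) by (field; lra).
    apply Rinv_le_contravar; nra.
Qed.

(** The 4 counts coordinate hyperplanes and the 6 counts pairs of coordinates. The bound holds for
    every [n], so [N] can be fixed before [n] grows. *)
Lemma adelic_count_approx N n : (1 <= N)%nat ->
  Rabs (lsum (box n) (fun a => indic (adelic_soluble a)) / vol n ^ 4 -
    lsum (box n) (fun a => lprod (obstructing_primes N) (fun p => local_indic p a)) / vol n ^ 4)
  <= 4 * / vol n + 6 * / INR N.
Proof.
  intros HN; assert (V := vol_pos n); assert (V4 := vol4_pos n).
  assert (HN' : 1 <= INR N) by now apply (le_INR 1).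
  unfold Rdiv; rewrite <- Rmult_minus_distr_r, <- lsum_minus.
  rewrite Rabs_mult, (Rabs_right (/ vol n ^ 4))
    by (apply Rle_ge, Rlt_le, Rinv_0_lt_compat; auto).
  apply Rmult_le_reg_r with (vol n ^ 4); auto.
  rewrite Rmult_assoc, Rinv_l, Rmult_1_r by lra.
  eapply Rle_trans; [apply lsum_abs|].
  eapply Rle_trans; [apply lsum_le_in; intros a Ha; now apply (adelic_indic_approx N n)|].
  rewrite lsum_plus, lsum_zero_count, lsum_swap.
  replace ((4 * / vol n + 6 * / INR N) * vol n ^ 4) with
    (4 * vol n ^ 3 + 6 * vol n ^ 4 * / INR N) by (field; lra).
  apply Rplus_le_compat_l.
  apply Rle_trans with (lsum (seq (N + 1) (n - N)) (fun m => 6 * vol n ^ 4 * / INR m ^ 2)).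
  - apply lsum_le_in; intros m Hm; apply in_seq in Hm; apply lsum_pair_count; lia.
  - rewrite lsum_scal; apply Rmult_le_compat_l; [lra|].
    assert (H := inv_square_tail N (n - N) HN).
    assert (0 < / INR (N + (n - N))); [|lra].
    apply Rinv_0_lt_compat, lt_0_INR; lia.
Qed.

(** All factors lie in [[0, 1]], so the partial products decrease and stay nonnegative. *)
Lemma partial_prod_cv : exists L, Un_cv partial_prod L.
Proof.
  assert (B : forall n, 0 <= partial_prod n /\ partial_prod (S n) <= partial_prod n).
  { assert (F : forall n, 0 <= (if prime_dec (Z.of_nat (S n)) then
          if Z.eq_dec (Z.of_nat (S n) mod 3) 1 then sigma_p (INR (S n)) else 1 else 1) <= 1).
    { intros n; destruct (prime_dec _) as [Hp|]; [|lra]; destruct (Z.eq_dec _ _); [|lra].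
      apply sigma_p_bounds, (le_INR 2); apply prime_ge_2 in Hp; lia. }
    induction n as [|n [IH _]]; (split; [|cbn [partial_prod]]).
    - simpl; lra.
    - assert (H := F O); lra.
    - cbn [partial_prod]; apply Rmult_le_pos; auto; apply F.
    - assert (H0 := F n); assert (H := F (S n)); assert (0 <= partial_prod (S n))
        by (cbn [partial_prod]; apply Rmult_le_pos; auto; apply F).
      cbn [partial_prod] in *; nra. }
  destruct (decreasing_cv partial_prod) as [L HL]; [intros n; apply B| |now exists L].
  exists 0; intros x [n ->]; unfold opp_seq; assert (H := B n); lra.
Qed.

Lemma adelic_density L : Un_cv partial_prod L ->
  mean4 (fun a => indic (adelic_soluble a)) (sigma_3 * L).
Proof.
  intros HL eps Heps.
  assert (HL' := CV_mult _ _ _ _ (Un_cv_const sigma_3) HL).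
  destruct (HL' (eps / 4)) as [N1 H1]; [lra|].
  (* With the factors 6 and 4 of [adelic_count_approx], the choices [eps / 24] and, below,
     [eps / 16] each contribute a quarter of [eps]. *)
  destruct (archimed_cor1 (eps / 24)) as [N2 [H2 H2']]; [lra|].
  set (N := max N1 N2).
  specialize (H1 N ltac:(lia)).
  destruct (mean4_obstructing_primes N (eps / 4)) as [N3 H3]; [lra|].
  destruct (inv_vol_cv (eps / 16)) as [N4 H4]; [lra|].
  exists (max N3 N4); intros n Hn.
  specialize (H3 n ltac:(lia)); specialize (H4 n ltac:(lia)).
  assert (H := adelic_count_approx N n ltac:(lia)).
  assert (HN : / INR N <= / INR N2)
    by (apply Rinv_le_contravar; [now apply lt_0_INR|apply le_INR; lia]).
  unfold Rdist in *; rewrite Rminus_0_r in H4.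
  apply Rabs_def2 in H1, H3, H4.
  set (d := lsum _ _ / vol n ^ 4 - lsum _ _ / vol n ^ 4) in H.
  assert (Hd := Rle_abs d); assert (Hd' := Rle_abs (- d)); rewrite Rabs_Ropp in Hd'.
  unfold d in *; apply Rabs_def1; lra.
Qed.

(** * Passing to primitive points *)

Definition gcd4 (a : Z4) : Z :=
  let '(a0, a1, a2, a3) := a in Z.gcd (Z.gcd (Z.gcd a0 a1) a2) a3.

Definition positive4 (a : Z4) : Prop :=
  let '(a0, a1, a2, a3) := a in
  (0 < a0)%Z \/ (a0 = 0 /\ 0 < a1)%Z \/ (a0 = 0 /\ a1 = 0 /\ 0 < a2)%Z
   \/ (a0 = 0 /\ a1 = 0 /\ a2 = 0 /\ 0 < a3)%Z.

Definition scale4 (c : Z) (a : Z4) : Z4 :=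
  let '(a0, a1, a2, a3) := a in (c * a0, c * a1, c * a2, c * a3)%Z.

Definition homogeneous (Q : Z4 -> Prop) : Prop :=
  forall c a, c <> 0%Z -> (Q (scale4 c a) <-> Q a).

Definition affine_count (Q : Z4 -> Prop) (n : nat) : R :=
  lsum (box n) (fun a => indic (positive4 a /\ Q a)).

Definition primitive_count (Q : Z4 -> Prop) (n : nat) : R :=
  lsum (box n) (fun a => indic (P3Q_point a /\ Q a)).

Lemma P3Q_point_iff a : P3Q_point a <-> gcd4 a = 1%Z /\ positive4 a.
Proof. now destruct a as [[[a0 a1] a2] a3]. Qed.

Lemma gcd4_scale c a : (0 < c)%Z -> gcd4 (scale4 c a) = (c * gcd4 a)%Z.
Proof.
  intros Hc; destruct a as [[[a0 a1] a2] a3]; unfold gcd4, scale4.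
  now rewrite !Z.gcd_mul_mono_l_nonneg by lia.
Qed.

Lemma positive4_scale c a : (0 < c)%Z -> (positive4 (scale4 c a) <-> positive4 a).
Proof. intros Hc; destruct a as [[[a0 a1] a2] a3]; unfold positive4, scale4; nia. Qed.

Lemma gcd4_factor a : exists b, a = scale4 (gcd4 a) b.
Proof.
  destruct a as [[[a0 a1] a2] a3]; unfold gcd4.
  set (g1 := Z.gcd a0 a1); set (g2 := Z.gcd g1 a2); set (g := Z.gcd g2 a3).
  assert (D3 : (g | a3)%Z) by apply Z.gcd_divide_r.
  assert (D2' : (g | g2)%Z) by apply Z.gcd_divide_l.
  assert (D2 : (g | a2)%Z) by (apply Z.divide_trans with g2; auto; apply Z.gcd_divide_r).
  assert (D1' : (g | g1)%Z) by (apply Z.divide_trans with g2; auto; apply Z.gcd_divide_l).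
  assert (D1 : (g | a1)%Z) by (apply Z.divide_trans with g1; auto; apply Z.gcd_divide_r).
  assert (D0 : (g | a0)%Z) by (apply Z.divide_trans with g1; auto; apply Z.gcd_divide_l).
  destruct D0 as [b0 E0], D1 as [b1 E1], D2 as [b2 E2], D3 as [b3 E3].
  exists (b0, b1, b2, b3); unfold scale4; now rewrite E0, E1, E2, E3, !(Z.mul_comm g).
Qed.

Lemma height_scale c a : (0 <= c)%Z -> height (scale4 c a) = (c * height a)%Z.
Proof.
  intros Hc; destruct a as [[[a0 a1] a2] a3]; unfold height, scale4.
  rewrite !Z.abs_mul, (Z.abs_eq c) by auto.
  now rewrite !Z.mul_max_distr_nonneg_l by auto.
Qed.

Lemma height_opp a : height (scale4 (-1) a) = height a.
Proof.
  destruct a as [[[a0 a1] a2] a3]; unfold height, scale4.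
  now rewrite !Z.abs_mul, !Z.mul_1_l.
Qed.

Lemma gcd4_bounds a : positive4 a -> (0 < gcd4 a <= height a)%Z.
Proof.
  intros Hp; destruct (gcd4_factor a) as [b E].
  assert (G0 : (0 <= gcd4 a)%Z)
    by (destruct a as [[[a0 a1] a2] a3]; unfold gcd4; apply Z.gcd_nonneg).
  assert (G : (0 < gcd4 a)%Z).
  { destruct (Z.eq_dec (gcd4 a) 0) as [H|H]; [exfalso|lia].
    rewrite E, H in Hp; destruct b as [[[b0 b1] b2] b3]; unfold positive4, scale4 in Hp; lia. }
  split; auto.
  rewrite E in Hp; apply positive4_scale in Hp; auto.
  rewrite E at 2; rewrite height_scale by lia.
  assert (1 <= height b)%Z; [|nia].
  destruct b as [[[b0 b1] b2] b3]; unfold positive4, height in *; lia.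
Qed.

Lemma scale4_inj c a b : c <> 0%Z -> scale4 c a = scale4 c b -> a = b.
Proof.
  intros Hc; destruct a as [[[a0 a1] a2] a3], b as [[[b0 b1] b2] b3]; unfold scale4; intros E.
  injection E as E0 E1 E2 E3.
  apply Z.mul_reg_l in E0, E1, E2, E3; auto; congruence.
Qed.

(** A positive vector is uniquely its gcd [d] times a primitive one, of height at most [n / d];
    homogeneity carries [Q] across the scaling. *)
Lemma affine_count_by_gcd Q n : homogeneous Q ->
  affine_count Q n = lsum (seq 1 n) (fun d => primitive_count Q (n / d)).
Proof.
  intros HQ; unfold affine_count.
  rewrite (lsum_ext_in (box n) _ (fun a => lsum (seq 1 n) (fun d =>
    indic (gcd4 a = Z.of_nat d /\ positive4 a /\ Q a)))).
  - rewrite lsum_swap; apply lsum_ext_in; intros d Hd; apply in_seq in Hd.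
    symmetry; apply lsum_ind_bij with (h := scale4 (Z.of_nat d)); try apply NoDup_box.
    + intros x y _ _ _ _ E; apply scale4_inj in E; auto; lia.
    + intros x Hx [HP Hq]; apply P3Q_point_iff in HP; destruct HP as [G P].
      apply in_box in Hx; split.
      * apply in_box; rewrite height_scale by lia.
        assert (D := Nat.mul_div_le n d ltac:(lia)); nia.
      * rewrite gcd4_scale, positive4_scale, G by lia; split; [lia|]; split; auto.
        apply HQ; auto; lia.
    + intros y Hy [G [P Hq]]; destruct (gcd4_factor y) as [b E]; exists b.
      rewrite G in E; apply in_box in Hy; rewrite E in Hy, P, Hq, G.
      rewrite height_scale in Hy by lia; rewrite gcd4_scale in G by lia.
      apply positive4_scale in P; [|lia]; apply HQ in Hq; [|lia]; split; [|split; auto; split; auto].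
      * apply in_box; rewrite Nat2Z.inj_div; apply Z.div_le_lower_bound; lia.
      * apply P3Q_point_iff; split; auto; nia.
  - intros a Ha; apply in_box in Ha.
    destruct (ind_cases (positive4 a /\ Q a)) as [[[P Hq] ->]|[h ->]].
    + symmetry; assert (G := gcd4_bounds a P).
      apply lsum_ind_unique with (Z.to_nat (gcd4 a)); auto using seq_NoDup.
      * apply in_seq; lia.
      * split; auto; lia.
      * intros x _ [E _]; lia.
    + rewrite (lsum_ext _ _ (fun _ => 0)), lsum_0; auto.
      intros d; apply ind_0; tauto.
Qed.

(** Sign change pairs the nonzero vectors, one of each pair being positive; the zero vector is the
    extra 1. *)
Lemma affine_count_half Q n : homogeneous Q -> Q (0, 0, 0, 0)%Z ->
  lsum (box n) (fun a => indic (Q a)) = 2 * affine_count Q n + 1.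
Proof.
  intros HQ H0.
  assert (Hneg : affine_count Q n = lsum (box n) (fun a => indic (positive4 (scale4 (-1) a) /\ Q a))).
  { apply lsum_ind_bij with (h := scale4 (-1)); try apply NoDup_box.
    - intros x y _ _ _ _ E; apply scale4_inj in E; auto; lia.
    - intros x Hx [P Hq]; split; [|split].
      + apply in_box; rewrite height_opp; now apply in_box.
      + destruct x as [[[x0 x1] x2] x3]; unfold positive4, scale4 in *; lia.
      + apply HQ; auto; lia.
    - intros x Hx [P Hq]; exists (scale4 (-1) x); split; [|split; [split; auto|]].
      + apply in_box; rewrite height_opp; now apply in_box.
      + apply HQ; auto; lia.
      + destruct x as [[[x0 x1] x2] x3]; unfold scale4.
        f_equal; [f_equal; [f_equal|]|]; ring. }
  assert (Hz : lsum (box n) (fun a => indic (a = (0, 0, 0, 0)%Z)) = 1).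
  { apply lsum_ind_unique with (0, 0, 0, 0)%Z; auto using NoDup_box.
    apply in_box; unfold height; simpl; lia. }
  replace (2 * affine_count Q n + 1) with (affine_count Q n + affine_count Q n + 1) by ring.
  rewrite Hneg at 2; rewrite <- Hz; unfold affine_count; rewrite <- !lsum_plus.
  apply lsum_ext; intros a; destruct (ind_cases (Q a)) as [[h ->]|[h ->]].
  - assert (T : (positive4 a /\ ~ positive4 (scale4 (-1) a) /\ a <> (0, 0, 0, 0)%Z) \/
      (~ positive4 a /\ positive4 (scale4 (-1) a) /\ a <> (0, 0, 0, 0)%Z) \/
      (~ positive4 a /\ ~ positive4 (scale4 (-1) a) /\ a = (0, 0, 0, 0)%Z)).
    { destruct (classic (a = (0, 0, 0, 0)%Z)) as [->|Hne].
      - right; right; unfold positive4, scale4; repeat split; lia.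
      - assert (C : forall x : Z, (x < 0 \/ x = 0 \/ 0 < x)%Z) by (intros; lia).
        destruct a as [[[a0 a1] a2] a3]; unfold positive4, scale4 in *.
        assert (N : ~ (a0 = 0 /\ a1 = 0 /\ a2 = 0 /\ a3 = 0)%Z)
          by (intros [-> [-> [-> ->]]]; now apply Hne).
        destruct (C a0) as [?|[?|?]]; [right; left; repeat split; auto; lia| |left; repeat split; auto; lia].
        destruct (C a1) as [?|[?|?]]; [right; left; repeat split; auto; lia| |left; repeat split; auto; lia].
        destruct (C a2) as [?|[?|?]]; [right; left; repeat split; auto; lia| |left; repeat split; auto; lia].
        destruct (C a3) as [?|[?|?]]; [right; left; repeat split; auto; lia|lia|left; repeat split; auto; lia]. }
    rewrite (ind_ext (positive4 a /\ Q a) (positive4 a)) by tauto.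
    rewrite (ind_ext (positive4 (scale4 (-1) a) /\ Q a) (positive4 (scale4 (-1) a))) by tauto.
    destruct T as [[T1 [T2 T3]]|[[T1 [T2 T3]]|[T1 [T2 T3]]]].
    + rewrite (ind_1 _ T1), (ind_0 _ T2), (ind_0 _ T3); ring.
    + rewrite (ind_0 _ T1), (ind_1 _ T2), (ind_0 _ T3); ring.
    + rewrite (ind_0 _ T1), (ind_0 _ T2), (ind_1 _ T3); ring.
  - rewrite !ind_0; try tauto; [ring|intros ->; tauto].
Qed.

(** The term [1/4] plus the tail bound [1/2]. As [3/4 < 1], the inversion of the divisor sum
    contracts, with constant [4 = 1 / (1 - 3/4)]. *)
Lemma inv_square_sum k : lsum (seq 2 k) (fun d => / INR d ^ 2) <= 3 / 4.
Proof.
  destruct k as [|k]; [simpl; lra|].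
  cbn [seq lsum fold_right].
  assert (H := inv_square_tail 2 k ltac:(lia)).
  change (lsum (seq 3 k) (fun d => / INR d ^ 2)) with (lsum (seq (2 + 1) k) (fun d => / INR d ^ 2)).
  fold (@lsum nat (seq 3 k) (fun d => / INR d ^ 2)).
  change (seq (2 + 1) k) with (seq 3 k) in H.
  assert (0 < / INR (2 + k)) by (apply Rinv_0_lt_compat, lt_0_INR; lia).
  simpl INR in *; lra.
Qed.

(* Replaces Moebius inversion: it works since the sum of 1/d^2 over d >= 2 is less than 1. *)
Lemma divisor_sum_inversion_bound (D E w : nat -> R) :
  (forall n, (1 <= n)%nat -> E n = lsum (seq 1 n) (fun d => D (n / d)%nat)) ->
  (forall n, (1 <= n)%nat -> Rabs (E n) <= w n) ->
  (forall n d, (1 <= d <= n)%nat -> w (n / d)%nat <= w n / INR d ^ 2) ->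
  forall n, (1 <= n)%nat -> Rabs (D n) <= 4 * w n.
Proof.
  intros HE Hw Hdiv n; induction n as [n IH] using lt_wf_ind; intros Hn.
  assert (Wn : 0 <= w n) by (eapply Rle_trans; [apply Rabs_pos|now apply Hw]).
  assert (E1 : E n = D n + lsum (seq 2 (n - 1)) (fun d => D (n / d)%nat)).
  { rewrite HE by auto; destruct n as [|n]; [lia|].
    simpl seq; rewrite Nat.sub_0_r; cbn [lsum fold_right]; now rewrite Nat.div_1_r. }
  assert (B : Rabs (lsum (seq 2 (n - 1)) (fun d => D (n / d)%nat)) <= 3 * w n).
  { eapply Rle_trans; [apply lsum_abs|].
    apply Rle_trans with (lsum (seq 2 (n - 1)) (fun d => 4 * w n * / INR d ^ 2)).
    - apply lsum_le_in; intros d Hd; apply in_seq in Hd.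
      eapply Rle_trans; [apply IH|].
      + apply Nat.div_lt; lia.
      + apply Nat.div_le_lower_bound; lia.
      + rewrite Rmult_assoc; apply Rmult_le_compat_l; [lra|]; apply Hdiv; lia.
    - rewrite lsum_scal; assert (H := inv_square_sum (n - 1)); nra. }
  replace (D n) with (E n - lsum (seq 2 (n - 1)) (fun d => D (n / d)%nat)) by lra.
  specialize (Hw n Hn).
  eapply Rle_trans; [apply Rabs_triang|]; rewrite Rabs_Ropp; lra.
Qed.

Lemma INR_div_le n d : (1 <= d)%nat -> INR (n / d) <= INR n / INR d.
Proof.
  intros Hd; assert (Hd' : 1 <= INR d) by now apply (le_INR 1).
  apply Rmult_le_reg_r with (INR d); [lra|].
  replace (INR n / INR d * INR d) with (INR n) by (field; lra).
  rewrite <- mult_INR; apply le_INR; rewrite Nat.mul_comm; apply Nat.mul_div_le; lia.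
Qed.

Lemma pow_div_le n d k : (1 <= d)%nat -> INR (n / d) ^ (2 + k) <= INR n ^ (2 + k) / INR d ^ 2.
Proof.
  intros Hd; assert (Hd' : 1 <= INR d) by now apply (le_INR 1).
  assert (H := INR_div_le n d Hd); assert (P := pos_INR (n / d)); assert (P' := pos_INR n).
  assert (H' : INR (n / d) <= INR n).
  { eapply Rle_trans; [exact H|]; apply Rmult_le_reg_r with (INR d); [lra|].
    replace (INR n / INR d * INR d) with (INR n) by (field; lra); nra. }
  rewrite !pow_add.
  replace (INR n ^ 2 * INR n ^ k / INR d ^ 2) with ((INR n / INR d) ^ 2 * INR n ^ k) by (field; lra).
  apply Rmult_le_compat; try (apply pow_le; auto); apply pow_incr; lra.
Qed.

Lemma homogeneous_True : homogeneous (fun _ => True).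
Proof. now intros c a. Qed.

Lemma affine_count_True n : affine_count (fun _ => True) n = (vol n ^ 4 - 1) / 2.
Proof.
  assert (H := affine_count_half (fun _ => True) n homogeneous_True I).
  rewrite (@lsum_ext Z4 _ _ (fun '(a0, a1, a2, a3) => 1 * 1 * 1 * 1)) in H.
  - rewrite (lsum_box_mult n (fun _ => 1) (fun _ => 1) (fun _ => 1) (fun _ => 1)) in H.
    rewrite lsum_Zrange_const in H; lra.
  - intros [[[a0 a1] a2] a3]; rewrite ind_1 by auto; ring.
Qed.

(** The positive vectors number at least [8 n^4], and those with gcd at least 2 at most [15/2 n^4],
    the product of 10 and [inv_square_sum]. *)
Lemma primitive_count_lower n : (1 <= n)%nat ->
  INR n ^ 4 / 2 <= primitive_count (fun _ => True) n.
Proof.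
  intros Hn; assert (Hn' : 1 <= INR n) by now apply (le_INR 1).
  assert (E := affine_count_by_gcd _ n homogeneous_True).
  assert (E1 : affine_count (fun _ => True) n = primitive_count (fun _ => True) n +
    lsum (seq 2 (n - 1)) (fun d => primitive_count (fun _ => True) (n / d))).
  { rewrite E; destruct n as [|n]; [lia|].
    simpl seq; rewrite Nat.sub_0_r; cbn [lsum fold_right]; now rewrite Nat.div_1_r. }
  assert (B : lsum (seq 2 (n - 1)) (fun d => primitive_count (fun _ => True) (n / d))
              <= 15 / 2 * INR n ^ 4).
  { apply Rle_trans with (lsum (seq 2 (n - 1)) (fun d => 10 * INR n ^ 4 * / INR d ^ 2)).
    - apply lsum_le_in; intros d Hd; apply in_seq in Hd.
      assert (Hq : 1 <= INR (n / d))
        by (apply (le_INR 1), Nat.div_le_lower_bound; lia).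
      apply Rle_trans with (affine_count (fun _ => True) (n / d)).
      { apply lsum_le; intros a; apply ind_le; rewrite P3Q_point_iff; tauto. }
      rewrite affine_count_True, vol_eq.
      assert (Hd' : 2 <= INR d) by (apply (le_INR 2); lia).
      assert (H := INR_div_le n d ltac:(lia)).
      set (q := INR (n / d)) in *; set (x := INR n / INR d) in *.
      (* 40 is the number of positive vectors in the box of radius 1. Below, [d >= 2] trades
         [40 / d^4] for [10 / d^2]. *)
      apply Rle_trans with (40 * q ^ 4).
      + assert (Q : (2 * q + 1) ^ 4 <= (3 * q) ^ 4) by (apply pow_incr; lra).
        assert (1 <= q ^ 4) by (apply pow_R1_Rle; lra); nra.
      + apply Rle_trans with (40 * x ^ 4).
        * apply Rmult_le_compat_l; [lra|]; apply pow_incr; lra.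
        * replace (10 * INR n ^ 4 * / INR d ^ 2) with (40 * x ^ 4 * (INR d ^ 2 / 4))
            by (unfold x; field; lra).
          assert (0 <= x ^ 4) by (apply pow_le; lra).
          assert (1 <= INR d ^ 2 / 4) by nra; nra.
    - rewrite lsum_scal; assert (H := inv_square_sum (n - 1)).
      assert (0 <= INR n ^ 4) by (apply pow_le; lra); nra. }
  rewrite affine_count_True, vol_eq in E1.
  assert (Q : (2 * INR n) ^ 4 + 1 <= (2 * INR n + 1) ^ 4).
  { set (x := INR n) in *.
    replace ((2 * x + 1) ^ 4) with ((2 * x) ^ 4 + 4 * (2 * x) ^ 3 + 6 * (2 * x) ^ 2 + 4 * (2 * x) + 1)
      by ring.
    assert (0 <= (2 * x) ^ 3) by (apply pow_le; lra).
    assert (0 <= (2 * x) ^ 2) by (apply pow_le; lra); lra. }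
  replace ((2 * INR n) ^ 4) with (16 * INR n ^ 4) in Q by ring; lra.
Qed.

(** Cancelling [c = p^e u] costs [e] digits of precision in the equation; reading the same
    coordinates [e] indices later restores them. *)
Lemma padic_soluble_scale p c a : prime p -> c <> 0%Z ->
  (padic_soluble p (scale4 c a) <-> padic_soluble p a).
Proof.
  intros Hp Hc; assert (P2 := prime_ge_2 _ Hp); destruct a as [[[a0 a1] a2] a3].
  assert (Hd : forall x, diag_cubic (scale4 c (a0, a1, a2, a3)) x = (c * diag_cubic (a0, a1, a2, a3) x)%Z)
    by (intros [[[x0 x1] x2] x3]; unfold diag_cubic, scale4; ring).
  split; intros [x0 [x1 [x2 [x3 [I0 [I1 [I2 [I3 [Hn He]]]]]]]]].
  - destruct (unit_part_exists p c Hp Hc) as [e [u [E Hu]]].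
    assert (Hshift : forall x, padic_int p x -> padic_int p (fun k => x (k + e)%nat)).
    { intros x Hx k; apply Z.divide_trans with (p ^ Z.of_nat (k + e))%Z; [apply pow_divide; lia|].
      apply (Hx (k + e)%nat). }
    assert (H1 : forall x, padic_int p x -> (p | x (1 + e)%nat)%Z -> (p | x 1%nat)%Z).
    { intros x Hx H; replace (x 1%nat) with (x (1 + e)%nat - (x (1 + e)%nat - x 1%nat))%Z by ring.
      apply Z.divide_sub_r; auto.
      rewrite <- (Z.pow_1_r p) at 1; apply (padic_int_cong p x 1); auto; lia. }
    exists (fun k => x0 (k + e)%nat), (fun k => x1 (k + e)%nat),
      (fun k => x2 (k + e)%nat), (fun k => x3 (k + e)%nat).
    do 4 (split; [now apply Hshift|]); split.
    + intros [D0 [D1 [D2 D3]]]; apply Hn; auto.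
    + intros k; specialize (He (k + e)%nat).
      rewrite Hd, E in He; set (F := diag_cubic _ _) in *.
      rewrite Nat2Z.inj_add, Z.pow_add_r, (Z.mul_comm (p ^ Z.of_nat k)), <- Z.mul_assoc in He by lia.
      apply Z.mul_divide_cancel_l in He; [|assert (Hpe := pow_nat_pos p e); lia].
      apply Gauss with u; auto.
      apply rel_prime_sym, rel_prime_Zpower_r; [lia|].
      now apply rel_prime_sym, prime_rel_prime.
  - exists x0, x1, x2, x3; do 5 (split; auto).
    intros k; rewrite Hd; apply Z.divide_mul_r, He.
Qed.

Lemma homogeneous_adelic : homogeneous adelic_soluble.
Proof.
  intros c a Hc; unfold adelic_soluble; split; intros [_ H]; split;
    try apply real_soluble_always; intros p Hp; specialize (H p Hp); revert H;
    now apply padic_soluble_scale.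
Qed.

Lemma adelic_soluble_0 : adelic_soluble (0, 0, 0, 0)%Z.
Proof.
  split; [apply real_soluble_always|]; intros p Hp; now apply padic_soluble_zero.
Qed.

Lemma count_points_primitive_count B Q : 0 <= B ->
  INR (count_points B Q) = primitive_count Q (Z.to_nat (up B - 1)).
Proof.
  intros HB; unfold count_points, primitive_count; rewrite <- lsum_ind_filter.
  destruct (archimed B) as [U1 U2].
  assert (U0 : (0 < up B)%Z) by (apply lt_IZR; lra).
  (* [up B] is strictly larger than [B], so [up B - 1] is the floor of [B]. *)
  assert (Hh : forall z, (z <= up B - 1)%Z <-> IZR z <= B).
  { intros z; split; intros H.
    - apply IZR_le in H; rewrite minus_IZR in H; lra.
    - assert (z < up B)%Z by (apply lt_IZR; lra); lia. }
  apply lsum_ind_bij with (h := fun a => a); try apply NoDup_box; auto.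
  - intros a Ha [HP [Hht HQ]]; split; auto.
    apply in_box; apply Hh in Hht; lia.
  - intros a Ha [HP HQ]; exists a; apply in_box in Ha; split; [apply in_box; lia|].
    split; auto; split; [|split]; auto; apply Hh; lia.
Qed.

(** The term [eta * n^4] comes from the density for large [n]; [K * n^2] absorbs the small [n] and
    the constant. Both exponents are at least 2, as the hypothesis on [w (n / d)] in the inversion
    demands. *)
Lemma primitive_density L : Un_cv partial_prod L -> forall eta, 0 < eta ->
  exists K, 0 <= K /\ forall n, (1 <= n)%nat ->
  Rabs (primitive_count adelic_soluble n - sigma_3 * L * primitive_count (fun _ => True) n)
    <= 4 * (eta * INR n ^ 4 + K * INR n ^ 2).
Proof.
  intros HL eta Heta; set (s := sigma_3 * L).
  (* For [n >= 1] one has [vol n ^ 4 <= 81 n^4]; passing to positive vectors halves this, and [81/2]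
     is below 41. *)
  destruct (adelic_density L HL (eta / 41)) as [N HN]; [lra|]; fold s in HN.
  (* Dominates the trivial bound on the error for every [n < N]. *)
  set (K := (1 + Rabs s) * vol N ^ 4).
  assert (Hs := Rabs_pos s); assert (VN := vol_pos N).
  assert (VN4 : 1 <= vol N ^ 4) by now apply pow_R1_Rle.
  assert (HK : 1 + Rabs s <= K) by (unfold K; nra).
  exists K; split; [lra|].
  set (D := fun n => primitive_count adelic_soluble n - s * primitive_count (fun _ => True) n).
  set (E := fun n => affine_count adelic_soluble n - s * affine_count (fun _ => True) n).
  intros n Hn; apply (divisor_sum_inversion_bound D E (fun n => eta * INR n ^ 4 + K * INR n ^ 2)); auto.
  - intros k Hk; unfold E, D.
    rewrite (affine_count_by_gcd _ k homogeneous_adelic), (affine_count_by_gcd _ k homogeneous_True).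
    now rewrite lsum_minus, lsum_scal.
  - clear n Hn; intros n Hn; assert (Hn' : 1 <= INR n) by now apply (le_INR 1).
    assert (T := affine_count_half _ n homogeneous_adelic adelic_soluble_0).
    assert (V := vol_pos n); assert (V4 := vol4_pos n).
    set (A := lsum (box n) (fun a => indic (adelic_soluble a))) in *.
    assert (EE : E n = (A - s * vol n ^ 4 - (1 - s)) / 2).
    { unfold E; rewrite affine_count_True; lra. }
    assert (N2 : 1 <= INR n ^ 2) by now apply pow_R1_Rle.
    assert (N4 : 1 <= INR n ^ 4) by now apply pow_R1_Rle.
    assert (S1 : Rabs (1 - s) <= 1 + Rabs s).
    { eapply Rle_trans; [apply Rabs_triang|]; rewrite Rabs_R1, Rabs_Ropp; lra. }
    assert (Bd : Rabs (E n) <= (Rabs (A - s * vol n ^ 4) + (1 + Rabs s)) / 2).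
    { rewrite EE; unfold Rdiv; rewrite Rabs_mult, (Rabs_right (/ 2)) by lra.
      apply Rmult_le_compat_r; [lra|].
      eapply Rle_trans; [apply Rabs_triang|]; rewrite Rabs_Ropp; lra. }
    destruct (Nat.le_gt_cases N n) as [Hge|Hlt].
    + specialize (HN n Hge); fold A in HN; unfold Rdist in HN.
      assert (X : Rabs (A - s * vol n ^ 4) <= eta / 41 * vol n ^ 4).
      { replace (A - s * vol n ^ 4) with ((A / vol n ^ 4 - s) * vol n ^ 4) by (field; lra).
        rewrite Rabs_mult, (Rabs_right (vol n ^ 4)) by lra.
        apply Rmult_le_compat_r; lra. }
      assert (Y : vol n ^ 4 <= 81 * INR n ^ 4).
      { replace (81 * INR n ^ 4) with ((3 * INR n) ^ 4) by ring.
        apply pow_incr; rewrite vol_eq; lra. }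
      assert (eta / 41 * vol n ^ 4 <= eta / 41 * (81 * INR n ^ 4))
        by (apply Rmult_le_compat_l; lra).
      nra.
    + assert (VV : vol n ^ 4 <= vol N ^ 4).
      { apply pow_incr; split; [lra|]; rewrite !vol_eq.
        assert (INR n <= INR N) by (apply le_INR; lia); lra. }
      assert (A0 : 0 <= A <= vol n ^ 4).
      { split; [apply lsum_nonneg; intros; apply ind_bounds|].
        assert (T' := affine_count_half (fun _ => True) n homogeneous_True I).
        rewrite affine_count_True in T'.
        apply Rle_trans with (lsum (box n) (fun _ => indic True)); [|lra].
        apply lsum_le; intros a; now apply ind_le. }
      assert (X : Rabs (A - s * vol n ^ 4) <= (1 + Rabs s) * vol N ^ 4).
      { eapply Rle_trans; [apply Rabs_triang|]; rewrite Rabs_Ropp, Rabs_mult.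
        rewrite (Rabs_right A), (Rabs_right (vol n ^ 4)) by lra; nra. }
      fold K in X; nra.
  - intros k d Hd.
    assert (P4 := pow_div_le k d 2 ltac:(lia)); assert (P2 := pow_div_le k d 0 ltac:(lia)).
    cbn [Nat.add] in P4, P2.
    replace ((eta * INR k ^ 4 + K * INR k ^ 2) / INR d ^ 2) with
      (eta * (INR k ^ 4 / INR d ^ 2) + K * (INR k ^ 2 / INR d ^ 2)) by (unfold Rdiv; ring).
    apply Rplus_le_compat; apply Rmult_le_compat_l; lra.
Qed.

Theorem theorem2p2 :
  exists L : R,
    Un_cv partial_prod L /\
    (forall eps : R, (eps > 0)%R ->
       exists B0 : R, forall B : R, (B >= B0)%R ->
         (Rabs (density_ratio B - sigma_3 * L) < eps)%R).
Proof.
  destruct partial_prod_cv as [L HL]; exists L; split; auto.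
  intros eps Heps.
  (* Once [K x^2 <= eps/32 x^4], the error is at most [4 * (eps/16) x^4 = eps/4 x^4], below [eps]
     times the lower bound [x^4 / 2] for the number of points. *)
  destruct (primitive_density L HL (eps / 32)) as [K [HK Hd]]; [lra|].
  destruct (archimed_cor1 (eps / (32 * (K + 1)))) as [N [HN HN0]].
  { apply Rdiv_lt_0_compat; lra. }
  exists (INR N + 2); intros B HB; unfold density_ratio.
  assert (N0 := pos_INR N).
  rewrite !count_points_primitive_count by lra.
  destruct (archimed B) as [U1 U2].
  set (n := Z.to_nat (up B - 1)).
  assert (Hn : INR N + 1 <= INR n).
  { assert (Hup : (Z.of_nat N + 1 < up B)%Z)
      by (apply lt_IZR; rewrite plus_IZR, <- INR_IZR_INZ; lra).
    rewrite <- S_INR; apply le_INR; unfold n; lia. }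
  assert (Hn1 : (1 <= n)%nat) by (apply INR_le; simpl INR at 1; lra).
  specialize (Hd n Hn1); assert (Hl := primitive_count_lower n Hn1).
  set (P := primitive_count (fun _ => True) n) in *.
  set (S := primitive_count adelic_soluble n) in *; set (s := sigma_3 * L) in *.
  set (x := INR n) in *.
  assert (X4 : 1 <= x ^ 4) by (apply pow_R1_Rle; lra).
  replace (S / P - s) with ((S - s * P) / P) by (field; lra).
  unfold Rdiv; rewrite Rabs_mult, (Rabs_right (/ P))
    by (apply Rle_ge, Rlt_le, Rinv_0_lt_compat; lra).
  apply Rmult_lt_reg_r with P; [lra|].
  rewrite Rmult_assoc, Rinv_l, Rmult_1_r by lra.
  apply Rle_lt_trans with (1 := Hd).
  assert (HNpos : 0 < INR N) by now apply lt_0_INR.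
  assert (HKx : K <= eps / 32 * x).
  { apply Rmult_lt_compat_r with (r := INR N * (32 * (K + 1))) in HN; [|nra].
    replace (/ INR N * (INR N * (32 * (K + 1)))) with (32 * (K + 1)) in HN by (field; lra).
    replace (eps / (32 * (K + 1)) * (INR N * (32 * (K + 1)))) with (eps * INR N) in HN
      by (field; lra).
    nra. }
  assert (HK2 : K * x ^ 2 <= eps / 32 * x ^ 4).
  { replace (x ^ 4) with (x * x * x ^ 2) by ring.
    rewrite <- Rmult_assoc; apply Rmult_le_compat_r; [apply pow_le; lra|].
    assert (0 <= eps / 32 * x) by nra; nra. }
  nra.
Qed.
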